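(* Let $n\in\mathbb N_0$ and $\lambda\in\mathbb C\setminus(-\infty,-\frac14)$. For a measurable function $g:\partial\mathbb D\to\mathbb C$, respectively a complex Borel measure $\nu$ on $\partial\mathbb D$, let $f(z)=\boldsymbol\Pi_{n,\lambda}g(z)$, respectively $f(z)=\boldsymbol\Pi_{n,\lambda}\nu(z)$. Then the following hold. (i) If $g\in C(\partial\mathbb D)$ then $\lim_{z\to\xi}\frac{f(z)}{\Phi_n(z\,|\,\lambda)}=g(\xi)$ for all $\xi\in\partial\mathbb D$, and uniformly as $|z|\to1$. (ii) If $g\in L^p(\partial\mathbb D)$ with $1\le p<\infty$ then $\lim_{r\to1}\frac{f(r\xi)}{\Phi_n(r\,|\,\lambda)}=g(\xi)$ for almost every $\xi\in\partial\mathbb D$ and in $L^p(\partial\mathbb D)$. (iii) If $g\in L^\infty(\partial\mathbb D)$ then $\lim_{r\to1}\frac{f(r\xi)}{\Phi_n(r\,|\,\lambda)}=g(\xi)$ in the weak*-topology of $L^\infty(\partial\mathbb D)$. (iv) If $\nu$ is a finite Borel measure on $\partial\mathbb D$ then the measures $\frac{f(r\xi)}{\Phi_n(r\,|\,\lambda)}\,d\xi$ converge to $\nu$ in the weak*-topology as $r\to1$.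
   Context: $\mathbb D$ is the open unit disk in $\mathbb C$, $\partial\mathbb D$ the unit circle, $\mathbb N_0=\{0,1,2,\dots\}$; $d\xi$ denotes the normalised Lebesgue measure $\mathsf m$ on $\partial\mathbb D$, and $L^p(\partial\mathbb D)$ is taken with respect to it. The Poisson kernel is $P(z,\xi)=\frac{1-|z|^2}{|\xi-z|^2}$, and $\mathfrak h(z,\xi)=-\log P(z,\xi)$. For $\lambda\in\mathbb C$, $s(\lambda)=\sqrt{\lambda+\frac14}$, where the square root of $re^{i\phi}$ ($r\ge0$, $\phi\in(-\pi,\pi]$) is $\sqrt r\,e^{i\phi/2}$. Define $P_n(z,\xi\,|\,\lambda)=\frac{1}{n!(2s(\lambda))^n}(-\mathfrak h(z,\xi))^nP(z,\xi)^{s(\lambda)+1/2}$ if $\lambda\ne-\frac14$, and $P_n(z,\xi\,|-\frac14)=\frac1{(2n)!}\mathfrak h(z,\xi)^{2n}P(z,\xi)^{1/2}$. The polyspherical function is $\Phi_n(z\,|\,\lambda)=\int_{\partial\mathbb D}P_n(z,\xi\,|\,\lambda)\,d\xi$; it depends only on $|z|$, and for $\lambda\in\mathbb C\setminus(-\infty,-\frac14)$ it has no zeroes for $|z|$ sufficiently close to $1$. The transforms are $\boldsymbol\Pi_{n,\lambda}\nu(z)=\int_{\partial\mathbb D}P_n(z,\xi\,|\,\lambda)\,d\nu(\xi)$ and $\boldsymbol\Pi_{n,\lambda}g(z)=\int_{\partial\mathbb D}P_n(z,\xi\,|\,\lambda)\,g(\xi)\,d\xi$, $z\in\mathbb D$.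 All quotients are considered for $|z|$, respectively $r$, close to $1$. *)

(* Defs.v *)
From HB Require Import structures.
From mathcomp Require Import all_boot all_order all_algebra.
From mathcomp Require Import complex ring lra.
From mathcomp Require Import all_classical all_reals all_analysis.
From mathcomp Require Import measurable_realfun.

Set Implicit Arguments.
Unset Strict Implicit.
Unset Printing Implicit Defensive.
Import Order.TTheory GRing.Theory Num.Theory.
Import numFieldNormedType.Exports.

Local Open Scope classical_set_scope.
Local Open Scope complex_scope.
Local Open Scope ring_scope.


(* the real-valued modulus; `|z| has values in R[i] *)
Notation cabs := ComplexField.Normc.normc.

Section complex_functions.
Variable R : realType.
Implicit Types (x : R) (w : R[i]^o).

Definition cexp w : R[i]^o :=
  (expR (complex.Re w) * cos (complex.Im w)) +i* (expR (complex.Re w) * sin (complex.Im w)).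

(* x ^ w for x > 0 *)
Definition cpow x w : R[i]^o := cexp (w * (ln x)%:C).

(* The principal square root is the library's [sqrtc]. *)
Lemma sqrtc_polar (r phi : R) : 0 <= r -> - pi < phi -> phi <= pi ->
  sqrtc (r%:C * cexp (0 +i* phi)) =
  (Num.sqrt r)%:C * cexp (0 +i* (phi / 2)).
Proof.
move=> r0 phil phir.
have c2 : cos phi = cos (phi / 2) ^+ 2 - sin (phi / 2) ^+ 2.
  by rewrite {1}(splitr phi) cosD !expr2.
have s2 : sin phi = 2 * (sin (phi / 2) * cos (phi / 2)).
  rewrite {1}(splitr phi) sinD mulr2n mulrDl mul1r; congr (_ + _).
  by rewrite mulrC.
have e1 : cos (phi / 2) ^+ 2 + sin (phi / 2) ^+ 2 = 1 := cos2Dsin2 _.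
have cge0 : 0 <= cos (phi / 2) by apply: cos_ge0_pihalf; lra.
rewrite /sqrtc /cexp /= !expR0 !mul1r !mul0r !addr0 !subr0.
have -> : (r * cos phi) ^+ 2 + (r * sin phi) ^+ 2 = r ^+ 2.
  by rewrite !exprMn -mulrDr cos2Dsin2 mulr1.
rewrite sqrtr_sqr (ger0_norm r0).
have -> : (r + r * cos phi) / 2 = r * cos (phi / 2) ^+ 2.
  by rewrite c2; set c := cos _ in e1 *; set s := sin _ in e1 *; nra.
have -> : (r - r * cos phi) / 2 = r * sin (phi / 2) ^+ 2.
  by rewrite c2; set c := cos _ in e1 *; set s := sin _ in e1 *; nra.
rewrite !(sqrtrM _ r0) !sqrtr_sqr (ger0_norm cge0).
apply/eqP; rewrite eq_complex /=; apply/andP; split; first by apply/eqP; ring.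
rewrite !mul0r addr0; apply/eqP.
have [->|rn0] := eqVneq r 0; first by rewrite sqrtr0 !(mul0r, mulr0).
have rgt0 : 0 < r by rewrite lt_def rn0.
rewrite mulf_eq0 (negbTE rn0) /=.
rewrite mulrCA; congr (_ * _).
have [phi0|phi0|phi0] := ltgtP phi 0.
- have shn : sin (phi / 2) < 0.
    rewrite -oppr_gt0 -sinN; apply: sin_gt0_pi; apply/andP; split; lra.
  have chp : 0 < cos (phi / 2).
    apply: cos_gt0_pihalf; apply/andP; split; lra.
  have sn : sin phi < 0 by rewrite s2; nra.
  by rewrite lt_eqF // ltr0_sg ?pmulr_rlt0 // ltr0_norm // mulN1r opprK.
- have shp : 0 < sin (phi / 2).
    apply: sin_gt0_pi; apply/andP; split; lra.
  have sp : 0 <= sin phi by rewrite s2; nra.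
  rewrite (gtr0_norm shp); case: eqP => [_|/eqP sn0]; first by rewrite mul1r.
  by rewrite gtr0_sg ?mul1r // pmulr_rgt0 // lt_def sn0.
- by rewrite phi0 mul0r sin0 normr0 mulr0.
Qed.

End complex_functions.

Section circle.
Variable R : realType.

Definition disk : set (R[i]^o) := [set z | cabs z < 1].

Definition circle : Type := set_type [set z : R[i]^o | cabs z = 1].

HB.instance Definition _ := Choice.on circle.
HB.instance Definition _ := Uniform.on circle.

Definition angle (t : R) : R[i]^o := cos t +i* sin t.

Lemma angle_circle t : angle t \in [set z : R[i]^o | cabs z = 1].
Proof. by rewrite inE /= cos2Dsin2 sqrtr1. Qed.

Definition expi (t : R) : circle := SigSub (angle_circle t).

HB.instance Definition _ := isPointed.Build circle (expi 0).

(* the Borel sigma-algebra *)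
HB.instance Definition _ :=
  Measurable.copy circle (g_sigma_algebraType (@open circle)).

Lemma expi_continuous : continuous expi.
Proof.
apply: continuous_comp_initial => t; apply/cvgrPdist_lt => e e0.
move: e0; rewrite ltcE /= => /andP[/eqP ie re].
have r2 : 0 < complex.Re e / 2 by rewrite divr_gt0.
have /cvgrPdist_lt/(_ _ r2) ct := @continuous_cos R t.
have /cvgrPdist_lt/(_ _ r2) st := @continuous_sin R t.
near=> s.
have cs : `|cos t - cos s| < complex.Re e / 2 by near: s; exact: ct.
have ss : `|sin t - sin s| < complex.Re e / 2 by near: s; exact: st.
rewrite /= ltcE /= ie eqxx /=.
apply: (@le_lt_trans _ _ (`|cos t - cos s| + `|sin t - sin s|)); last by lra.
have -> : `|cos t - cos s| + `|sin t - sin s| =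
    Num.sqrt ((`|cos t - cos s| + `|sin t - sin s|) ^+ 2).
  by rewrite sqrtr_sqr [RHS]ger0_norm ?addr_ge0.
rewrite ler_sqrt ?sqr_ge0 //.
have nK (x : R) : `|x| ^+ 2 = x ^+ 2 by rewrite real_normK ?num_real.
rewrite -[(cos t - cos s) ^+ 2]nK -[(sin t - sin s) ^+ 2]nK.
have : 0 <= `|cos t - cos s| by []. have : 0 <= `|sin t - sin s| by [].
by nra.
Unshelve. all: by end_near. Qed.

Lemma measurable_expi :
  measurable_fun [set: measurableTypeR R] (expi : measurableTypeR R -> circle).
Proof.
apply: (measurability (@open circle)) => // _ [U oU <-].
rewrite setTI; apply: open_measurable.
by move/continuousP : expi_continuous; apply.
Qed.

Lemma twopi_gt0 : 0 < 2 * pi :> R.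
Proof. by rewrite mulr_gt0 ?pi_gt0. Qed.

Definition expi_mfun : {mfun measurableTypeR R >-> circle} :=
  HB.pack expi (isMeasurableFun.Build _ _ (measurableTypeR R) circle expi
    measurable_expi).

(* normalised Lebesgue measure, as the law of exp(i t) for t uniform on
   [0, 2 pi] *)
Definition mT : probability circle R :=
  distribution (uniform_prob twopi_gt0) expi_mfun.

End circle.

Section integrals.
Context {d : measure_display} {T : measurableType d} {R : realType}.

Definition cintegral (mu : {measure set T -> \bar R}) (h : T -> R[i]^o) :
    R[i]^o :=
  (\int[mu]_x complex.Re (h x)) +i* (\int[mu]_x complex.Im (h x)).

Section charge_integral.
Variable nu : {charge set T -> \bar R}.

Definition hahn_pos : set T := projT1 (cid (Hahn_decomposition nu)).

Definition hahn_neg : set T :=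
  projT1 (cid (projT2 (cid (Hahn_decomposition nu)))).

Lemma hahn_posneg : hahn_decomposition nu hahn_pos hahn_neg.
Proof. exact: projT2 (cid (projT2 (cid (Hahn_decomposition nu)))). Qed.

Definition charge_integral (h : T -> R[i]^o) : R[i]^o :=
  cintegral (jordan_pos hahn_posneg) h - cintegral (jordan_neg hahn_posneg) h.

End charge_integral.

(* nu = nu1 + i nu2 with nu1, nu2 finite signed measures *)
Record cmeasure := CMeasure {
  cmeasure_re : {charge set T -> \bar R} ;
  cmeasure_im : {charge set T -> \bar R} }.

Definition cm_integral (nu : cmeasure) (h : T -> R[i]^o) : R[i]^o :=
  charge_integral (cmeasure_re nu) h
  + (0 +i* 1) * charge_integral (cmeasure_im nu) h.

(* the complex measure F dmu, by convention 0 if F is not integrable *)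
Definition cdensity (mu : {measure set T -> \bar R}) (F : T -> R[i]^o) :
    cmeasure :=
  match pselect (mu.-integrable setT (fun x => (complex.Re (F x))%:E)),
        pselect (mu.-integrable setT (fun x => (complex.Im (F x))%:E)) with
  | left iRe, left iIm => CMeasure (induced_charge iRe) (induced_charge iIm)
  | _, _ => CMeasure czero czero
  end.

End integrals.
Arguments cmeasure {d} T R.

Section spaces.
Variable R : realType.
Implicit Types (p : \bar R) (g : circle R -> R[i]^o).

Definition Lp p g : Prop :=
  measurable_fun [set: circle R] (g : _ -> g_sigma_algebraType (@open R[i]^o))
  /\ (Lnorm (mT R) p (fun xi => (cabs (g xi))%:E) < +oo)%E.

(* The following describe limits of functions F r as r -> 1-; F r has to belong
   to the space under consideration for r close to 1 only. *)

Definition Lp_cvg p (F : R -> circle R -> R[i]^o) g : Prop :=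
  (\forall r \near 1^'-, Lp p (F r)) /\
  Lnorm (mT R) p (fun xi => (cabs (F r xi - g xi))%:E) @[r --> 1^'-] --> 0%E.

(* weak* convergence in L^oo, the dual of L^1 *)
Definition Linfty_weakstar_cvg (F : R -> circle R -> R[i]^o) g : Prop :=
  (\forall r \near 1^'-, Lp +oo%E (F r)) /\
  forall h, Lp 1%E h ->
    (cintegral (mT R) (fun xi => h xi * F r xi) : R[i]^o) @[r --> 1^'-] -->
    (cintegral (mT R) (fun xi => h xi * g xi) : R[i]^o).

(* weak* convergence of complex measures, as the dual of C(circle) *)
Definition measure_weakstar_cvg (nu_ : R -> cmeasure (circle R) R)
    (nu : cmeasure (circle R) R) : Prop :=
  forall h : circle R -> R[i]^o, continuous h ->
    cm_integral (nu_ r) h @[r --> 1^'-] --> cm_integral nu h.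

End spaces.

Section polyspherical.
Variable R : realType.
Implicit Types (n : nat) (lam z : R[i]^o) (xi : circle R).

Definition poisson z xi : R :=
  (1 - cabs z ^+ 2) / cabs (set_val xi - z) ^+ 2.

Definition horo z xi : R := - ln (poisson z xi).

Definition spar lam : R[i]^o := sqrtc (lam + 4^-1).

Definition Pn n lam z xi : R[i]^o :=
  if lam == - 4^-1 then
    ((2 * n)%N`!)%:R^-1 * (horo z xi)%:C ^+ (2 * n)%N * cpow (poisson z xi) 2^-1
  else
    (n`!%:R * (2 * spar lam) ^+ n)^-1 * (- (horo z xi)%:C) ^+ n
      * cpow (poisson z xi) (spar lam + 2^-1).

Definition Phi n lam z : R[i]^o := cintegral (mT R) (Pn n lam z).

Definition Pi_fun n lam (g : circle R -> R[i]^o) z : R[i]^o :=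
  cintegral (mT R) (fun xi => Pn n lam z xi * g xi).

Definition Pi_meas n lam (nu : cmeasure (circle R) R) z : R[i]^o :=
  cm_integral nu (Pn n lam z).

(* f(r xi) / Phi_n(r | lam) *)
Definition radial n lam (f : R[i]^o -> R[i]^o) (r : R) xi : R[i]^o :=
  f (r%:C * set_val xi) / Phi n lam r%:C.

End polyspherical.

(* Main.v *)
(** The kernel is [P_n = F (log P)] with [F u] a multiple of [u ^ k * exp ((s + 1/2) u)], so by
    rotation invariance [Phi_n] is a mean over the circle of a function of [u = log P].
    Along a circle of radius [r], [u] satisfies a second order differential equation;
    integrating by parts yields three-term recursions for the means [J a] of [P ^ a], and
    from them a lower bound of [|Phi_n|] by a multiple of [L ^ k * J a], where
    [L = log ((1 + r) / (1 - r))] bounds [|u|] and [a = Re s + 1/2 >= 1/2].  Hence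
    [|P_n / Phi_n| <= K * Q] for the probability kernel [Q = P ^ a / J a], which is
    radially decreasing, symmetric and concentrates at the boundary point.  This gives
    (i).  At a Lebesgue point of [g] the layer cake decomposition of [Q] into averages
    over arcs gives pointwise convergence.  Convergence in [L ^ p] then follows by
    dominated convergence with the varying majorants [\int Q |g| ^ p] (Jensen), whose
    integrals do not depend on [r] because [Q] is symmetric; (iii) is dominated
    convergence, and (iv) reduces to (i) by Fubini and the symmetry of [P_n]. *)

Require Import Defs.
From HB Require Import structures.
From mathcomp Require Import all_boot all_order all_algebra.
From mathcomp Require Import complex ring lra.
From mathcomp Require Import all_classical all_reals all_analysis.
From mathcomp Require Import measurable_realfun.

Set Implicit Arguments.
Unset Strict Implicit.
Unset Printing Implicit Defensive.
Import Order.TTheory GRing.Theory Num.Theory.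
Import numFieldNormedType.Exports.

Local Open Scope classical_set_scope.
Local Open Scope complex_scope.
Local Open Scope ring_scope.

(** The obstacle is cancellation: for non-real [s] the kernel oscillates like [P ^ (i tau)], and
    dividing by [Phi_n] requires [|Phi_n|] to be as large as the mean of [|P_n|]. For exponents [a]
    large compared with [tau], [P ^ a] is so concentrated at its peak that the phase is almost
    constant there; the recursions, which are those of the Legendre functions of degree
    [a + i tau - 1] at [cosh L], then carry the lower bound down by unit steps to every [a > 1/2].
    They stop there: at [a = 1/2], which occurs only for [lam = -1/4], the coefficient [2 a - 1]
    vanishes and [J a] has order [L exp (- L / 2)]. This endpoint is treated by hand; there [tau] is
    zero and the power of [u] is even, so nothing cancels. For [a > 1/2] the factor [u ^ k] may be
    replaced by [L ^ k], because [L - u] has bounded mean with respect to [P ^ a / J a]. All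
    concentration of [Q] comes from one fact: [J a] exceeds [exp (- a L)], the size of [P ^ a] away
    from the peak, at least by a constant times [L]. *)

Section complex_modulus.
Variable R : realType.
Implicit Types w : R[i]^o.

Lemma sqr_cabs w : cabs w ^+ 2 = complex.Re w ^+ 2 + complex.Im w ^+ 2.
Proof. by case: w => a b /=; rewrite sqr_sqrtr // addr_ge0 ?sqr_ge0. Qed.

Lemma cabs_ge0 w : 0 <= cabs w.
Proof. by case: w => a b /=; rewrite sqrtr_ge0. Qed.

Lemma cabsD w1 w2 : cabs (w1 + w2) <= cabs w1 + cabs w2.
Proof. exact: le_normcD. Qed.

Lemma cabsM w1 w2 : cabs (w1 * w2) = cabs w1 * cabs w2.
Proof. exact: ComplexField.Normc.normcM. Qed.

Lemma cabsN w : cabs (- w) = cabs w.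
Proof. exact: normcN. Qed.

Lemma cabsB w1 w2 : cabs (w1 - w2) = cabs (w2 - w1).
Proof. by rewrite -cabsN opprB. Qed.

Lemma cabsV w : cabs w^-1 = (cabs w)^-1.
Proof. exact: ComplexField.Normc.normcV. Qed.

Lemma cabsR (x : R) : cabs (x%:C) = `|x|.
Proof. by rewrite /= expr0n addr0 sqrtr_sqr. Qed.

Lemma cabs0 : cabs (0 : R[i]) = 0.
Proof. exact: ComplexField.Normc.normc0. Qed.

Lemma cabs_eq0 w : (cabs w == 0) = (w == 0).
Proof.
by apply/eqP/eqP => [/ComplexField.Normc.eq0_normc //|->]; rewrite cabs0.
Qed.

Lemma cabs_gt0 w : (0 < cabs w) = (w != 0).
Proof. by rewrite lt_def cabs_ge0 cabs_eq0 andbT. Qed.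

Lemma ReD w1 w2 : complex.Re (w1 + w2) = complex.Re w1 + complex.Re w2.
Proof. by case: w1 w2 => ? ? []. Qed.

Lemma ImD w1 w2 : complex.Im (w1 + w2) = complex.Im w1 + complex.Im w2.
Proof. by case: w1 w2 => ? ? []. Qed.

Lemma ReN w : complex.Re (- w) = - complex.Re w.
Proof. by case: w. Qed.

Lemma ImN w : complex.Im (- w) = - complex.Im w.
Proof. by case: w. Qed.

Lemma ReM w1 w2 : complex.Re (w1 * w2) =
  complex.Re w1 * complex.Re w2 - complex.Im w1 * complex.Im w2.
Proof. by case: w1 w2 => ? ? []. Qed.

Lemma ImM w1 w2 : complex.Im (w1 * w2) =
  complex.Re w1 * complex.Im w2 + complex.Im w1 * complex.Re w2.
Proof. by case: w1 w2 => ? ? [] * /=; rewrite addrC [in RHS]addrC addrC. Qed.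

Lemma cabs_Re w : `|complex.Re w| <= cabs w.
Proof.
case: w => a b /=; rewrite -sqrtr_sqr ler_wsqrtr // lerDl; exact: sqr_ge0.
Qed.

Lemma cabs_Im w : `|complex.Im w| <= cabs w.
Proof.
case: w => a b /=; rewrite -sqrtr_sqr ler_wsqrtr // lerDr; exact: sqr_ge0.
Qed.

Lemma cabs_le_ReIm w : cabs w <= `|complex.Re w| + `|complex.Im w|.
Proof.
rewrite -ler_sqr ?nnegrE ?cabs_ge0 ?addr_ge0 // sqr_cabs.
rewrite -[complex.Re w ^+ 2]real_normK ?num_real //.
rewrite -[complex.Im w ^+ 2]real_normK ?num_real //.
have : 0 <= `|complex.Re w| * `|complex.Im w| by rewrite mulr_ge0.
nra.
Qed.

Lemma normc_cabs w : `|w| = (cabs w)%:C.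
Proof. by case: w. Qed.

(** The norm of [R[i]] has values in [R[i]], where only numbers with equal imaginary parts compare;
    this criterion with a real [e] is used instead for complex limits. *)
Lemma cvgcP (T : Type) (F : set_system T) (FF : Filter F) (f : T -> R[i]^o) l :
  f @ F --> l <-> forall e : R, 0 < e -> \forall x \near F, cabs (f x - l) < e.
Proof.
split.
- move=> /cvgrPdist_lt fl e e0.
  have := fl e%:C; rewrite ltcR => /(_ e0); apply: filterS => x.
  by rewrite normc_cabs ltcR cabsB.
- move=> fl; apply/cvgrPdist_lt => e; rewrite ltcE /= => /andP[/eqP ie re].
  have := fl _ re; apply: filterS => x.
  by rewrite /= normc_cabs ltcE /= ie eqxx /= -cabsB.
Qed.

Lemma near_cabs (z : R[i]^o) (e : R) : 0 < e ->
  \forall w \near z, cabs (w - z) < e.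
Proof. by move=> e0; have /cvgcP := @cvg_id _ (nbhs z); exact. Qed.

Lemma nbhs_cabs (z : R[i]^o) (A : set (R[i]^o)) : nbhs z A ->
  exists2 e : R, 0 < e & forall w, cabs (w - z) < e -> A w.
Proof.
move=> /nbhs_ballP[e /= e0 eA].
move: e0; rewrite ltcE /= => /andP[/eqP ie re].
exists (complex.Re e) => // w wz; apply: eA.
by rewrite -ball_normE /ball_ /= normc_cabs ltcE /= ie eqxx -cabsB.
Qed.

Lemma continuous_Re : continuous (@complex.Re R : R[i]^o -> R).
Proof.
move=> z; apply/cvgrPdist_lt; first exact: nbhs_filter.
move=> e e0; have := near_cabs z e0; apply: filterS => w.
rewrite cabsB; apply: le_lt_trans.
by rewrite -ReN -ReD; exact: cabs_Re.
Qed.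

Lemma continuous_Im : continuous (@complex.Im R : R[i]^o -> R).
Proof.
move=> z; apply/cvgrPdist_lt; first exact: nbhs_filter.
move=> e e0; have := near_cabs z e0; apply: filterS => w.
rewrite cabsB; apply: le_lt_trans.
by rewrite -ImN -ImD; exact: cabs_Im.
Qed.

End complex_modulus.

Section continuous_complex_functions.
Variables (R : realType) (T : topologicalType).
Implicit Types g : T -> R[i]^o.

Lemma continuous_Re_comp g : continuous g -> continuous (fun x => complex.Re (g x)).
Proof.
move=> cg x; apply: (@continuous_comp T _ _ g (@complex.Re R : R[i]^o -> R)).
  exact: cg.
exact: (@continuous_Re R (g x)).
Qed.

Lemma continuous_Im_comp g : continuous g -> continuous (fun x => complex.Im (g x)).
Proof.
move=> cg x; apply: (@continuous_comp T _ _ g (@complex.Im R : R[i]^o -> R)).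
  exact: cg.
exact: (@continuous_Im R (g x)).
Qed.

End continuous_complex_functions.

(** * The circle: compactness and integration in the angle *)

Section circle_topology.
Variable R : realType.
Notation C := (circle R).
Notation m := (mT R).
Implicit Types (xi : C).

Definition cre (xi : C) : R := complex.Re (set_val xi : R[i]).
Definition cim (xi : C) : R := complex.Im (set_val xi : R[i]).

Lemma cabs_circle xi : cabs (set_val xi) = 1.
Proof. by case: xi => x h; have := h; rewrite [X in X -> _]inE. Qed.

Lemma circle_sqr xi : cre xi ^+ 2 + cim xi ^+ 2 = 1.
Proof. by rewrite -sqr_cabs cabs_circle expr1n. Qed.

Lemma continuous_set_val : continuous (set_val : C -> R[i]^o).
Proof. exact: initial_continuous. Qed.

Lemma continuous_cre : continuous cre.
Proof. exact: continuous_Re_comp continuous_set_val. Qed.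

Lemma continuous_cim : continuous cim.
Proof. exact: continuous_Im_comp continuous_set_val. Qed.

Lemma continuous_circle_measurable (f : C -> R) :
  continuous f -> measurable_fun setT f.
Proof.
move=> cf; apply: (measurability _ (RGenOpens.measurableE R)).
move=> _ [_ [a [b ->]] <-]; rewrite setTI; apply: sub_sigma_algebra.
by move/continuousP : cf; apply; exact: interval_open.
Qed.

Lemma expi_eq (t : R) xi : cos t = cre xi -> sin t = cim xi -> expi t = xi.
Proof.
move=> ct st; apply: val_inj => /=; rewrite /angle ct st /cre /cim.
by case: xi {ct st} => -[a b] h.
Qed.

Lemma expi_surj xi : exists2 t : R, 0 <= t <= 2 * pi & expi t = xi.
Proof.
have e1 := circle_sqr xi.
have a1 : -1 <= cre xi <= 1.
  by have := sqr_ge0 (cim xi); have := sqr_ge0 (cre xi); nra.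
have ac := acosK a1; have as_ := sin_acos a1.
have ax0 := acos_ge0 a1; have axpi := acos_lepi a1.
have s2 : Num.sqrt (1 - cre xi ^+ 2) = `|cim xi|.
  by rewrite -sqrtr_sqr; congr Num.sqrt; lra.
rewrite s2 in as_.
have pi0 := pi_ge0 R.
have [b0|b0] := leP 0 (cim xi).
- exists (acos (cre xi)); first by apply/andP; split=> //; lra.
  by apply: expi_eq => //; rewrite as_ ger0_norm.
- exists (2 * pi - acos (cre xi)); first by apply/andP; split; lra.
  have -> : 2 * pi - acos (cre xi) = - acos (cre xi) + pi *+ 2.
    by rewrite mulr_natl addrC.
  apply: expi_eq.
    by rewrite cosD2pi cosN.
  by rewrite sinD2pi sinN as_ ltr0_norm ?opprK.
Qed.

Lemma compact_circle : compact [set: C].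
Proof.
have -> : [set: C] = @expi R @` `[0, 2 * pi]%classic.
  apply/seteqP; split => // xi _; have [t t0 <-] := expi_surj xi.
  by exists t => //=; rewrite in_itv.
apply: continuous_compact; last exact: segment_compact.
exact/continuous_subspaceT/expi_continuous.
Qed.

Lemma continuous_circle_bounded (f : C -> R) : continuous f ->
  exists2 B : R, 0 < B & forall xi, `|f xi| <= B.
Proof.
move=> cf.
have cf' : {within [set: C], continuous (fun xi => `|f xi|)}.
  apply: continuous_subspaceT => xi.
  by apply: continuous_comp; [exact: cf|exact: norm_continuous].
have [|c _ fc] := compact_EVT_max _ compact_circle cf'.
  by exists (expi 0).
exists (`|f c| + 1) => [|xi]; first by rewrite ltr_wpDl.
by rewrite (le_trans (fc xi (in_setT _))) // lerDl.
Qed.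

Lemma continuous_circle_integrable (mu : {finite_measure set C -> \bar R})
  (f : C -> R) : continuous f -> mu.-integrable setT (EFin \o f).
Proof.
move=> cf; have [B B0 fB] := continuous_circle_bounded cf.
apply: measurable_bounded_integrable => //.
- by rewrite ltey_eq fin_num_measure.
- exact: continuous_circle_measurable.
- exists B; split; first exact: num_real.
  by move=> x Bx y _ /=; rewrite (le_trans (fB _)) // ltW.
Qed.

Lemma mTT : (m [set: C] = 1)%E.
Proof. exact: probability_setT. Qed.

Lemma ge0_integral_mT (f : C -> \bar R) : measurable_fun setT f ->
  (forall xi, 0 <= f xi)%E ->
  (\int[m]_xi f xi =
   ((2 * pi)^-1)%:E * \int[lebesgue_measure]_(t in `[0%R, (2 * pi)%R]) f (expi t))%E.
Proof.
move=> mf f0; rewrite ge0_integral_distribution //.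
rewrite integral_uniform ?subr0 //; last by move=> t; exact: f0.
by apply: (measurableT_comp mf); exact: measurable_expi.
Qed.

Lemma integral_mT_continuous (f : C -> R) : continuous f ->
  \int[m]_xi f xi =
  (2 * pi)^-1 * \int[lebesgue_measure]_(t in `[0, 2 * pi]) f (expi t).
Proof.
move=> cf; have [B B0 fB] := continuous_circle_bounded cf.
have mf := continuous_circle_measurable cf.
have fB0 xi : 0 <= f xi + B by have := fB xi; rewrite ler_norml; lra.
have intf := continuous_circle_integrable m cf.
have intB : m.-integrable setT (EFin \o cst B).
  by apply: continuous_circle_integrable; exact: cst_continuous.
have p0 := twopi_gt0 R.
have cfe : continuous (f \o @expi R).
  by move=> t; apply: continuous_comp; [exact: expi_continuous|exact: cf].
have if1 : lebesgue_measure.-integrable `[0, 2 * pi]%classic (EFin \o (f \o @expi R)).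
  apply: continuous_compact_integrable; first exact: segment_compact.
  exact: continuous_subspaceT.
have iB1 : lebesgue_measure.-integrable `[0, 2 * pi]%classic (EFin \o (cst B : R -> R)).
  apply: continuous_compact_integrable; first exact: segment_compact.
  by apply: continuous_subspaceT; exact: cst_continuous.
(* The change of variables is at hand for nonnegative functions, so it is applied to [f + B], and
   the constant is then cancelled. *)
have : \int[m]_xi (f xi + B) =
  (2 * pi)^-1 * \int[lebesgue_measure]_(t in `[0, 2 * pi]) (f (expi t) + B).
  rewrite /Rintegral ge0_integral_mT; last 2 first.
  - by apply/measurable_EFinP; apply: measurable_funD.
  - by move=> xi; rewrite lee_fin.
  rewrite fineM //.
  apply: integrable_fin_num => //=.
  by apply: (integrableD _ if1 iB1).
rewrite RintegralD // (RintegralD _ if1 iB1) //.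
rewrite !Rintegral_cst // [X in _ + _ * fine X = _]mTT /= mulr1.
rewrite lebesgue_measure_itv /= lte_fin p0 -EFinD /= subr0 mulrDr.
rewrite [B * _]mulrC mulKf ?gt_eqF //.
exact: addIr.
Qed.

End circle_topology.

(* Stated over an abstract [topologicalType]: on [circle R] the filter instances
   of [cvgD] and the like are not found by unification. *)
Section continuous_real_functions.
Variables (R : realType) (T : topologicalType).
Implicit Types f g : T -> R.

Lemma continuous_funD f g : continuous f -> continuous g ->
  continuous (fun x => f x + g x).
Proof. by move=> cf cg x; apply: cvgD; [exact: cf|exact: cg]. Qed.

Lemma continuous_funB f g : continuous f -> continuous g ->
  continuous (fun x => f x - g x).
Proof. by move=> cf cg x; apply: cvgB; [exact: cf|exact: cg]. Qed.

Lemma continuous_funM f g : continuous f -> continuous g ->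
  continuous (fun x => f x * g x).
Proof. by move=> cf cg x; apply: cvgM; [exact: cf|exact: cg]. Qed.

Lemma continuous_funMl (k : R) f : continuous f -> continuous (fun x => k * f x).
Proof. by move=> cf x; apply: cvgM; [exact: cvg_cst|exact: cf]. Qed.

Lemma continuous_funX f n : continuous f -> continuous (fun x => f x ^+ n).
Proof.
move=> cf; elim: n => [|n ih].
  by under eq_fun do rewrite expr0; move=> x; exact: cvg_cst.
by under eq_fun do rewrite exprS; exact: continuous_funM.
Qed.

Lemma continuous_funV f : (forall x, f x != 0) -> continuous f ->
  continuous (fun x => (f x)^-1).
Proof. by move=> f0 cf x; apply: cvgV; [exact: f0|exact: cf]. Qed.

Lemma continuous_fun_comp f (phi : R -> R) : continuous phi -> continuous f ->
  continuous (fun x => phi (f x)).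
Proof.
by move=> cphi cf x; apply: continuous_comp; [exact: cf|exact: cphi].
Qed.

Lemma continuous_fun_ln f : (forall x, 0 < f x) -> continuous f ->
  continuous (fun x => ln (f x)).
Proof.
by move=> f0 cf x; apply: continuous_comp; [exact: cf|exact: continuous_ln].
Qed.

End continuous_real_functions.

(** * The Poisson kernel and integration by parts along a circle *)

Section poisson_kernel.
Variable R : realType.
Notation C := (circle R).
Notation m := (mT R).
Implicit Types (xi : C) (z : R[i]^o) (r : R).

Lemma cabs_sub_circle z xi :
  cabs (set_val xi - z) ^+ 2 =
  1 + cabs z ^+ 2 - 2 * (complex.Re z * cre xi + complex.Im z * cim xi).
Proof.
have := circle_sqr xi.
rewrite !sqr_cabs ReD ReN ImD ImN /cre /cim; lra.
Qed.

Lemma cabs_sub_ge z xi : 1 - cabs z <= cabs (set_val xi - z).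
Proof.
have := cabsD (set_val xi - z) z; rewrite subrK cabs_circle; lra.
Qed.

Lemma cabs_sub_le z xi : cabs (set_val xi - z) <= 1 + cabs z.
Proof.
by have := cabsD (set_val xi) (- z); rewrite cabsN cabs_circle.
Qed.

Lemma cabs_sub_gt0 z xi : cabs z < 1 -> 0 < cabs (set_val xi - z).
Proof. by move=> z1; apply: lt_le_trans (cabs_sub_ge z xi); lra. Qed.

Lemma poisson_gt0 z xi : cabs z < 1 -> 0 < poisson z xi.
Proof.
move=> z1; have := cabs_sub_gt0 xi z1 => h.
have z0 := cabs_ge0 z.
by rewrite /poisson divr_gt0 ?exprn_gt0 //; nra.
Qed.

Lemma poisson_le z xi : cabs z < 1 ->
  poisson z xi <= (1 + cabs z) / (1 - cabs z).
Proof.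
move=> z1; have h := cabs_sub_ge z xi; have z0 := cabs_ge0 z.
have d0 : 0 < 1 - cabs z by lra.
rewrite /poisson ler_pdivrMr ?exprn_gt0 ?cabs_sub_gt0 //.
rewrite [leRHS]mulrAC ler_pdivlMr //.
have : (1 - cabs z) ^+ 2 <= cabs (set_val xi - z) ^+ 2.
  by rewrite ler_sqr ?nnegrE ?cabs_ge0 //; lra.
nra.
Qed.

Lemma poisson_ge z xi : cabs z < 1 ->
  (1 - cabs z) / (1 + cabs z) <= poisson z xi.
Proof.
move=> z1; have h := cabs_sub_le z xi; have z0 := cabs_ge0 z.
have d0 : 0 < 1 + cabs z by lra.
rewrite /poisson ler_pdivlMr ?exprn_gt0 ?cabs_sub_gt0 //.
rewrite mulrAC ler_pdivrMr //.
have : cabs (set_val xi - z) ^+ 2 <= (1 + cabs z) ^+ 2.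
  by rewrite ler_sqr ?nnegrE ?cabs_ge0 //; lra.
nra.
Qed.

Lemma continuous_poisson z : cabs z < 1 -> continuous (poisson z : C -> R).
Proof.
move=> z1; apply: continuous_funMl; apply: continuous_funV.
  by move=> xi; rewrite gt_eqF // exprn_gt0 // cabs_sub_gt0.
under eq_fun do rewrite cabs_sub_circle.
apply: continuous_funB; first exact: cst_continuous.
apply: continuous_funMl; apply: continuous_funD; apply: continuous_funMl.
- exact: continuous_cre.
- exact: continuous_cim.
Qed.

Definition lnP z xi : R := ln (poisson z xi).

Lemma continuous_lnP z : cabs z < 1 -> continuous (lnP z : C -> R).
Proof.
move=> z1; apply: continuous_fun_ln; last exact: continuous_poisson.
by move=> xi; exact: poisson_gt0.
Qed.

Lemma expR_lnP z xi : cabs z < 1 -> expR (lnP z xi) = poisson z xi.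
Proof. by move=> z1; rewrite lnK // posrE poisson_gt0. Qed.

Lemma continuous_comp_lnP (phi : R -> R) z : cabs z < 1 -> continuous phi ->
  continuous (fun xi : C => phi (lnP z xi)).
Proof.
by move=> z1 cphi; apply: continuous_fun_comp cphi _; exact: continuous_lnP.
Qed.

Lemma integrable_comp_lnP (phi : R -> R) z : cabs z < 1 -> continuous phi ->
  m.-integrable setT (EFin \o (fun xi : C => phi (lnP z xi))).
Proof.
by move=> z1 cphi; apply: continuous_circle_integrable; exact: continuous_comp_lnP.
Qed.

Lemma cabs_real r : 0 <= r -> cabs (r%:C : R[i]^o) = r.
Proof. by move=> r0; rewrite cabsR ger0_norm. Qed.

Lemma poisson_expi r t : 0 <= r ->
  poisson r%:C (expi t) = (1 - r ^+ 2) / (1 + r ^+ 2 - 2 * r * cos t).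
Proof.
move=> r0; rewrite /poisson cabs_sub_circle cabs_real // /cre /cim /=.
by rewrite mul0r addr0 mulrA.
Qed.

(* [u = ln P] satisfies [u'' = x P - P ^+ 2] and [u' ^+ 2 = 2 x P - P ^+ 2 - 1]
   with [x = (1 + r ^+ 2) / (1 - r ^+ 2)]; the integrand is the derivative of
   [u' * phi u]. *)
Lemma poisson_ibp r (phi phi' : R -> R) : 0 <= r < 1 ->
  (forall u : R, is_derive u (1 : R) phi (phi' u)) -> continuous phi' ->
  \int[m]_xi (((1 + r ^+ 2) / (1 - r ^+ 2) * poisson r%:C xi - poisson r%:C xi ^+ 2)
       * phi (lnP r%:C xi)
    + (2 * ((1 + r ^+ 2) / (1 - r ^+ 2)) * poisson r%:C xi
       - poisson r%:C xi ^+ 2 - 1) * phi' (lnP r%:C xi)) = 0.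
Proof.
move=> /andP[r0 r1] dphi cphi'.
set x := (1 + r ^+ 2) / (1 - r ^+ 2).
have r2 : 0 < 1 - r ^+ 2 by nra.
have z1 : cabs (r%:C : R[i]^o) < 1 by rewrite cabs_real.
have cphi : continuous phi.
  by move=> u; apply: differentiable_continuous; apply/derivable1_diffP.
have cP := continuous_poisson z1.
have cf : continuous (fun xi : C =>
    ((x * poisson r%:C xi - poisson r%:C xi ^+ 2) * phi (lnP r%:C xi)
    + (2 * x * poisson r%:C xi - poisson r%:C xi ^+ 2 - 1) * phi' (lnP r%:C xi))).
  have cP2 : continuous (fun xi : C => poisson r%:C xi ^+ 2).
    exact: continuous_funX.
  apply: continuous_funD; apply: continuous_funM; try exact: continuous_comp_lnP.
  - by apply: continuous_funB => //; exact: continuous_funMl.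
  - apply: continuous_funB; last exact: cst_continuous.
    by apply: continuous_funB => //; exact: continuous_funMl.
rewrite (integral_mT_continuous cf).
set f := (X in continuous X) in cf.
(* [D t] is the squared distance from [expi t] to [r]; [U] will be [ln P] as a function of the
   angle. *)
pose D t : R := 1 + r ^+ 2 - 2 * r * cos t.
have D0 t : 0 < D t.
  have c1 := cos_le1 t; have : 0 < (1 - r) ^+ 2 by rewrite exprn_gt0 //; lra.
  rewrite /D; nra.
pose U t : R := ln (1 - r ^+ 2) - ln (D t).
have UE t : lnP r%:C (expi t) = U t.
  by rewrite /lnP poisson_expi // ln_div ?posrE //; exact: D0.
pose U' t : R := - (2 * r * sin t / D t).
have dD t : is_derive t (1 : R) D (2 * r * sin t).
  rewrite /D; apply: is_derive_eq; rewrite /GRing.scale /=.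
  by ring.
have dU t : is_derive t (1 : R) U (U' t).
  rewrite /U.
  have dln : is_derive (D t) (1 : R) (@ln R) (D t)^-1 by exact: is_derive1_ln.
  have dlnD := is_derive1_comp dln (dD t).
  apply: is_derive_eq; rewrite /U'; ring.
have PE t : poisson r%:C (expi t) = (1 - r ^+ 2) / D t by rewrite poisson_expi.
have e1 t : 2 * r * cos t = 1 + r ^+ 2 - D t by rewrite /D; ring.
have e2 t : (2 * r * sin t) ^+ 2 = 2 * (1 + r ^+ 2) * D t - D t ^+ 2 - (1 - r ^+ 2) ^+ 2.
  by rewrite exprMn sin2cos2 /D; ring.
have dF t : is_derive t (1 : R) (fun t => U' t * phi (U t)) (f (expi t)).
  have dphi' := dphi (U t).
  have dphiU := is_derive1_comp dphi' (dU t).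
  have Dn0 : D t != 0 by rewrite gt_eqF.
  have dV := is_deriveV Dn0 (dD t).
  have dU' : is_derive t (1 : R) U' (x * ((1 - r ^+ 2) / D t) - ((1 - r ^+ 2) / D t) ^+ 2).
    rewrite /U'; apply: is_derive_eq.
    rewrite /GRing.scale /=.
    transitivity ((2 * r * sin t) ^+ 2 * (D t) ^- 2 - (D t)^-1 * (2 * r * cos t)).
      by ring.
    rewrite e1 e2 /x; field.
    by rewrite Dn0 gt_eqF.
  have -> : f (expi t) = (U' t) * (phi' (U t) * U' t) + phi (U t) * (x * ((1 - r ^+ 2) / D t) - ((1 - r ^+ 2) / D t) ^+ 2).
    rewrite /f PE UE.
    have -> : 2 * x * ((1 - r ^+ 2) / D t) - ((1 - r ^+ 2) / D t) ^+ 2 - 1 = U' t ^+ 2.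
      rewrite /U' sqrrN [in RHS]expr_div_n e2 /x; field.
      by rewrite Dn0 gt_eqF.
    by ring.
  exact: is_deriveM.
rewrite /Rintegral (@continuous_FTC2 _ (f \o @expi R) (fun t => U' t * phi (U t))).
(* The boundary terms vanish because [U'] carries the factor [sin t]. *)
- rewrite /U' mulr_natl sin2pi sin0 !(mulr0, mul0r, oppr0) sube0 /=.
  by rewrite mulr0.
- exact: twopi_gt0.
- apply: continuous_subspaceT => t; apply: continuous_comp.
    exact: expi_continuous.
  exact: cf.
- have dFt t := @ex_derive _ _ _ _ _ _ _ (dF t).
  have cF : continuous (fun t => U' t * phi (U t)).
    by move=> t; apply: differentiable_continuous; apply/derivable1_diffP.
  split; first by move=> t _; exact: dFt.
  - by apply: cvg_at_right_filter; exact: cF.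
  - by apply: cvg_at_left_filter; exact: cF.
- by move=> t _; rewrite derive1E derive_val.
Qed.

End poisson_kernel.

(** * Rotation invariance of the means of functions of [ln P] *)

Section rotation.
Variable R : realType.
Notation C := (circle R).
Notation m := (mT R).
Notation mu := (@lebesgue_measure R).
Implicit Types (xi : C) (z : R[i]^o) (r : R).

Let integrable_seg (H : R -> R) a b : continuous H ->
  mu.-integrable `[a, b]%classic (EFin \o H).
Proof.
move=> cH; apply: continuous_compact_integrable; first exact: segment_compact.
exact: continuous_subspaceT.
Qed.

Lemma Rintegral_shift (H : R -> R) (a b c : R) : continuous H -> a <= b ->
  \int[mu]_(t in `[a, b]) H (t + c) = \int[mu]_(t in `[a + c, b + c]) H t.
Proof.
move=> cH ab.
have dF (t : R) : is_derive t (1 : R) (fun t : R => t + c) 1.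
  by apply: is_derive_eq; rewrite addr0.
have dE : (fun t : R => t + c)^`()%classic = cst 1.
  by apply/funext => t; rewrite derive1E derive_val.
have cF : continuous (fun t : R => t + c).
  by move=> t; apply: cvgD; [exact: cvg_id|exact: cvg_cst].
rewrite /Rintegral (@integration_by_substitution_increasing _ (fun t : R => t + c)) //.
- rewrite dE; congr fine; apply: eq_integral => t _ /=; congr EFin.
  by rewrite -[RHS]/(H (t + c) * 1) mulr1.
- by move=> x y _ _; rewrite ltrD2r.
- by rewrite dE => t _; exact: cst_continuous.
- by rewrite dE; exact: is_cvg_cst.
- by rewrite dE; exact: is_cvg_cst.
- split; first by move=> t _; exact: ex_derive.
  + by apply: cvg_at_right_filter; exact: cF.
  + by apply: cvg_at_left_filter; exact: cF.
- exact: continuous_subspaceT.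
Qed.

Lemma Rintegral_period (H : R -> R) (T c : R) : continuous H ->
  (forall t, H (t + T) = H t) -> 0 <= c <= T ->
  \int[mu]_(t in `[0, T]) H (t + c) = \int[mu]_(t in `[0, T]) H t.
Proof.
move=> cH HT /andP[c0 cT].
have split_int (a b d : R) : a <= b -> b <= d ->
    \int[mu]_(t in `[a, d]) H t =
    \int[mu]_(t in `[a, b]) H t + \int[mu]_(t in `[b, d]) H t.
  move=> ab bd.
  have := @Rintegral_itvB _ H (BLeft a) (BRight d) b (integrable_seg _ _ cH).
  rewrite !bnd_simp => /(_ ab bd).
  rewrite Rintegral_itv_obnd_cbnd => [<-|]; first by rewrite addrC subrK.
  apply: integrableS (integrable_seg b d cH) => //.
  by move=> t /=; rewrite !in_itv /= => /andP[/ltW -> ->].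
rewrite Rintegral_shift //; last by lra.
rewrite add0r (split_int c T (T + c)) ?lerDl //.
rewrite [in RHS](split_int 0 c T) //.
have := @Rintegral_shift H 0 c T cH c0.
rewrite add0r [c + T]addrC => <-.
rewrite addrC; congr (_ + _).
by apply: eq_Rintegral => t _; rewrite HT.
Qed.

Lemma expiD2pi (t : R) : expi (t + 2 * pi) = expi t.
Proof.
apply: val_inj; rewrite /= /angle mulr_natl.
by rewrite cosD2pi sinD2pi.
Qed.

(** The Poisson kernel depends only on [|z|] and on the angle between [xi] and [z]; with [al] the
    argument of [z], rotating is a shift of the angle over a full period. *)
Lemma integral_lnP_radial (phi : R -> R) z : cabs z < 1 -> continuous phi ->
  \int[m]_xi phi (lnP z xi) = \int[m]_xi phi (lnP (cabs z)%:C xi).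
Proof.
move=> z1 cphi; have z0 := cabs_ge0 z.
have z1' : cabs ((cabs z)%:C : R[i]^o) < 1 by rewrite cabs_real.
rewrite integral_mT_continuous; last exact: continuous_comp_lnP.
rewrite integral_mT_continuous; last exact: continuous_comp_lnP.
have [zz|zn0] := eqVneq z 0.
  by rewrite zz cabs0.
have u1 : (z / (cabs z)%:C : R[i]^o) \in [set w : R[i]^o | cabs w = 1].
  by rewrite inE /= cabsM cabsV cabs_real // mulfV // cabs_eq0.
have [al al0 ale] := expi_surj (SigSub u1).
have zE : z = (cabs z)%:C * (cos al +i* sin al).
  have -> : cos al +i* sin al = z / (cabs z)%:C.
    have : set_val (expi al) = set_val (SigSub u1 : C) by rewrite ale.
    by [].
  by rewrite mulrC divfK // (_ : 0 = (0 : R)%:C) // (inj_eq (@complexI R)) cabs_eq0.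
pose H t := phi (lnP (cabs z)%:C (expi t)).
have cH : continuous H.
  move=> t; rewrite (_ : H = (fun xi => phi (lnP (cabs z)%:C xi)) \o @expi R) //.
  apply: continuous_comp; first exact: expi_continuous.
  exact: continuous_comp_lnP.
have HT t : H (t + 2 * pi) = H t by rewrite /H expiD2pi.
(* The shift by [- al] is replaced by [2 * pi - al], which lies in the range [[0, 2 pi]] asked for
   by [Rintegral_period]. *)
have c0 : 0 <= 2 * pi - al <= 2 * pi by lra.
rewrite -(Rintegral_period cH HT c0); congr (_ * _).
apply: eq_Rintegral => t _; rewrite /H /lnP; congr (phi (ln _)).
have reE : complex.Re z = cabs z * cos al.
  by rewrite {1}zE ReM /= mul0r subr0.
have imE : complex.Im z = cabs z * sin al.
  by rewrite {1}zE ImM /= mul0r addr0.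
rewrite poisson_expi // /poisson cabs_sub_circle reE imE; congr (_ / (_ - _)).
rewrite (_ : t + (2 * pi - al) = t - al + pi *+ 2); last by rewrite -mulr_natl; ring.
by rewrite cosD2pi cosB /cre /cim /=; ring.
Qed.

End rotation.

(** * Means of powers of the Poisson kernel and their recursions *)

Section moments.
Variable R : realType.
Notation C := (circle R).
Notation m := (mT R).
Implicit Types (xi : C) (z : R[i]^o) (r : R) (phi psi : R -> R).

Definition lnPmean r phi : R := \int[m]_xi phi (lnP r%:C xi).

(** The hyperbolic distance from 0 to [r]. Its exponential is the largest value of [P (r, xi)], and
    [(1 + r ^ 2) / (1 - r ^ 2)] is its hyperbolic cosine. *)
Definition hrad r : R := ln ((1 + r) / (1 - r)).

Section fixed_radius.
Variable r : R.
Hypothesis r01 : 0 <= r < 1.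

Let z1 : cabs (r%:C : R[i]^o) < 1.
Proof. by case/andP: r01 => r0 r1; rewrite cabs_real. Qed.

Lemma lnPmeanD phi psi : continuous phi -> continuous psi ->
  lnPmean r (fun u => phi u + psi u) = lnPmean r phi + lnPmean r psi.
Proof. by move=> cp cq; apply: RintegralD => //; exact: integrable_comp_lnP. Qed.

Lemma lnPmeanB phi psi : continuous phi -> continuous psi ->
  lnPmean r (fun u => phi u - psi u) = lnPmean r phi - lnPmean r psi.
Proof. by move=> cp cq; apply: RintegralB => //; exact: integrable_comp_lnP. Qed.

Lemma lnPmeanZ k phi : continuous phi ->
  lnPmean r (fun u => k * phi u) = k * lnPmean r phi.
Proof. by move=> cp; apply: RintegralZl => //; exact: integrable_comp_lnP. Qed.

Lemma lnPmean_cst k : lnPmean r (fun=> k) = k.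
Proof. by rewrite /lnPmean Rintegral_cst // [X in _ * fine X]mTT mulr1. Qed.

Lemma lnPmean_lincomb (s : seq (R * (R -> R))) :
  foldr (fun p P => continuous p.2 /\ P) True s ->
  lnPmean r (fun u => \sum_(p <- s) p.1 * p.2 u) =
  \sum_(p <- s) p.1 * lnPmean r p.2.
Proof.
(* Continuity is added to the claim so that additivity of the mean applies in the induction. *)
suff : foldr (fun p P => continuous p.2 /\ P) True s ->
    continuous (fun u => \sum_(p <- s) p.1 * p.2 u) /\
    lnPmean r (fun u => \sum_(p <- s) p.1 * p.2 u) =
    \sum_(p <- s) p.1 * lnPmean r p.2.
  by move=> h /h [].
elim: s => [|[k phi] s ih] /=.
  rewrite big_nil; under eq_fun do rewrite big_nil.
  by split; [exact: cst_continuous|rewrite lnPmean_cst].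
move=> [cphi /ih [cs es]].
under eq_fun do rewrite big_cons /=.
rewrite big_cons /= -es; split.
  by apply: continuous_funD => //; exact: continuous_funMl.
rewrite (lnPmeanD _ cs); last exact: continuous_funMl.
by rewrite lnPmeanZ.
Qed.

Lemma expR_hrad : expR (hrad r) = (1 + r) / (1 - r).
Proof.
by case/andP: r01 => r0 r1; rewrite lnK // posrE divr_gt0 //; lra.
Qed.

Lemma expR_Nhrad : expR (- hrad r) = (1 - r) / (1 + r).
Proof. by rewrite expRN expR_hrad invf_div. Qed.

Lemma hrad_ge0 : 0 <= hrad r.
Proof.
case/andP: r01 => r0 r1; rewrite ln_ge0 // ler_pdivlMr ?mul1r; lra.
Qed.

Lemma lnP_le z xi : cabs z = r -> - hrad r <= lnP z xi <= hrad r.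
Proof.
case/andP: r01 => r0 r1 zr; have zlt1 : cabs z < 1 by rewrite zr.
apply/andP; split; rewrite -ler_expR ?expR_Nhrad ?expR_hrad expR_lnP // -zr.
- exact: poisson_ge.
- exact: poisson_le.
Qed.

Lemma lnPmean_le phi psi : continuous phi -> continuous psi ->
  (forall u, - hrad r <= u <= hrad r -> phi u <= psi u) ->
  lnPmean r phi <= lnPmean r psi.
Proof.
move=> cp cq pq; apply: le_Rintegral => //.
- exact: integrable_comp_lnP.
- exact: integrable_comp_lnP.
- move=> xi _; apply: pq; apply: lnP_le.
  by case/andP: r01 => r0 r1; rewrite cabs_real.
Qed.

Lemma lnPmean_ibp phi phi' :
  (forall u : R, is_derive u (1 : R) phi (phi' u)) -> continuous phi' ->
  lnPmean r (fun u =>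
    ((1 + r ^+ 2) / (1 - r ^+ 2) * expR u - expR u ^+ 2) * phi u
    + (2 * ((1 + r ^+ 2) / (1 - r ^+ 2)) * expR u - expR u ^+ 2 - 1) * phi' u)
  = 0.
Proof.
move=> dphi cphi'; rewrite -[RHS](poisson_ibp r01 dphi cphi').
by apply: eq_Rintegral => xi _; rewrite expR_lnP.
Qed.

End fixed_radius.

(** As a function of [x = cosh (hrad r)], [J a r] is the Legendre function of degree [a - 1]; [JC]
    and [JS] are the real and imaginary parts of the mean of [P ^ (a + i tau)]. *)
Definition J a r : R := lnPmean r (fun u => expR (a * u)).
Definition JC a tau r : R := lnPmean r (fun u => expR (a * u) * cos (tau * u)).
Definition JS a tau r : R := lnPmean r (fun u => expR (a * u) * sin (tau * u)).

Lemma continuous_expRl (a : R) : continuous (fun u : R => expR (a * u)).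
Proof.
apply: (@continuous_fun_comp _ _ (fun u => a * u) expR); first exact: continuous_expR.
by apply: continuous_funMl => u; exact: cvg_id.
Qed.

Lemma continuous_cosl (a : R) : continuous (fun u : R => cos (a * u)).
Proof.
apply: (@continuous_fun_comp _ _ (fun u => a * u) cos); first exact: continuous_cos.
by apply: continuous_funMl => u; exact: cvg_id.
Qed.

Lemma continuous_sinl (a : R) : continuous (fun u : R => sin (a * u)).
Proof.
apply: (@continuous_fun_comp _ _ (fun u => a * u) sin); first exact: continuous_sin.
by apply: continuous_funMl => u; exact: cvg_id.
Qed.

Lemma is_derive_expRl (a u : R) :
  is_derive u (1 : R) (fun u : R => expR (a * u)) (a * expR (a * u)).
Proof.
have dl : is_derive u (1 : R) (fun u : R => a * u) a.
  by apply: is_derive_eq; rewrite /GRing.scale /= mulr1 ?addr0.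
have := is_derive1_comp (is_derive_expR (a * u)) dl => /is_derive_eq; apply.
by rewrite mulrC.
Qed.

Lemma is_derive_cosl (a u : R) :
  is_derive u (1 : R) (fun u : R => cos (a * u)) (- (a * sin (a * u))).
Proof.
have dl : is_derive u (1 : R) (fun u : R => a * u) a.
  by apply: is_derive_eq; rewrite /GRing.scale /= mulr1 ?addr0.
have := is_derive1_comp (is_derive_cos (a * u)) dl => /is_derive_eq; apply.
by rewrite mulNr mulrC.
Qed.

Lemma is_derive_sinl (a u : R) :
  is_derive u (1 : R) (fun u : R => sin (a * u)) (a * cos (a * u)).
Proof.
have dl : is_derive u (1 : R) (fun u : R => a * u) a.
  by apply: is_derive_eq; rewrite /GRing.scale /= mulr1 ?addr0.
have := is_derive1_comp (is_derive_sin (a * u)) dl => /is_derive_eq; apply.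
by rewrite mulrC.
Qed.

Lemma is_derive_expRcos (b tau u : R) :
  is_derive u (1 : R) (fun u : R => expR (b * u) * cos (tau * u))
  (b * (expR (b * u) * cos (tau * u)) - tau * (expR (b * u) * sin (tau * u))).
Proof.
have := is_deriveM (is_derive_expRl b u) (is_derive_cosl tau u).
move=> /is_derive_eq; apply; rewrite /GRing.scale /=; ring.
Qed.

Lemma is_derive_expRsin (b tau u : R) :
  is_derive u (1 : R) (fun u : R => expR (b * u) * sin (tau * u))
  (b * (expR (b * u) * sin (tau * u)) + tau * (expR (b * u) * cos (tau * u))).
Proof.
have := is_deriveM (is_derive_expRl b u) (is_derive_sinl tau u).
move=> /is_derive_eq; apply; rewrite /GRing.scale /=; ring.
Qed.

Lemma expR2 (u : R) : expR (2 * u) = expR u ^+ 2.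
Proof. by rewrite expRM_natl. Qed.

Lemma cexpcos a tau : continuous (fun u : R => expR (a * u) * cos (tau * u)).
Proof. exact: continuous_funM (@continuous_expRl a) (@continuous_cosl tau). Qed.

Lemma cexpsin a tau : continuous (fun u : R => expR (a * u) * sin (tau * u)).
Proof. exact: continuous_funM (@continuous_expRl a) (@continuous_sinl tau). Qed.

Section recursion.
Variable r : R.
Hypothesis r01 : 0 <= r < 1.
Let x := (1 + r ^+ 2) / (1 - r ^+ 2).

(** Integration by parts with [phi u = exp (b u) cos (tau u)]: the factors [x P - P ^ 2] and
    [2 x P - P ^ 2 - 1] raise the exponent by 0, 1 or 2. Together with [JS_recursion] it is Bonnet's
    recursion for Legendre functions of complex degree. *)
Lemma JC_recursion b tau :
  x * (JC (b + 1) tau r + 2 * (b * JC (b + 1) tau r - tau * JS (b + 1) tau r)) =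
  JC (b + 2) tau r + (b * JC (b + 2) tau r - tau * JS (b + 2) tau r)
  + (b * JC b tau r - tau * JS b tau r).
Proof.
have := lnPmean_ibp r01 (fun u => is_derive_expRcos b tau u).
rewrite -/x => /(_ _) h.
apply/eqP; rewrite -subr_eq0; apply/eqP; rewrite -[RHS]h; last first.
  by apply: continuous_funB; apply: continuous_funMl; [exact: cexpcos|exact: cexpsin].
pose s : seq (R * (R -> R)) := [::
  (x * (1 + 2 * b), fun u => expR ((b + 1) * u) * cos (tau * u));
  (- (x * (2 * tau)), fun u => expR ((b + 1) * u) * sin (tau * u));
  (- (1 + b), fun u => expR ((b + 2) * u) * cos (tau * u));
  (tau, fun u => expR ((b + 2) * u) * sin (tau * u));
  (- b, fun u => expR (b * u) * cos (tau * u));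
  (tau, fun u => expR (b * u) * sin (tau * u))].
rewrite [X in _ = lnPmean r X](_ : _ = fun u => \sum_(p <- s) p.1 * p.2 u).
  rewrite lnPmean_lincomb //; last first.
    by split; [exact: cexpcos|split; [exact: cexpsin|split; [exact: cexpcos|
      split; [exact: cexpsin|split; [exact: cexpcos|split; [exact: cexpsin|]]]]]].
  rewrite /s !big_cons big_nil /= /JC /JS.
  do 6 move: (lnPmean r _); move=> *; ring.
apply/funext => u; rewrite /s !big_cons big_nil /=.
by rewrite !(mulrDl b) mul1r !expRD expR2; ring.
Qed.

Lemma JS_recursion b tau :
  x * (JS (b + 1) tau r + 2 * (b * JS (b + 1) tau r + tau * JC (b + 1) tau r)) =
  JS (b + 2) tau r + (b * JS (b + 2) tau r + tau * JC (b + 2) tau r)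
  + (b * JS b tau r + tau * JC b tau r).
Proof.
have := lnPmean_ibp r01 (fun u => is_derive_expRsin b tau u).
rewrite -/x => /(_ _) h.
apply/eqP; rewrite -subr_eq0; apply/eqP; rewrite -[RHS]h; last first.
  by apply: continuous_funD; apply: continuous_funMl; [exact: cexpsin|exact: cexpcos].
pose s : seq (R * (R -> R)) := [::
  (x * (1 + 2 * b), fun u => expR ((b + 1) * u) * sin (tau * u));
  (x * (2 * tau), fun u => expR ((b + 1) * u) * cos (tau * u));
  (- (1 + b), fun u => expR ((b + 2) * u) * sin (tau * u));
  (- tau, fun u => expR ((b + 2) * u) * cos (tau * u));
  (- b, fun u => expR (b * u) * sin (tau * u));
  (- tau, fun u => expR (b * u) * cos (tau * u))].
rewrite [X in _ = lnPmean r X](_ : _ = fun u => \sum_(p <- s) p.1 * p.2 u).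
  rewrite lnPmean_lincomb //; last first.
    by split; [exact: cexpsin|split; [exact: cexpcos|split; [exact: cexpsin|
      split; [exact: cexpcos|split; [exact: cexpsin|split; [exact: cexpcos|]]]]]].
  rewrite /s !big_cons big_nil /= /JC /JS.
  do 6 move: (lnPmean r _); move=> *; ring.
apply/funext => u; rewrite /s !big_cons big_nil /=.
by rewrite !(mulrDl b) mul1r !expRD expR2; ring.
Qed.

Lemma J_recursion b : x * ((1 + 2 * b) * J (b + 1) r) =
  (1 + b) * J (b + 2) r + b * J b r.
Proof.
have JE a : JC a 0 r = J a r.
  rewrite /JC /J; congr lnPmean; apply/funext => u.
  by rewrite mul0r cos0 mulr1.
have := JC_recursion b 0; rewrite (JE (b + 1)) (JE (b + 2)) (JE b).
move: (JS _ _ _) (JS _ _ _) (JS _ _ _) (J _ _) (J _ _) (J _ _) => *; lra.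
Qed.

(* The case [phi u = u * expR (- u / 2)] of the integration by parts. *)
Lemma J_half_identity : 2 * x * J 2^-1 r =
  J (3 / 2) r + J (- 2^-1) r + 2^-1 * lnPmean r (fun u => u * expR (3 / 2 * u))
  - 2^-1 * lnPmean r (fun u => u * expR (- 2^-1 * u)).
Proof.
pose phi u : R := u * expR (- 2^-1 * u).
pose phi' u : R := u * (- 2^-1 * expR (- 2^-1 * u)) + expR (- 2^-1 * u).
have dphi u : is_derive u (1 : R) phi (phi' u).
  have de := is_derive_expRl (- 2^-1) u.
  have := is_deriveM (is_derive_id u (1 : R)) de => /is_derive_eq; apply.
  by rewrite /GRing.scale /= mulr1.
have cu (k : R) : continuous (fun u : R => u * expR (k * u)).
  by apply: continuous_funM; [move=> u; exact: cvg_id|exact: continuous_expRl].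
have := lnPmean_ibp r01 dphi.
rewrite -/x => /(_ _) h.
apply/eqP; rewrite -subr_eq0; apply/eqP; rewrite -[RHS]h; last first.
  apply: continuous_funD; last exact: continuous_expRl.
  apply: continuous_funM; first by move=> u; exact: cvg_id.
  by apply: continuous_funMl; exact: continuous_expRl.
pose s : seq (R * (R -> R)) := [::
  (2 * x, fun u => expR (2^-1 * u)); (- 1, fun u => expR (3 / 2 * u));
  (- 1, fun u => expR (- 2^-1 * u)); (- 2^-1, fun u => u * expR (3 / 2 * u));
  (2^-1, fun u => u * expR (- 2^-1 * u))].
rewrite [X in _ = lnPmean r X](_ : _ = fun u => \sum_(p <- s) p.1 * p.2 u).
  rewrite lnPmean_lincomb //; last first.
    split; [exact: continuous_expRl|split; [exact: continuous_expRl|]].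
    by split; [exact: continuous_expRl|split; [exact: cu|split; [exact: cu|]]].
  rewrite /s !big_cons big_nil /= /J.
  do 5 move: (lnPmean r _); move=> *; ring.
apply/funext => u; rewrite /s !big_cons big_nil /= /phi /phi'.
have -> : expR (2^-1 * u) = expR u * expR (- 2^-1 * u).
  by rewrite -expRD; congr expR; lra.
have -> : expR (3 / 2 * u) = expR u ^+ 2 * expR (- 2^-1 * u).
  by rewrite -expR2 -expRD; congr expR; lra.
by field.
Qed.

End recursion.

End moments.

(** * Lower bounds for the means as the radius tends to one *)

Section moment_asymptotics.
Variable R : realType.
Notation C := (circle R).
Notation m := (mT R).
Notation mu := (@lebesgue_measure R).
Implicit Types (xi : C) (z : R[i]^o) (r : R) (phi psi : R -> R).

Lemma near1_01 : \forall r \near (1 : R)^'-, 0 <= r < 1.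
Proof.
near=> r; apply/andP; split; last by near: r; exact: nbhs_left_lt.
by apply: ltW; near: r; exact: nbhs_left_gt.
Unshelve. all: by end_near. Qed.

Lemma near1_hrad (K : R) : \forall r \near (1 : R)^'-, K <= hrad r.
Proof.
near=> r.
have r01 : 0 <= r < 1 by near: r; exact: near1_01.
have /andP[r0 r1] := r01.
rewrite -ler_expR expR_hrad // ler_pdivlMr; last lra.
have : 1 - expR (- K) < r.
  by near: r; apply: nbhs_left_gt; rewrite ltrBlDr ltrDl expR_gt0.
have : expR K * expR (- K) = 1 by rewrite -expRD subrr expR0.
have := expR_gt0 K; nra.
Unshelve. all: by end_near. Qed.

Lemma sin_le_id (t : R) : 0 <= t -> sin t <= t.
Proof.
rewrite le_eqVlt => /predU1P[<-|t0]; first by rewrite sin0.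
have [|c _] := @MVT R sin cos 0 t t0 (fun x _ => is_derive_sin x).
  by apply: continuous_subspaceT; exact: continuous_sin.
rewrite sin0 !subr0 => ->; rewrite -[leRHS]mul1r ler_pM2r //; exact: cos_le1.
Qed.

Lemma cos_ge_quad (t : R) : 0 <= t <= 1 -> 1 - cos t <= t ^+ 2 / 2.
Proof.
move=> /andP[t0 t1].
have s1 : sin (t / 2) <= t / 2 by apply: sin_le_id; lra.
have s0 : 0 <= sin (t / 2).
  by apply: sin_ge0_pi; have := pi_ge2 R; lra.
have : cos t = 1 - 2 * sin (t / 2) ^+ 2.
  rewrite {1}(splitr t) cosD -!expr2 cos2sin2; lra.
nra.
Qed.

(** Here [1 - r <= 2 exp (- L) <= t] gives [|expi t - r| ^ 2 <= 2 t ^ 2], so [P] is at least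
    [exp (- L) / (2 t ^ 2)]. The upper end of the range of [t] keeps [P >= exp (L / 4)]. *)
Lemma lnP_lower r t : 0 <= r < 1 -> 8 <= hrad r ->
  2 * expR (- hrad r) <= t <= expR (- (3 / 4) * hrad r) ->
  hrad r / 4 <= lnP r%:C (expi t) /\
  expR (- hrad r / 2) / 2 / t <= expR (2^-1 * lnP r%:C (expi t)).
Proof.
move=> r01 L8 /andP[ta tb]; have /andP[r0 r1] := r01.
set L := hrad r in L8 ta tb *.
have aE : expR (- L) = (1 - r) / (1 + r) by exact: expR_Nhrad.
set a := expR (- L) in ta aE *.
have a0 : 0 < a := expR_gt0 _.
have epsE : 1 - r = a * (1 + r) by rewrite aE divfK // gt_eqF //; lra.
have t0 : 0 < t by lra.
have t1 : t <= 1.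
  by rewrite (le_trans tb) // -[leRHS]expR0 ler_expR; lra.
have z1 : cabs (r%:C : R[i]^o) < 1 by rewrite cabs_real.
have PE := poisson_expi t r0.
set D := 1 + r ^+ 2 - 2 * r * cos t in PE.
have D0 : 0 < D.
  have c1 := cos_le1 t; have : 0 < (1 - r) ^+ 2 by rewrite exprn_gt0 //; lra.
  by rewrite /D; nra.
have Dt : D <= 2 * t ^+ 2.
  have : 1 - cos t <= t ^+ 2 / 2 by apply: cos_ge_quad; lra.
  have : (1 - r) ^+ 2 <= t ^+ 2 by rewrite ler_sqr ?nnegrE; nra.
  have : 0 <= t ^+ 2 by exact: sqr_ge0.
  by rewrite /D; nra.
have Pge : a / (2 * t ^+ 2) <= poisson r%:C (expi t).
  have t20 : 0 < 2 * t ^+ 2 by rewrite mulr_gt0 // exprn_gt0.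
  rewrite PE ler_pdivrMr // mulrAC ler_pdivlMr //.
  have -> : 1 - r ^+ 2 = a * (1 + r) ^+ 2.
    by rewrite expr2 mulrA -epsE; ring.
  rewrite -mulrA ler_pM2l //.
  have : 1 <= (1 + r) ^+ 2 by nra.
  by have := ltW t20; nra.
have P0 := poisson_gt0 (expi t) z1.
split.
- rewrite -ler_expR expR_lnP //; apply: le_trans Pge.
  have t2 : t ^+ 2 <= expR (- (3 / 2) * L).
    have -> : - (3 / 2) * L = 2 * (- (3 / 4) * L) by lra.
    by rewrite expR2 ler_sqr ?nnegrE ?expR_ge0 // ltW.
  rewrite ler_pdivlMr ?mulr_gt0 ?exprn_gt0 //.
  apply: (@le_trans _ _ (expR (L / 4) * (2 * expR (- (3 / 2) * L)))).
    by rewrite ler_pM2l ?expR_gt0 // ler_pM2l.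
  have -> : a = expR (L / 4) * (expR (L / 4) * expR (- (3 / 2) * L)).
    by rewrite -!expRD; congr expR; lra.
  rewrite ler_pM2l ?expR_gt0 // ler_pM2r ?expR_gt0 //.
  by apply: le_trans (expR_ge1Dx _); lra.
- rewrite -ler_sqr ?nnegrE ?expR_ge0 ?divr_ge0 ?expR_ge0 //; last exact: ltW.
  rewrite -expR2 mulrA divff // mul1r expR_lnP //; apply: le_trans Pge.
  have e2 : expR (- L / 2) ^+ 2 = a by rewrite -expR2; congr expR; lra.
  rewrite !exprMn !exprVn e2 -!mulrA ler_pM2l // -invfM.
  rewrite lef_pV2 ?posrE ?mulr_gt0 ?exprn_gt0 //.
  by have := sqr_ge0 t; lra.
Qed.

(** On the arc of [lnP_lower] the integrand is at least a constant times
    [L ^ (2 k) exp (- L / 2) / t]; the integral of [1 / t] over this arc is of order [L], which is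
    the extra power of [L]. *)
Lemma lnPmean_lower k : exists2 c : R, 0 < c &
  \forall r \near (1 : R)^'-,
    c * hrad r ^+ (2 * k).+1 * expR (- hrad r / 2)
    <= lnPmean r (fun u => u ^+ (2 * k) * expR (2^-1 * u)).
Proof.
(* [1 / (2 pi)] normalises the measure, [4 ^ (- 2 k)] comes from [u >= L / 4], [1 / 2] from the
   bound on [P ^ (1/2)], and [1 / 8] from [ln b - ln a >= L / 4 - 1 >= L / 8]. *)
exists ((2 * pi)^-1 * ((4 ^+ (2 * k))^-1 / 2) / 8).
  have p0 := twopi_gt0 R.
  by rewrite divr_gt0 // mulr_gt0 ?invr_gt0 // divr_gt0 // invr_gt0 exprn_gt0.
near=> r.
have r01 : 0 <= r < 1 by near: r; exact: near1_01.
have L16 : 16 <= hrad r by near: r; exact: near1_hrad.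
set L := hrad r in L16 *.
have /andP[r0 r1] := r01.
have z1 : cabs (r%:C : R[i]^o) < 1 by rewrite cabs_real.
pose phi u : R := u ^+ (2 * k) * expR (2^-1 * u).
have cphi : continuous phi.
  apply: continuous_funM; last exact: continuous_expRl.
  by apply: continuous_funX => u; exact: cvg_id.
have phi0 u : 0 <= phi u.
  by rewrite /phi mulr_ge0 ?expR_ge0 // exprM exprn_ge0 // sqr_ge0.
pose a := 2 * expR (- L); pose b := expR (- (3 / 4) * L).
have a0 : 0 < a by rewrite mulr_gt0 ?expR_gt0.
have lnb : ln b = - (3 / 4) * L by rewrite expRK.
have ln2 : ln 2 <= 1 :> R.
  by rewrite -[leRHS]expRK ler_ln ?posrE ?expR_gt0 // (le_trans _ (expR_ge1Dx _)).
have lna : ln a = ln 2 - L by rewrite lnM ?posrE ?expR_gt0 // expRK.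
have ab : a < b by rewrite -ltr_ln ?posrE ?expR_gt0 // lna lnb; lra.
have b1 : b <= 2 * pi.
  have := pi_ge2 R; have : b <= 1 by rewrite -[leRHS]expR0 ler_expR; lra.
  lra.
pose K := (L / 4) ^+ (2 * k) * (expR (- L / 2) / 2).
have K0 : 0 <= K.
  by rewrite /K mulr_ge0 ?divr_ge0 ?expR_ge0 // exprn_ge0 // divr_ge0 //; lra.
have low t : a <= t <= b -> K / t <= phi (lnP r%:C (expi t)).
  move=> tab; have t0 : 0 < t by case/andP: tab => + _; apply: lt_le_trans.
  have [|h1 h2] := lnP_lower r01 _ tab; first by rewrite -/L; lra.
  rewrite /K /phi -mulrA; apply: ler_pM => //.
  - by rewrite exprn_ge0 // divr_ge0 //; lra.
  - by rewrite !divr_ge0 ?expR_ge0 // ltW.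
  - have l0 : 0 <= L / 4 by lra.
    by rewrite lerXn2r ?nnegrE // (le_trans l0).
have cH : continuous (phi \o lnP r%:C \o @expi R).
  move=> t; apply: continuous_comp; first exact: expi_continuous.
  exact: continuous_comp_lnP.
have tn0 t : a <= t -> t != 0 by move=> at_; rewrite gt_eqF //; apply: lt_le_trans at_.
have dK t : a <= t -> is_derive t (1 : R) (fun t => K * ln t) (K / t).
  move=> at_; have dl : is_derive t (1 : R) (@ln R) t^-1.
    by apply: is_derive1_ln; apply: lt_le_trans at_.
  by apply: is_derive_eq; rewrite /GRing.scale /= ?addr0.
have cV t : a <= t -> {for t, continuous (fun t : R => K / t)}.
  move=> at_; apply: cvgM; first exact: cvg_cst.
  by apply: cvgV; [exact: tn0|exact: cvg_id].
have cKl t : a <= t -> {for t, continuous (fun t : R => K * ln t)}.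
  move=> at_; apply: cvgM; first exact: cvg_cst.
  by apply: continuous_ln; apply: lt_le_trans at_.
have cW : {within `[a, b], continuous (fun t : R => K / t)}.
  apply/continuous_within_itvP => //; split.
  - by move=> t; rewrite in_itv /= => /andP[/ltW at_ _]; exact: cV.
  - by apply: cvg_at_right_filter; apply: cV.
  - by apply: cvg_at_left_filter; apply: cV; exact: ltW.
rewrite -[lnPmean _ _]/(\int[m]_xi phi (lnP r%:C xi)).
rewrite integral_mT_continuous; last exact: (continuous_comp_lnP z1 cphi).
rewrite -!mulrA ler_pM2l ?invr_gt0 ?twopi_gt0 //.
rewrite -lee_fin.
have ifin c d : mu.-integrable `[c, d]%classic (EFin \o (phi \o lnP r%:C \o @expi R)).
  apply: continuous_compact_integrable; first exact: segment_compact.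
  exact: continuous_subspaceT.
rewrite /Rintegral fineK; last by apply: integrable_fin_num => //=; exact: ifin.
apply: (@le_trans _ _ (\int[mu]_(t in `[a, b]) (phi (lnP r%:C (expi t)))%:E)%E); last first.
  apply: ge0_subset_integral => //.
  - apply/measurable_EFinP; apply: measurable_funTS; apply: continuous_measurable_fun.
    exact: cH.
  - by move=> t _; rewrite lee_fin.
  - by move=> t /=; rewrite !in_itv /= => /andP[? ?]; apply/andP; split; lra.
apply: (@le_trans _ _ (\int[mu]_(t in `[a, b]) (K / t)%:E)%E); last first.
  apply: ge0_le_integral => //=.
  - by move=> t; rewrite in_itv /= => /andP[t0 _]; rewrite lee_fin divr_ge0 //; lra.
  - by apply/measurable_EFinP; exact: subspace_continuous_measurable_fun cW.
  - apply/measurable_EFinP; apply: measurable_funTS; apply: continuous_measurable_fun.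
    exact: cH.
rewrite (@continuous_FTC2 R (fun t : R => K / t) (fun t : R => K * ln t)) //.
- rewrite -EFinB lee_fin -mulrBr lnb lna.
  have -> : (4 ^+ (2 * k))^-1 * (2^-1 * (8^-1 * (L ^+ (2 * k).+1 * expR (- L / 2))))
    = K * (L / 8) by rewrite /K exprMn exprVn exprS; ring.
  by apply: ler_wpM2l => //; lra.
- split.
  + by move=> t; rewrite in_itv /= => /andP[/ltW at_ _]; exact: (@ex_derive _ _ _ _ _ _ _ (dK _ at_)).
  + by apply: cvg_at_right_filter; apply: cKl.
  + by apply: cvg_at_left_filter; apply: cKl; exact: ltW.
- move=> t; rewrite in_itv /= => /andP[/ltW at_ _].
  by have dt := dK _ at_; rewrite derive1E derive_val.
Unshelve. all: by end_near. Qed.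

End moment_asymptotics.

(** * Ratios of neighbouring means, and the phase for large exponents *)

Section moment_ratios.
Variable R : realType.
Implicit Types (r : R) (p : R).

Lemma J_gt0 p r : 0 <= r < 1 -> 0 < J p r.
Proof.
move=> r01; rewrite (@lt_le_trans _ _ (expR (- (`|p| * hrad r)))) ?expR_gt0 //.
rewrite -[leLHS](lnPmean_cst r); apply: lnPmean_le => //.
- exact: cst_continuous.
- exact: continuous_expRl.
move=> u uL; rewrite ler_expR.
have := ler_norm (- (p * u)); rewrite normrN normrM.
have : `|u| <= hrad r by rewrite ler_norml.
have := normr_ge0 p; nra.
Qed.

(** As [u >= - L], [P ^ p] is at least [exp (- (p - 1/2) L) P ^ (1/2)], which reduces to the
    exponent 1/2. The point is the factor [L] gained over [exp (- p L)], the smallest value of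
    [P ^ p]. *)
Lemma J_lower p : 2^-1 <= p -> exists2 c : R, 0 < c &
  \forall r \near (1 : R)^'-, c * hrad r * expR (- (p * hrad r)) <= J p r.
Proof.
move=> p2; have [c c0 cJ] := lnPmean_lower R 0.
exists c => //; near=> r.
have r01 : 0 <= r < 1 by near: r; exact: near1_01.
have L0 := hrad_ge0 r01.
have : c * hrad r ^+ (2 * 0).+1 * expR (- hrad r / 2)
  <= lnPmean r (fun u => u ^+ (2 * 0) * expR (2^-1 * u)) by near: r.
rewrite muln0 expr1 => h.
have e1 : expR (- (p * hrad r)) = expR (- ((p - 2^-1) * hrad r)) * expR (- hrad r / 2).
  by rewrite -expRD; congr expR; lra.
apply: (@le_trans _ _ (expR (- ((p - 2^-1) * hrad r)) *
    lnPmean r (fun u => u ^+ 0 * expR (2^-1 * u)))).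
  by rewrite e1 mulrCA ler_pM2l ?expR_gt0.
rewrite -lnPmeanZ //; last first.
  by under eq_fun do rewrite expr0 mul1r; exact: continuous_expRl.
apply: lnPmean_le => //.
- apply: continuous_funMl.
  by under eq_fun do rewrite expr0 mul1r; exact: continuous_expRl.
- exact: continuous_expRl.
move=> u uL; rewrite expr0 mul1r -expRD ler_expR; nra.
Unshelve. all: by end_near. Qed.

(** One has [exp (- L) P ^ (p - 1) = exp (- (u + L)) P ^ p]. Where [u + L >= ln (2 / eta)] this is
    at most [eta / 2 * P ^ p]; elsewhere [P] is within a constant factor of its minimum [exp (- L)],
    and the quantity is at most [K exp (- p L)], which [J_lower] absorbs. *)
Lemma J_concentration p (eta : R) : 2^-1 <= p -> 0 < eta ->
  \forall r \near (1 : R)^'-, expR (- hrad r) * J (p - 1) r <= eta * J p r.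
Proof.
move=> p2 eta0; have [c c0 cJ] := J_lower p2.
pose l := ln (2 / eta).
pose K := expR (`|p - 1| * `|l|).
have K0 : 0 < K := expR_gt0 _.
near=> r.
have r01 : 0 <= r < 1 by near: r; exact: near1_01.
have L1 : 2 * K / (c * eta) + `|l| <= hrad r by near: r; exact: near1_hrad.
have Jl : c * hrad r * expR (- (p * hrad r)) <= J p r by near: r.
have J0 := J_gt0 p r01.
set L := hrad r in L1 Jl *.
have pt u : - L <= u <= L -> expR (- L) * expR ((p - 1) * u) <=
    eta / 2 * expR (p * u) + K * expR (- (p * L)).
  move=> uL.
  have [ul|ul] := leP (- (u + L)) (- l).
  - rewrite -[leLHS]addr0; apply: lerD; last by rewrite mulr_ge0 ?expR_ge0 // ltW.
    have -> : eta / 2 = expR (- l).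
      by rewrite expRN lnK ?posrE ?divr_gt0 // invf_div.
    rewrite -!expRD ler_expR; lra.
  - rewrite -[leLHS]add0r; apply: lerD.
      by rewrite mulr_ge0 ?expR_ge0 // divr_ge0 // ltW.
    rewrite /K -!expRD ler_expR.
    have ll := ler_norm l.
    have : (p - 1) * (u + L) <= `|p - 1| * `|l|.
      have := ler_norm ((p - 1) * (u + L)); rewrite normrM.
      have : `|u + L| <= `|l| by rewrite ger0_norm; lra.
      have := normr_ge0 (p - 1); nra.
    lra.
have cE := @continuous_expRl R.
have cA : continuous (fun u => eta / 2 * expR (p * u)) by exact: continuous_funMl.
have cB : continuous (fun u => expR (- L) * expR ((p - 1) * u)).
  exact: continuous_funMl.
have cK : continuous (fun _ : R => K * expR (- (p * L))) by exact: cst_continuous.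
have := lnPmean_le r01 cB (continuous_funD cA cK) pt.
rewrite (lnPmeanD r01 cA cK) (lnPmeanZ r01 _ (cE _)) (lnPmeanZ r01 _ (cE _)).
rewrite lnPmean_cst -/(J _ _) -/(J _ _) => h; apply: le_trans h _.
have : K * expR (- (p * L)) <= eta / 2 * J p r.
  apply: (@le_trans _ _ (eta / 2 * (c * L * expR (- (p * L))))).
    rewrite !mulrA ler_pM2r ?expR_gt0 //.
    have : 2 * K / (c * eta) <= L by have := normr_ge0 l; lra.
    rewrite ler_pdivrMr ?mulr_gt0 //; lra.
  by rewrite ler_pM2l // divr_gt0.
lra.
Unshelve. all: by end_near. Qed.

Lemma x_bounds r : 0 <= r < 1 ->
  expR (hrad r) / 2 <= (1 + r ^+ 2) / (1 - r ^+ 2) <= expR (hrad r).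
Proof.
move=> r01; have /andP[r0 r1] := r01.
have d1 : 0 < 1 - r by lra.
have d2 : 0 < 1 - r ^+ 2 by nra.
rewrite expR_hrad //; apply/andP; split.
- rewrite ler_pdivlMr //.
  have -> : (1 + r) / (1 - r) / 2 * (1 - r ^+ 2) = (1 + r) ^+ 2 / 2.
    by field; rewrite gt_eqF.
  have := sqr_ge0 (1 - r); lra.
- rewrite ler_pdivrMr //.
  have -> : (1 + r) / (1 - r) * (1 - r ^+ 2) = (1 + r) ^+ 2.
    by field; rewrite gt_eqF.
  lra.
Qed.

(** In [(2 p - 1) x J p = p J (p + 1) + (p - 1) J (p - 1)] one has [x >= exp L / 2], and the last
    term is negligible by [J_concentration]. The threshold [(2 p - 1) / (2 p)] is the limit of
    [J (p + 1) / (exp L * J p)]. *)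
Lemma J_succ p (kappa : R) : 2^-1 < p -> kappa < (2 * p - 1) / (2 * p) ->
  \forall r \near (1 : R)^'-, kappa * expR (hrad r) * J p r <= J (p + 1) r.
Proof.
move=> p2 kp.
have p0 : 0 < p by lra.
(* Chosen so that the error [(|p - 1| + 1) eta] exactly uses up the gap between [(2 p - 1) / 2] and
   [p kappa]. *)
pose eta := ((2 * p - 1) / 2 - p * kappa) / (`|p - 1| + 1).
have d0 : 0 < `|p - 1| + 1 by rewrite ltr_wpDl.
have eta0 : 0 < eta.
  rewrite divr_gt0 // subr_gt0.
  by move: kp; rewrite ltr_pdivlMr ?mulr_gt0 //; lra.
have etaE : eta * (`|p - 1| + 1) = (2 * p - 1) / 2 - p * kappa.
  by rewrite divfK // gt_eqF.
near=> r.
have r01 : 0 <= r < 1 by near: r; exact: near1_01.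
have Jc : expR (- hrad r) * J (p - 1) r <= eta * J p r.
  by near: r; apply: J_concentration => //; exact: ltW.
have /andP[x1 _] := x_bounds r01.
have := J_recursion r01 (p - 1).
rewrite subrK (_ : p - 1 + 2 = p + 1); last lra.
set x := (1 + r ^+ 2) / (1 - r ^+ 2) in x1 *.
have J0 := J_gt0 p r01; have J1 := J_gt0 (p - 1) r01; have J2 := J_gt0 (p + 1) r01.
set E := expR (hrad r) in x1 *; have E0 : 0 < E := expR_gt0 _.
have Jc' : J (p - 1) r <= eta * E * J p r.
  rewrite -(ler_pM2l (expR_gt0 (- hrad r))); apply: le_trans Jc _.
  have -> : expR (- hrad r) * (eta * E * J p r) = expR (- hrad r) * E * (eta * J p r).
    by ring.
  by rewrite -expRD addNr expR0 mul1r.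
move: x (J p r) (J (p - 1) r) (J (p + 1) r) E x1 E0 J0 J1 J2 Jc'.
move=> {Jc} x Jp Jm Jq E x1 E0 J0 J1 J2 Jc' h.
rewrite -(ler_pM2l p0).
have h1 : (p - 1) * Jm <= `|p - 1| * (eta * E * Jp).
  apply: (@le_trans _ _ (`|p - 1| * Jm)).
    by apply: ler_wpM2r; [exact: ltW|exact: ler_norm].
  exact: ler_wpM2l.
have h2 : E / 2 * ((2 * p - 1) * Jp) <= x * ((1 + 2 * (p - 1)) * Jp).
  rewrite (_ : 1 + 2 * (p - 1) = 2 * p - 1); last by ring.
  by apply: ler_wpM2r => //; apply: mulr_ge0; [lra|exact: ltW].
have h3 : p * (kappa * E * Jp) =
    E / 2 * ((2 * p - 1) * Jp) - (`|p - 1| + 1) * (eta * E * Jp).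
  have -> : (`|p - 1| + 1) * (eta * E * Jp) = eta * (`|p - 1| + 1) * (E * Jp) by ring.
  by rewrite etaE; field.
have h4 : 0 <= eta * E * Jp.
  by apply: mulr_ge0; [apply: mulr_ge0|]; exact: ltW.
rewrite h3; move: h h1 h2 h4; clear; lra.
Unshelve. all: by end_near. Qed.

Lemma one_sub_cos_le (y : R) : 1 - cos y <= `|y|.
Proof.
wlog y0 : y / 0 <= y.
  move=> h; have [/h//|/ltW y0] := leP 0 y.
  by rewrite -cosN -normrN; apply: h; rewrite oppr_ge0.
rewrite ger0_norm //; move: y0; rewrite le_eqVlt => /predU1P[<-|y0].
  by rewrite cos0 subrr.
have [|c _] := @MVT R cos (fun x => - sin x) 0 y y0 (fun x _ => is_derive_cos x).
  by apply: continuous_subspaceT; exact: continuous_cos.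
rewrite cos0 subr0 => h; have := sin_geN1 c; have := sin_le1 c; nra.
Qed.

Definition Jc a tau r : R[i] := JC a tau r +i* JS a tau r.

Lemma normJC a tau r : 0 <= r < 1 -> `|JC a tau r| <= J a r.
Proof.
move=> r01; rewrite ler_norml; apply/andP; split.
- rewrite -mulN1r -lnPmeanZ //; last exact: continuous_expRl.
  apply: lnPmean_le => //; [by apply: continuous_funMl; exact: continuous_expRl|exact: cexpcos|].
  by move=> u _; have := cos_geN1 (tau * u); have := expR_ge0 (a * u); nra.
- apply: lnPmean_le => //; [exact: cexpcos|exact: continuous_expRl|].
  by move=> u _; have := cos_le1 (tau * u); have := expR_ge0 (a * u); nra.
Qed.

Lemma normJS a tau r : 0 <= r < 1 -> `|JS a tau r| <= J a r.
Proof.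
move=> r01; rewrite ler_norml; apply/andP; split.
- rewrite -mulN1r -lnPmeanZ //; last exact: continuous_expRl.
  apply: lnPmean_le => //; [by apply: continuous_funMl; exact: continuous_expRl|exact: cexpsin|].
  by move=> u _; have := sin_geN1 (tau * u); have := expR_ge0 (a * u); nra.
- apply: lnPmean_le => //; [exact: cexpsin|exact: continuous_expRl|].
  by move=> u _; have := sin_le1 (tau * u); have := expR_ge0 (a * u); nra.
Qed.

Lemma cabs_rotate (A B th : R) : cos th * A + sin th * B <= cabs (A +i* B).
Proof.
apply: le_trans (ler_norm _) _; rewrite /= -sqrtr_sqr ler_wsqrtr //.
have := cos2Dsin2 th; have := sqr_ge0 (cos th * B - sin th * A); nra.
Qed.

(* Comparing the phase of [P ^ (i tau)] with its value at the peak of [P]. *)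
Lemma Jc_peak a tau r : 0 <= r < 1 ->
  J a r - `|tau| * (expR (hrad r) * J (a - 1) r - J a r) <= cabs (Jc a tau r).
Proof.
move=> r01; apply: le_trans (cabs_rotate _ _ (tau * hrad r)).
set L := hrad r.
pose f1 u := expR (a * u); pose f2 u := expR ((a - 1) * u).
pose g1 u := expR (a * u) * cos (tau * u).
pose g2 u := expR (a * u) * sin (tau * u).
have cf1 : continuous f1 by exact: continuous_expRl.
have cf2 : continuous (fun u => expR L * f2 u).
  by apply: continuous_funMl; exact: continuous_expRl.
have cf3 : continuous (fun u => expR L * f2 u - f1 u) by exact: continuous_funB.
have cf4 : continuous (fun u => `|tau| * (expR L * f2 u - f1 u)).
  exact: continuous_funMl.
have cg1 : continuous (fun u => cos (tau * L) * g1 u).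
  by apply: continuous_funMl; exact: cexpcos.
have cg2 : continuous (fun u => sin (tau * L) * g2 u).
  by apply: continuous_funMl; exact: cexpsin.
have <- : lnPmean r (fun u => f1 u - `|tau| * (expR L * f2 u - f1 u)) =
    J a r - `|tau| * (expR L * J (a - 1) r - J a r).
  rewrite lnPmeanB // (lnPmeanZ r01 _ cf3) lnPmeanB // lnPmeanZ //.
  exact: continuous_expRl.
have <- : lnPmean r (fun u => cos (tau * L) * g1 u + sin (tau * L) * g2 u) =
    cos (tau * L) * JC a tau r + sin (tau * L) * JS a tau r.
  by rewrite lnPmeanD // !lnPmeanZ //; [exact: cexpsin|exact: cexpcos].
apply: lnPmean_le => //; [exact: continuous_funB|exact: continuous_funD|].
rewrite /f1 /f2 /g1 /g2 /L.
move=> u uL.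
have -> : cos (tau * hrad r) * (expR (a * u) * cos (tau * u)) +
    sin (tau * hrad r) * (expR (a * u) * sin (tau * u)) =
    expR (a * u) * cos (tau * (hrad r - u)).
  by rewrite mulrBr cosB; ring.
have -> : expR (hrad r) * expR ((a - 1) * u) = expR (a * u) * expR (hrad r - u).
  by rewrite -!expRD; congr expR; lra.
(* [1 - cos y <= |y|] and [1 + y <= exp y] bound the loss of phase at [u] by
   [|tau| (exp (L - u) - 1)]; the mean of [exp (L - u) - 1] against [P ^ a] is
   [exp L * J (a - 1) - J a]. *)
have := one_sub_cos_le (tau * (hrad r - u)); rewrite normrM.
rewrite [`|hrad r - u|]ger0_norm; last lra.
have := expR_ge1Dx (hrad r - u) => h1 h2.
have h3 : `|tau| * (hrad r - u) <= `|tau| * (expR (hrad r - u) - 1).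
  by rewrite ler_wpM2l //; lra.
have := expR_gt0 (a * u); nra.
Qed.

(** [J_succ] with [kappa = 1 - 1 / p] gives [exp L * J p <= p / (p - 1) * J (p + 1)], so the loss in
    [Jc_peak] for the exponent [p + 1] is at most [|tau| / (p - 1)], hence at most half, of
    [J (p + 1)]. *)
Lemma Jc_base p tau : 2 * `|tau| + 2 <= p ->
  \forall r \near (1 : R)^'-, 2^-1 * J (p + 1) r <= cabs (Jc (p + 1) tau r).
Proof.
move=> pt; have t0 := normr_ge0 tau.
have p0 : 0 < p by lra.
near=> r.
have r01 : 0 <= r < 1 by near: r; exact: near1_01.
have h : (1 - p^-1) * expR (hrad r) * J p r <= J (p + 1) r.
  near: r; apply: J_succ; first lra.
  rewrite ltr_pdivlMr ?mulr_gt0 // mulrBl mul1r mulrCA mulVf ?gt_eqF //; lra.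
apply: le_trans (Jc_peak _ _ r01); rewrite addrK.
set E := expR (hrad r) * J p r.
have {}h : (p - 1) * E <= p * J (p + 1) r.
  rewrite -(ler_pM2l p0) in h; apply: le_trans h.
  by rewrite /E !mulrA mulrBr mulr1 divff ?gt_eqF.
have J0 := J_gt0 (p + 1) r01.
have E0 : 0 <= E by apply: mulr_ge0; [exact: expR_ge0|apply: ltW; exact: J_gt0].
clearbody E; move: (J (p + 1) r) J0 h => Jq J0 h.
have : (p - 1) * (`|tau| * (E - Jq)) <= `|tau| * Jq.
  rewrite mulrCA ler_wpM2l //; lra.
move=> h2.
have : (p - 1) * (2^-1 * Jq) <=
       (p - 1) * (Jq - `|tau| * (E - Jq)).
  have : `|tau| * Jq <= (p - 1) / 2 * Jq.
    by rewrite ler_pM2r //; lra.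
  lra.
by rewrite ler_pM2l //; lra.
Unshelve. all: by end_near. Qed.

End moment_ratios.

(* Otherwise [//], [ring] and [lra] compare distinct means by unfolding the integrals. *)
Opaque lnPmean J JC JS hrad.

(** * Lower bounds for the means of [u ^ n * P ^ (a + i tau)] with [a > 1/2] *)

Section complex_moments.
Variable R : realType.
Implicit Types (r a tau : R).

Lemma Jc_recursion a tau r : 0 <= r < 1 ->
  ((2 * a - 1) +i* (2 * tau)) * ((1 + r ^+ 2) / (1 - r ^+ 2))%:C * Jc a tau r =
  (a +i* tau) * Jc (a + 1) tau r + ((a - 1) +i* tau) * Jc (a - 1) tau r :> R[i].
Proof.
move=> r01; have := JC_recursion r01 (a - 1) tau; have := JS_recursion r01 (a - 1) tau.
rewrite subrK (_ : a - 1 + 2 = a + 1); last lra.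
rewrite /Jc; move: (_ / _) (JC _ _ _) (JC _ _ _) (JC _ _ _) (JS _ _ _) (JS _ _ _) (JS _ _ _).
move=> x C1 C2 C0 S1 S2 S0 h1 h2.
apply/eqP; rewrite eq_complex /=; apply/andP; split; apply/eqP; lra.
Qed.

Lemma cabs_Jc_le a tau r : 0 <= r < 1 -> cabs (Jc a tau r) <= 2 * J a r.
Proof.
move=> r01; apply: le_trans (cabs_le_ReIm _) _ => /=.
have := normJC a tau r01; have := normJS a tau r01; lra.
Qed.

Lemma Jc_recursion_bound a tau r : 0 <= r < 1 ->
  a * cabs (Jc (a + 1) tau r) <=
  cabs ((2 * a - 1) +i* (2 * tau) : R[i]) * expR (hrad r) * cabs (Jc a tau r)
  + cabs ((a - 1) +i* tau : R[i]) * (2 * J (a - 1) r).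
Proof.
move=> r01.
have h8 := cabs_Jc_le (a - 1) tau r01.
have /andP[x0 x1] := x_bounds r01.
have a1 : a <= cabs (a +i* tau : R[i]).
  exact: le_trans (ler_norm a) (@cabs_Re R (a +i* tau)).
have := Jc_recursion a tau r01.
move: ((1 + r ^+ 2) / (1 - r ^+ 2)) x0 x1 (Jc (a - 1) tau r) h8 (Jc a tau r) (Jc (a + 1) tau r) => x x0 x1.
move: ((2 * a - 1) +i* _ : R[i]) ((a - 1) +i* _ : R[i]) (a +i* _ : R[i]) a1.
move=> w1 w0 w2 a1 Z0 h8 Z1 Z2 h.
have x0' : 0 <= x by apply: le_trans x0; rewrite divr_ge0 ?expR_ge0.
have h5 : cabs (w2 * Z2) <= cabs (w2 * Z2 + w0 * Z0) + cabs (w0 * Z0).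
  by rewrite -[cabs (w0 * Z0)]cabsN; apply: le_trans (cabsD _ _); rewrite addrK.
rewrite -h 2!cabsM in h5; rewrite 2!cabsM cabsR (ger0_norm x0') in h5.
have h6 : a * cabs Z2 <= cabs w2 * cabs Z2 by apply: ler_wpM2r a1; exact: cabs_ge0.
have h7 : cabs w0 * cabs Z0 <= cabs w0 * (2 * J (a - 1) r).
  by apply: ler_wpM2l h8; exact: cabs_ge0.
have h9 : cabs w1 * x * cabs Z1 <= cabs w1 * expR (hrad r) * cabs Z1.
  by apply: ler_wpM2r; [|apply: ler_wpM2l x1]; exact: cabs_ge0.
apply: le_trans h6 (le_trans h5 _); exact: lerD.
Qed.

(** If [Jc a] were small compared with [J a], the recursion would make [Jc (a + 1)] small compared
    with [exp L * J a], which has the order of [J (a + 1)] by [J_succ]; the remaining term in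
    [J (a - 1)] is negligible by concentration. *)
Lemma Jc_descend a tau : 2^-1 < a ->
  (exists2 c : R, 0 < c &
    \forall r \near (1 : R)^'-, c * J (a + 1) r <= cabs (Jc (a + 1) tau r)) ->
  exists2 c : R, 0 < c & \forall r \near (1 : R)^'-, c * J a r <= cabs (Jc a tau r).
Proof.
move=> a2 [c c0 cJ].
have a0 : 0 < a by lra.
(* Half of the limit ratio in [J_succ]. *)
pose kappa := (2 * a - 1) / (4 * a).
have kappa0 : 0 < kappa by rewrite divr_gt0 //; lra.
have kappaE : kappa * (4 * a) = 2 * a - 1 by rewrite divfK // gt_eqF //; lra.
have rb := @Jc_recursion_bound a tau.
move: (cabs_ge0 ((a - 1) +i* tau : R[i])) (cabs_ge0 ((2 * a - 1) +i* (2 * tau) : R[i])) rb.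
move: (cabs ((a - 1) +i* tau : R[i])) (cabs ((2 * a - 1) +i* (2 * tau) : R[i])).
move=> w0 w1 w00 w10 rb.
have w01 : 0 < w0 + 1 by lra.
have w11 : 0 < w1 + 1 by lra.
have ack0 : 0 < a * c * kappa by apply: mulr_gt0; [exact: mulr_gt0|].
have w04 : 0 < 4 * (w0 + 1) by apply: mulr_gt0.
have w12 : 0 < 2 * (w1 + 1) by apply: mulr_gt0.
(* With this [eta] the term in [J (a - 1)] takes up at most half of the main term; [w0 + 1] and
   [w1 + 1] avoid division by zero. *)
pose eta := a * c * kappa / (4 * (w0 + 1)).
have eta0 : 0 < eta by exact: divr_gt0.
have etaE : eta * (4 * (w0 + 1)) = a * c * kappa by rewrite divfK // gt_eqF //; lra.
exists (a * c * kappa / (2 * (w1 + 1))); first exact: divr_gt0.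
near=> r.
have r01 : 0 <= r < 1 by near: r; exact: near1_01.
have h1 : c * J (a + 1) r <= cabs (Jc (a + 1) tau r) by near: r.
have h2 : kappa * expR (hrad r) * J a r <= J (a + 1) r.
  by near: r; apply: J_succ => //; rewrite ltr_pdivlMr ?mulr_gt0 //; lra.
have h3 : expR (- hrad r) * J (a - 1) r <= eta * J a r.
  by near: r; apply: J_concentration => //; exact: ltW.
have J0 := J_gt0 a r01.
have h5 := rb r r01.
have E0 := expR_gt0 (hrad r).
rewrite expRN mulrC (ler_pdivrMr _ _ E0) in h3.
have Z0 := cabs_ge0 (Jc a tau r).
move: (cabs (Jc a tau r)) (cabs (Jc (a + 1) tau r)) (expR (hrad r)) E0 h1 h2 h3 h5 Z0.
move: (J (a - 1) r) (J a r) J0 (J (a + 1) r) => Jm Ja Ja0 Jp Z1 Z2 E E0 h1 h2 h3 h5 Z0.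
have e1 : a * (c * (kappa * E * Ja)) <= a * (c * Jp).
  by rewrite ler_pM2l // ler_pM2l.
have e2 : a * (c * Jp) <= a * Z2 by rewrite ler_pM2l.
have e4 : w0 * (2 * Jm) <= w0 * (2 * (eta * Ja * E)).
  by apply: ler_wpM2l => //; rewrite ler_pM2l.
have h9 : (a * c * kappa * Ja) * E <= (w1 * Z1 + 2 * w0 * eta * Ja) * E by lra.
rewrite ler_pM2r // in h9.
rewrite mulrAC ler_pdivrMr //.
have h10 : 2 * w0 * eta * Ja <= a * c * kappa / 2 * Ja.
  rewrite ler_pM2r // -etaE; have := ltW eta0; lra.
lra.
Unshelve. all: by end_near. Qed.

(** The induction is on the number of unit steps from [a] up to the range of [Jc_base]; each step
    back down is [Jc_descend]. *)
Lemma Jc_lower a tau : 2^-1 < a ->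
  exists2 c : R, 0 < c & \forall r \near (1 : R)^'-, c * J a r <= cabs (Jc a tau r).
Proof.
have : exists N, 2 * `|tau| + 3 <= a + N%:R.
  exists (Num.truncn (`|2 * `|tau| + 3 - a|)).+1.
  have := truncnS_gt (2 * `|tau| + 3 - a).
  have := truncnS_gt (`|2 * `|tau| + 3 - a|).
  have := ler_norm (2 * `|tau| + 3 - a); lra.
move=> [N]; elim: N a => [|N ih] a aN a2.
  exists 2^-1; first by rewrite invr_gt0.
  have := @Jc_base R (a - 1) tau; rewrite subrK; apply; lra.
apply: Jc_descend => //; apply: ih; last lra.
by rewrite -addrA nat1r.
Qed.

(** The inequality [d (L - u) <= exp (d (L - u))] bounds the mean by [exp (d L) J (a - d) / d], and
    [J_succ] at [a - d] leads back to [J a]. This takes [a - d > 1/2]; at [a = 1/2] the mean would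
    be of order [L * J a]. *)
Lemma mean_hradB a : 2^-1 < a -> exists2 c : R, 0 < c &
  \forall r \near (1 : R)^'-, lnPmean r (fun u => (hrad r - u) * expR (a * u)) <= c * J a r.
Proof.
move=> a2.
have [d [d0 d1 da]] : exists d : R, [/\ 0 < d, d <= 1 & 2^-1 < a - d].
  exists (Num.min 1 ((a - 2^-1) / 2)); split.
  - by rewrite lt_min ltr01 /= divr_gt0 // subr_gt0.
  - by rewrite ge_min lexx.
  - have : Num.min 1 ((a - 2^-1) / 2) <= (a - 2^-1) / 2 by rewrite ge_min lexx orbT.
    lra.
pose p := a - d.
pose kappa := (2 * p - 1) / (4 * p).
have kappa0 : 0 < kappa by rewrite /kappa /p divr_gt0 //; lra.
exists (d^-1 / kappa); first by rewrite divr_gt0 // invr_gt0.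
near=> r.
have r01 : 0 <= r < 1 by near: r; exact: near1_01.
have h2 : kappa * expR (hrad r) * J p r <= J (p + 1) r.
  near: r; apply: J_succ => //.
  have p0 : 0 < p by rewrite /p; lra.
  rewrite /kappa ltr_pdivlMr ?mulr_gt0 //.
  have -> : (2 * p - 1) / (4 * p) * (2 * p) = (2 * p - 1) / 2 by field; rewrite gt_eqF.
  by rewrite /p; lra.
set L := hrad r in h2 *.
have cE := @continuous_expRl R.
have s1 : lnPmean r (fun u => (L - u) * expR (a * u)) <= d^-1 * expR (d * L) * J p r.
  rewrite -lnPmeanZ //; apply: lnPmean_le => //.
  - apply: continuous_funM => //; apply: continuous_funB; first exact: cst_continuous.
    by move=> u; exact: cvg_id.
  - exact: continuous_funMl.
  move=> u uL.
  have -> : d^-1 * expR (d * L) * expR (p * u) = d^-1 * expR (d * (L - u)) * expR (a * u).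
    by rewrite -!mulrA -!expRD; congr (_ * expR _); rewrite /p; ring.
  rewrite ler_pM2r ?expR_gt0 // -(ler_pM2l d0) mulrA divff ?gt_eqF // mul1r.
  by have := expR_ge1Dx (d * (L - u)); lra.
have s2 : J (p + 1) r <= expR ((1 - d) * L) * J a r.
  rewrite -lnPmeanZ //; apply: lnPmean_le => //; first exact: continuous_funMl.
  move=> u; rewrite -/L => /andP[_ uL]; rewrite -expRD ler_expR /p.
  have : (1 - d) * u <= (1 - d) * L by apply: ler_wpM2l => //; rewrite subr_ge0.
  lra.
apply: le_trans s1 _.
have s3 : kappa * expR L * J p r <= expR ((1 - d) * L) * J a r by exact: le_trans s2.
have eE : expR L = expR ((1 - d) * L) * expR (d * L) by rewrite -expRD; congr expR; ring.
have s4 : kappa * (expR (d * L) * J p r) <= J a r.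
  rewrite -(ler_pM2l (expR_gt0 ((1 - d) * L))); apply: le_trans s3.
  by rewrite eE le_eqVlt; apply/orP; left; apply/eqP; ring.
rewrite -!mulrA ler_pM2l ?invr_gt0 // ler_pdivlMl //.
Unshelve. all: by end_near. Qed.

Definition Jnc n a tau r : R[i] :=
  lnPmean r (fun u => u ^+ n * (expR (a * u) * cos (tau * u))) +i*
  lnPmean r (fun u => u ^+ n * (expR (a * u) * sin (tau * u))).

(** The mean value bound [|L ^ n - u ^ n| <= n L ^ (n - 1) (L - u)], multiplied by [L] to avoid the
    exponent [n - 1]. *)
Lemma normB_exp (L u : R) n : - L <= u <= L ->
  L * `|L ^+ n - u ^+ n| <= n%:R * L ^+ n * (L - u).
Proof.
move=> uL; have L0 : 0 <= L by lra.
elim: n => [|n ih]; first by rewrite !expr0 subrr normr0 !mulr0 !mul0r.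
have -> : L ^+ n.+1 - u ^+ n.+1 = L * (L ^+ n - u ^+ n) + (L - u) * u ^+ n.
  by rewrite !exprS; ring.
have un : `|u ^+ n| <= L ^+ n.
  by rewrite normrX lerXn2r ?nnegrE // ler_norml.
apply: (@le_trans _ _ (L * (L * `|L ^+ n - u ^+ n| + (L - u) * L ^+ n))).
  rewrite ler_wpM2l //; apply: le_trans (ler_normD _ _) _.
  rewrite !normrM (ger0_norm L0) lerD2l ger0_norm ?ler_wpM2l //; lra.
rewrite mulrDr -natr1 exprS.
have : L * (L * `|L ^+ n - u ^+ n|) <= L * (n%:R * L ^+ n * (L - u)) by rewrite ler_wpM2l.
lra.
Qed.

(** By [normB_exp] and [mean_hradB], replacing [u ^ n] by [L ^ n] changes the mean by at most a
    constant times [L ^ (n - 1) J a], which is of lower order than the bound [c L ^ n J a] coming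
    from [Jc_lower]. *)
Lemma Jnc_lower n a tau : 2^-1 < a ->
  exists2 c : R, 0 < c & \forall r \near (1 : R)^'-,
    c * hrad r ^+ n * J a r <= cabs (Jnc n a tau r).
Proof.
move=> a2; have [c c0 cJ] := Jc_lower tau a2; have [K K0 KJ] := mean_hradB a2.
exists (c / 2); first by rewrite divr_gt0.
near=> r.
have r01 : 0 <= r < 1 by near: r; exact: near1_01.
have h1 : c * J a r <= cabs (Jc a tau r) by near: r.
have h2 : lnPmean r (fun u => (hrad r - u) * expR (a * u)) <= K * J a r by near: r.
(* From [L = 4 n K / c] on, the error is at most half of the main term. *)
have L1 : 1 + 4 * n%:R * K / c <= hrad r by near: r; exact: near1_hrad.
set L := hrad r in h2 L1 *.
have J0 := J_gt0 a r01.
have nK : 0 <= 4 * n%:R * K / c by rewrite divr_ge0 ?mulr_ge0 // ltW.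
have L0 : 0 < L by lra.
have diff (t : R -> R) : continuous t -> (forall u, `|t u| <= 1) ->
  L * `|L ^+ n * lnPmean r (fun u => expR (a * u) * t u)
     - lnPmean r (fun u => u ^+ n * (expR (a * u) * t u))| <= n%:R * L ^+ n * (K * J a r).
  move=> ct t1.
  have cE := @continuous_expRl R.
  have cun : continuous (fun u : R => u ^+ n) by apply: continuous_funX => u; exact: cvg_id.
  have ce : continuous (fun u : R => expR (a * u) * t u) by exact: continuous_funM.
  have cL : continuous (fun u : R => L ^+ n * (expR (a * u) * t u)) by exact: continuous_funMl.
  have cu : continuous (fun u : R => u ^+ n * (expR (a * u) * t u)) by exact: continuous_funM.
  have cd : continuous (fun u : R => L ^+ n * (expR (a * u) * t u) - u ^+ n * (expR (a * u) * t u)).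
    exact: continuous_funB.
  have cl : continuous (fun u : R => (L - u) * expR (a * u)).
    apply: continuous_funM => //; apply: continuous_funB; first exact: cst_continuous.
    by move=> u; exact: cvg_id.
  have cnl : continuous (fun u : R => n%:R * L ^+ n * ((L - u) * expR (a * u))).
    exact: continuous_funMl.
  have pt u : - L <= u <= L ->
      `|L * (L ^+ n * (expR (a * u) * t u) - u ^+ n * (expR (a * u) * t u))|
      <= n%:R * L ^+ n * ((L - u) * expR (a * u)).
    move=> uL.
    have -> : L * (L ^+ n * (expR (a * u) * t u) - u ^+ n * (expR (a * u) * t u)) =
        L * (L ^+ n - u ^+ n) * expR (a * u) * t u by ring.
    rewrite normrM -[leRHS]mulr1; apply: ler_pM => //.
    rewrite 2!normrM (gtr0_norm L0) [`|expR _|]gtr0_norm ?expR_gt0 //.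
    by rewrite [leRHS]mulrA ler_pM2r ?expR_gt0 // normB_exp.
  rewrite -lnPmeanZ // -lnPmeanB // -{1}(gtr0_norm L0) -normrM -lnPmeanZ //.
  have nn : 0 <= n%:R * L ^+ n :> R by rewrite mulr_ge0 // exprn_ge0 // ltW.
  apply: le_trans (ler_wpM2l nn h2).
  rewrite -lnPmeanZ // ler_norml; apply/andP; split.
  - rewrite -mulN1r -lnPmeanZ //; apply: lnPmean_le => //; try exact: continuous_funMl.
    by move=> u /pt; rewrite ler_norml mulN1r => /andP[].
  - apply: lnPmean_le => //; first exact: continuous_funMl.
    by move=> u /pt; rewrite ler_norml => /andP[].
have dC := diff _ (@continuous_cosl R tau) (fun u => cos_max (tau * u)).
have dS := diff _ (@continuous_sinl R tau) (fun u => sin_max (tau * u)).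
have LnE : L ^+ n * cabs (Jc a tau r) <=
    cabs (Jnc n a tau r) + cabs ((L ^+ n)%:C * Jc a tau r - Jnc n a tau r).
  have -> : L ^+ n * cabs (Jc a tau r) = cabs ((L ^+ n)%:C * Jc a tau r).
    by rewrite cabsM cabsR ger0_norm // exprn_ge0 // ltW.
  by rewrite addrC; apply: le_trans (cabsD _ _); rewrite subrK.
have Ln0 : 0 < L ^+ n by rewrite exprn_gt0.
have h3 : L * cabs ((L ^+ n)%:C * Jc a tau r - Jnc n a tau r) <=
    2 * (n%:R * L ^+ n * (K * J a r)).
  apply: (@le_trans _ _ (L * (`|L ^+ n * JC a tau r
     - lnPmean r (fun u => u ^+ n * (expR (a * u) * cos (tau * u)))| +
     `|L ^+ n * JS a tau r
     - lnPmean r (fun u => u ^+ n * (expR (a * u) * sin (tau * u)))|))).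
    rewrite ler_pM2l //; apply: le_trans (cabs_le_ReIm _) _.
    by rewrite /= mul0r subr0 mul0r addr0.
  rewrite mulrDr; move: dC dS; rewrite -/(JC _ _ _) -/(JS _ _ _); lra.
have h4 : L * (L ^+ n * (c * J a r)) <= L * (L ^+ n * cabs (Jc a tau r)).
  by rewrite ler_pM2l // ler_pM2l.
have h5 : L * (L ^+ n * cabs (Jc a tau r)) <= L * (cabs (Jnc n a tau r) +
    cabs ((L ^+ n)%:C * Jc a tau r - Jnc n a tau r)) by rewrite ler_pM2l.
have h6 : 2 * (n%:R * L ^+ n * (K * J a r)) <= L * (c / 2 * L ^+ n * J a r).
  have : 4 * n%:R * K <= L * c by rewrite -ler_pdivrMr //; lra.
  have : 0 < L ^+ n * J a r by rewrite mulr_gt0.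
  nra.
rewrite -(ler_pM2l L0); lra.
Unshelve. all: by end_near. Qed.

End complex_moments.

(** * The endpoint exponent 1/2 *)

Section half_moment.
Variable R : realType.
Notation C := (circle R).
Notation m := (mT R).
Implicit Types (r a tau : R) (xi : C) (z : R[i]^o).

(** At [a = 1/2] the coefficient [2 a - 1] of the recursion vanishes, which leaves only
    [J (3/2) = J (- 1/2)]. The information on [J (1/2)] comes from [J_half_identity], the derivative
    of the recursion in the exponent: with [|u| <= L] it gives [2 x J (1/2) <= (2 + L) J (- 1/2)],
    where [J (- 1/2) <= exp (L / 2)]. *)
Lemma J_half_upper : \forall r \near (1 : R)^'-,
  J 2^-1 r <= 2 * hrad r * expR (- hrad r / 2).
Proof.
have e1 : - 2^-1 + 1 = 2^-1 :> R by lra.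
have e2 : - 2^-1 + 2 = 3 / 2 :> R by lra.
have e3 : 1 + 2 * - 2^-1 = 0 :> R by lra.
near=> r.
have r01 : 0 <= r < 1 by near: r; exact: near1_01.
have L2 : 2 <= hrad r by near: r; exact: near1_hrad.
have /andP[x1 _] := x_bounds r01.
have h := J_half_identity r01.
have h0 := J_recursion r01 (- 2^-1).
rewrite e1 e2 e3 mul0r mulr0 in h0.
set L := hrad r in L2 x1 *.
have cE := @continuous_expRl R.
have cu (k : R) : continuous (fun u : R => u * expR (k * u)).
  by apply: continuous_funM; [move=> u; exact: cvg_id|exact: cE].
have b1 : lnPmean r (fun u => u * expR (3 / 2 * u)) <= L * J (3 / 2) r.
  rewrite -(lnPmeanZ r01 L (cE (3 / 2))).
  apply: lnPmean_le; [exact: r01|exact: cu|exact: continuous_funMl|] => u /andP[_ uL].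
  by apply: ler_wpM2r => //; exact: expR_ge0.
have b2 : - lnPmean r (fun u => u * expR (- 2^-1 * u)) <= L * J (- 2^-1) r.
  rewrite -lnPmeanZ // -mulN1r -lnPmeanZ //.
  apply: lnPmean_le => //; try exact: continuous_funMl.
  by move=> u /andP[uL _]; rewrite mulN1r -mulNr ler_wpM2r ?expR_ge0 // lerNl.
have b3 : J (- 2^-1) r <= expR (L / 2).
  rewrite -[leRHS](lnPmean_cst r); apply: lnPmean_le => //; first exact: cst_continuous.
  by move=> u; rewrite ler_expR -/L; clear; lra.
have J0 := J_gt0 2^-1 r01.
clearbody L.
move: (J 2^-1 r) (J (3 / 2) r) (J (- 2^-1) r) (lnPmean _ _) (lnPmean _ _) ((1 + _) / _)
  h h0 x1 b1 b2 b3 J0 => Jh Jp Jm m1 m2 x h h0 x1 b1 b2 b3 J0.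
have h5 : expR L * Jh <= expR L * (2 * L * expR (- L / 2)).
  have -> : expR L * (2 * L * expR (- L / 2)) = 2 * L * expR (L / 2).
    rewrite mulrCA -expRD; congr (_ * expR _); lra.
  have e4 : Jp = Jm by lra.
  rewrite e4 in h b1.
  have h6 : expR L * Jh <= 2 * x * Jh.
    by rewrite ler_pM2r //; lra.
  have h7 : (2 + L) * Jm <= 2 * L * expR (L / 2).
    have -> : 2 * L * expR (L / 2) = (2 + L) * expR (L / 2) + (L - 2) * expR (L / 2) by ring.
    have := expR_gt0 (L / 2) => e0.
    have : (2 + L) * Jm <= (2 + L) * expR (L / 2) by rewrite ler_pM2l //; lra.
    have : 0 <= (L - 2) * expR (L / 2) by rewrite mulr_ge0 ?expR_ge0 //; lra.
    lra.
  lra.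
by rewrite ler_pM2l ?expR_gt0 in h5.
Unshelve. all: by end_near. Qed.

(** Up to constants, the bounds of [lnPmean_lower] and [J_half_upper] differ exactly by the factor
    [L ^ (2 k)]. *)
Lemma mean_half_lower k : exists2 c : R, 0 < c & \forall r \near (1 : R)^'-,
  c * hrad r ^+ (2 * k) * J 2^-1 r <= lnPmean r (fun u => u ^+ (2 * k) * expR (2^-1 * u)).
Proof.
have [c c0 cm] := lnPmean_lower R k.
exists (c / 2); first exact: divr_gt0.
near=> r.
have r01 : 0 <= r < 1 by near: r; exact: near1_01.
have L0 := hrad_ge0 r01.
have h1 : J 2^-1 r <= 2 * hrad r * expR (- hrad r / 2) by near: r; exact: J_half_upper.
apply: le_trans (near cm r _) => //.
have Lk : 0 <= c / 2 * hrad r ^+ (2 * k) by rewrite mulr_ge0 ?exprn_ge0 ?divr_ge0 // ltW.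
apply: le_trans (ler_wpM2l Lk h1) _.
by rewrite exprS le_eqVlt; apply/orP; left; apply/eqP; field.
Unshelve. all: by end_near. Qed.

End half_moment.

(** * The kernel [Pn] as a function of [ln P] *)

Section kernel_bound.
Variable R : realType.
Notation C := (circle R).
Notation m := (mT R).
Implicit Types (r a tau : R) (xi : C) (z : R[i]^o).

Definition cfun (F : R -> R[i]) : Prop :=
  continuous (fun u : R => complex.Re (F u)) /\ continuous (fun u : R => complex.Im (F u)).

Definition cmean r (F : R -> R[i]) : R[i] :=
  lnPmean r (fun u => complex.Re (F u)) +i* lnPmean r (fun u => complex.Im (F u)).

Lemma cfunM k F : cfun F -> cfun (fun u => k * F u).
Proof.
move=> [cR cI]; split.
- under eq_fun do rewrite ReM.
  by apply: continuous_funB; exact: continuous_funMl.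
- under eq_fun do rewrite ImM.
  by apply: continuous_funD; exact: continuous_funMl.
Qed.

Lemma cmeanM r k F : 0 <= r < 1 -> cfun F -> cmean r (fun u => k * F u) = k * cmean r F.
Proof.
move=> r01 [cR cI]; rewrite /cmean.
have -> : (fun u => complex.Re (k * F u)) = (fun u =>
    complex.Re k * complex.Re (F u) - complex.Im k * complex.Im (F u)).
  by apply/funext => u; rewrite ReM.
have -> : (fun u => complex.Im (k * F u)) = (fun u =>
    complex.Re k * complex.Im (F u) + complex.Im k * complex.Re (F u)).
  by apply/funext => u; rewrite ImM.
rewrite lnPmeanB ?lnPmeanD //; try exact: continuous_funMl.
by rewrite !lnPmeanZ //; case: k.
Qed.

Lemma cintegral_lnP F z : cabs z < 1 -> cfun F ->
  cintegral m (fun xi => F (lnP z xi)) = cmean (cabs z) F.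
Proof.
move=> z1 [cR cI]; rewrite /cintegral /cmean.
by congr (_ +i* _); exact: integral_lnP_radial.
Qed.

Lemma natV_real n : (n%:R^-1 : R[i]) = (n%:R^-1 : R)%:C.
Proof. by rewrite fmorphV rmorph_nat. Qed.

Lemma cpowE (x : R) (w : R[i]^o) : cpow x w =
  (expR (complex.Re w * ln x) * cos (complex.Im w * ln x)) +i*
  (expR (complex.Re w * ln x) * sin (complex.Im w * ln x)).
Proof.
by case: w => p q; rewrite /cpow /cexp /= !mulr0 subr0 add0r.
Qed.

(** The real part of the principal root of [w] is the root of [(|w| + Re w) / 2]; it vanishes only
    for real [w <= 0], that is for real [lam <= - 1/4]. *)
Lemma spar_Re_gt0 (lam : R[i]^o) :
  ~ (complex.Im lam = 0 /\ complex.Re lam < - 4^-1) -> lam != - 4^-1 ->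
  0 < complex.Re (spar lam : R[i]).
Proof.
move=> hlam lamn.
have wE : lam + 4^-1 = (complex.Re lam + 4^-1) +i* complex.Im lam :> R[i].
  rewrite natV_real; case: lam {hlam lamn} => x y.
  by apply/eqP; rewrite eq_complex /= addr0 !eqxx.
have w0 : lam + 4^-1 != 0 by rewrite addr_eq0.
rewrite /spar /sqrtc wE /= sqrtr_gt0 divr_gt0 //.
set a := complex.Re lam + 4^-1; set b := complex.Im lam.
have ab : `|a| <= Num.sqrt (a ^+ 2 + b ^+ 2).
  by rewrite -sqrtr_sqr ler_wsqrtr // lerDl sqr_ge0.
rewrite ltNge; apply/negP => h.
have aN : a <= - `|a| by lra.
have a0 : a <= 0 by have := normr_ge0 a; lra.
have sE : Num.sqrt (a ^+ 2 + b ^+ 2) = - a by have := ler0_norm a0; lra.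
have b0 : b = 0.
  have := congr1 (fun x => x ^+ 2) sE; rewrite /= sqr_sqrtr ?addr_ge0 ?sqr_ge0 //.
  rewrite sqrrN => /eqP; rewrite -subr_eq0 addrAC subrr add0r sqrf_eq0.
  by move/eqP.
apply: hlam; split => //.
rewrite lt_neqAle; apply/andP; split; last by rewrite /a in a0; lra.
apply/negP => /eqP la; move: w0; rewrite wE -/a -/b b0 /a la addNr.
by rewrite eqxx.
Qed.

(** Puts both clauses of [Pn] in one form. For [lam = - 1/4] one has [N = 2 n] and [a = 1/2];
    otherwise [N = n], [a = Re s + 1/2 > 1/2] and [tau = Im s]. Since [|u| <= L], the upper bound of
    [F] and the lower bound of its mean carry the same power of [L]. *)
Lemma Pn_structure n (lam : R[i]^o) :
  ~ (complex.Im lam = 0 /\ complex.Re lam < - 4^-1) ->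
  exists (F : R -> R[i]) (N : nat) (a B c : R), [/\ cfun F,
    forall z xi, Pn n lam z xi = F (lnP z xi),
    (2^-1 <= a) /\ 0 < B /\ 0 < c,
    forall u, cabs (F u) <= B * (`|u| ^+ N * expR (a * u)) &
    \forall r \near (1 : R)^'-, c * hrad r ^+ N * J a r <= cabs (cmean r F)].
Proof.
move=> hlam; have [->|lamn] := eqVneq lam (- 4^-1).
- have [c c0 cm] := mean_half_lower R n.
  pose k : R := ((2 * n)%N`!)%:R^-1.
  have k0 : 0 < k by rewrite invr_gt0 ltr0n fact_gt0.
  pose h (u : R) := u ^+ (2 * n) * expR (2^-1 * u).
  have ch : continuous h.
    apply: continuous_funM; last exact: continuous_expRl.
    by apply: continuous_funX => u; exact: cvg_id.
  exists (fun u => (k * h u)%:C), (2 * n)%N, 2^-1, k, (k * c).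
  split => //.
  + by split; [exact: continuous_funMl|exact: cst_continuous].
  + move=> z xi; rewrite /Pn eqxx natV_real -rmorphXn /horo -/(lnP z xi) exprM sqrrN -exprM.
    rewrite cpowE natV_real /= mul0r cos0 sin0 mulr1 mulr0.
    by rewrite -!rmorphM /= -mulrA.
  + by rewrite mulr_gt0.
  + move=> u; rewrite cabsR normrM (gtr0_norm k0) ler_pM2l // /h.
    by rewrite normrM normrX (gtr0_norm (expR_gt0 _)).
  + near=> r.
    have r01 : 0 <= r < 1 by near: r; exact: near1_01.
    apply: le_trans (le_trans (ler_norm _) (cabs_Re _)).
    have -> : complex.Re (cmean r (fun u => (k * h u)%:C)) = k * lnPmean r h.
      by rewrite -lnPmeanZ.
    rewrite -!mulrA ler_pM2l // mulrA.
    by near: r.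
- have s0 := spar_Re_gt0 hlam lamn.
  pose s : R[i] := spar lam; pose a := complex.Re s + 2^-1; pose tau := complex.Im s.
  have a2 : 2^-1 < a by rewrite /a ltrDr.
  pose k : R[i] := (n`!%:R * (2 * s) ^+ n)^-1.
  have sn0 : s != 0 by apply/eqP => sE; move: s0; rewrite -/s sE /= ltxx.
  have kn0 : k != 0.
    rewrite invr_eq0 mulf_neq0 ?expf_neq0 ?mulf_neq0 ?pnatr_eq0 //.
    by rewrite -lt0n fact_gt0.
  have k0 : 0 < cabs k by rewrite cabs_gt0.
  have [c c0 cJ] := Jnc_lower n tau a2.
  pose G (u : R) : R[i] :=
    (u ^+ n * (expR (a * u) * cos (tau * u))) +i* (u ^+ n * (expR (a * u) * sin (tau * u))).
  have cG : cfun G.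
    have cX : continuous (fun u : R => u ^+ n).
      by apply: continuous_funX => u; exact: cvg_id.
    split; apply: continuous_funM => //; apply: continuous_funM;
      [exact: continuous_expRl|exact: continuous_cosl|
       exact: continuous_expRl|exact: continuous_sinl].
  exists (fun u => k * G u), n, a, (2 * cabs k), (cabs k * c).
  split.
  + exact: cfunM.
  + move=> z xi; rewrite /Pn (negbTE lamn) -/s -/k -mulrA; congr (_ * _).
    rewrite cpowE /horo -rmorphN opprK -/(lnP z xi) -rmorphXn /G.
    have -> : complex.Re (s + 2^-1) = a by rewrite ReD natV_real.
    have -> : complex.Im (s + 2^-1) = tau by rewrite ImD natV_real /= addr0.
    by apply/eqP; rewrite eq_complex /= !mul0r subr0 addr0 !eqxx.
  + by split; [exact: ltW|split; rewrite mulr_gt0].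
  + move=> u; set Y := `|u| ^+ n * expR (a * u).
    rewrite cabsM (_ : 2 * cabs k * Y = cabs k * (Y + Y)); last ring.
    rewrite ler_pM2l //; apply: le_trans (cabs_le_ReIm _) _; rewrite /G /=.
    have en (t : R) : `|t| <= 1 -> `|u ^+ n * (expR (a * u) * t)| <= `|u| ^+ n * expR (a * u).
      move=> t1; rewrite mulrA normrM -[leRHS]mulr1; apply: ler_pM => //.
      by rewrite normrM normrX (gtr0_norm (expR_gt0 _)).
    by apply: lerD; apply: en; [exact: cos_max|exact: sin_max].
  + near=> r.
    have r01 : 0 <= r < 1 by near: r; exact: near1_01.
    rewrite cmeanM // cabsM -!mulrA ler_pM2l // mulrA.
    have -> : cmean r G = Jnc n a tau r by [].
    by near: r.
Unshelve. all: by end_near. Qed.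

End kernel_bound.

(** * Integrals of complex functions *)

Section complex_integral.
Context {d : measure_display} {T : measurableType d} {R : realType}.
Variable mu : {measure set T -> \bar R}.
Implicit Types (f g h : T -> R[i]^o) (k : T -> R).

Definition cmeasurable h :=
  measurable_fun setT (fun x => complex.Re (h x)) /\
  measurable_fun setT (fun x => complex.Im (h x)).

Definition cintegrable h :=
  mu.-integrable setT (fun x => (complex.Re (h x))%:E) /\
  mu.-integrable setT (fun x => (complex.Im (h x))%:E).

Lemma cmeasurable_cabs h : cmeasurable h -> measurable_fun setT (fun x => cabs (h x)).
Proof.
move=> [mR mI].
have -> : (fun x => cabs (h x)) =
    Num.sqrt \o (fun x => complex.Re (h x) ^+ 2 + complex.Im (h x) ^+ 2).
  by apply/funext => x /=; case: (h x).
apply: measurableT_comp.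
  by apply: continuous_measurable_fun; exact: sqrt_continuous.
by apply: measurable_funD; exact: measurable_funX.
Qed.

Lemma cmeasurableD f g : cmeasurable f -> cmeasurable g -> cmeasurable (fun x => f x + g x).
Proof.
move=> [fR fI] [gR gI]; split.
- by under eq_fun do rewrite ReD; exact: measurable_funD.
- by under eq_fun do rewrite ImD; exact: measurable_funD.
Qed.

Lemma cmeasurableN f : cmeasurable f -> cmeasurable (fun x => - f x).
Proof.
by case=> mR mI; split; [under eq_fun do rewrite ReN|under eq_fun do rewrite ImN];
  exact: measurable_funN.
Qed.

Lemma cmeasurableM f g : cmeasurable f -> cmeasurable g -> cmeasurable (fun x => f x * g x).
Proof.
move=> [fR fI] [gR gI]; split.
- by under eq_fun do rewrite ReM; apply: measurable_funB; exact: measurable_funM.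
- by under eq_fun do rewrite ImM; apply: measurable_funD; exact: measurable_funM.
Qed.

Lemma cmeasurable_cst (w : R[i]^o) : cmeasurable (fun=> w).
Proof. by split; exact: measurable_cst. Qed.

Lemma cintegrable_measurable h : cintegrable h -> cmeasurable h.
Proof. by move=> [/measurable_int/measurable_EFinP ? /measurable_int/measurable_EFinP ?]. Qed.

Lemma cintegrable_le h k : cmeasurable h -> mu.-integrable setT (EFin \o k) ->
  (forall x, cabs (h x) <= k x) -> cintegrable h.
Proof.
move=> [mR mI] ik hk; split; (apply: le_integrable ik => //;
  first exact/measurable_EFinP); move=> x _ /=; rewrite lee_fin.
- exact: le_trans (cabs_Re _) (le_trans (hk x) (ler_norm _)).
- exact: le_trans (cabs_Im _) (le_trans (hk x) (ler_norm _)).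
Qed.

(** The factor 2 comes from estimating real and imaginary parts separately. *)
Lemma cabs_cintegral_le h k : cmeasurable h -> mu.-integrable setT (EFin \o k) ->
  (forall x, cabs (h x) <= k x) -> cabs (cintegral mu h) <= 2 * \int[mu]_x k x.
Proof.
move=> mh ik hk; have [iR iI] := cintegrable_le mh ik hk.
apply: le_trans (cabs_le_ReIm _) _; rewrite /= mulr2n mulrDl mul1r.
apply: lerD; apply: le_trans (le_normr_Rintegral _ _) _ => //; apply: le_Rintegral => //.
- exact: integrable_norm.
- by move=> x _; exact: le_trans (cabs_Re _) (hk x).
- exact: integrable_norm.
- by move=> x _; exact: le_trans (cabs_Im _) (hk x).
Qed.

Lemma cintegralD f g : cintegrable f -> cintegrable g ->
  cintegral mu (fun x => f x + g x) = cintegral mu f + cintegral mu g.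
Proof.
move=> [fR fI] [gR gI]; rewrite /cintegral.
under eq_Rintegral do rewrite ReD.
rewrite RintegralD //; under [X in _ +i* X]eq_Rintegral do rewrite ImD.
by rewrite RintegralD.
Qed.

Lemma cintegralM (w : R[i]^o) f : cintegrable f ->
  cintegral mu (fun x => w * f x) = w * cintegral mu f.
Proof.
move=> [fR fI]; rewrite /cintegral.
under eq_Rintegral do rewrite ReM.
under [X in _ +i* X]eq_Rintegral do rewrite ImM.
have iz (c : R) (h : T -> R) : mu.-integrable setT (EFin \o h) ->
    mu.-integrable setT (EFin \o (fun x => c * h x)) by exact: integrableZl.
rewrite RintegralB ?RintegralD //; try exact: iz.
by rewrite !RintegralZl //; case: w.
Qed.

Lemma cintegrableM (w : R[i]^o) f : cintegrable f -> cintegrable (fun x => w * f x).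
Proof.
have iz (c : R) (h : T -> R) : mu.-integrable setT (EFin \o h) ->
    mu.-integrable setT (EFin \o (fun x => c * h x)) by exact: integrableZl.
move=> [fR fI]; split.
- under eq_fun do rewrite ReM EFinB.
  by apply: integrableB => //; exact: iz.
- under eq_fun do rewrite ImM EFinD.
  by apply: integrableD => //; exact: iz.
Qed.

Lemma cintegrableD f g : cintegrable f -> cintegrable g ->
  cintegrable (fun x => f x + g x).
Proof.
move=> [fR fI] [gR gI]; split.
- by under eq_fun do rewrite ReD EFinD; exact: integrableD.
- by under eq_fun do rewrite ImD EFinD; exact: integrableD.
Qed.

End complex_integral.

(** * The probability kernel [Q] and the bound of [Pn / Phi] *)

Section poisson_power_kernel.
Variable R : realType.
Notation C := (circle R).
Notation m := (mT R).
Implicit Types (r a tau : R) (xi : C) (z : R[i]^o).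

Definition Q a z xi : R := expR (a * lnP z xi) / J a (cabs z).

Let cabs_01 z : cabs z < 1 -> 0 <= cabs z < 1.
Proof. by move=> z1; rewrite cabs_ge0. Qed.

Lemma Q_gt0 a z xi : cabs z < 1 -> 0 < Q a z xi.
Proof. by move=> z1; rewrite divr_gt0 ?expR_gt0 // J_gt0 // cabs_01. Qed.

Lemma continuous_Q a z : cabs z < 1 -> continuous (Q a z : C -> R).
Proof.
move=> z1; rewrite /Q; under eq_fun do rewrite mulrC; apply: continuous_funMl.
exact: (continuous_comp_lnP z1 (@continuous_expRl R a)).
Qed.

Lemma measurable_Q a z : cabs z < 1 -> measurable_fun setT (Q a z : C -> R).
Proof. by move=> z1; apply: continuous_circle_measurable; exact: continuous_Q. Qed.

Lemma integral_Q a z : cabs z < 1 -> \int[m]_xi Q a z xi = 1.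
Proof.
move=> z1; rewrite /Q RintegralZr //; last first.
  by apply: (@integrable_comp_lnP R (fun u => expR (a * u))) => //; exact: continuous_expRl.
rewrite (integral_lnP_radial z1 (@continuous_expRl R a)) divff // gt_eqF //.
exact: J_gt0 (cabs_01 z1).
Qed.

Lemma Q_bounded a z : cabs z < 1 -> exists2 B : R, 0 < B & forall xi, Q a z xi <= B.
Proof.
move=> z1; have [B B0 QB] := continuous_circle_bounded (continuous_Q z1 (a := a)).
by exists B => // xi; exact: le_trans (ler_norm _) (QB xi).
Qed.

Lemma integrable_QM a z (k : C -> R) : cabs z < 1 -> m.-integrable setT (EFin \o k) ->
  m.-integrable setT (EFin \o (fun xi => Q a z xi * k xi)).
Proof.
move=> z1 ik; have [B B0 QB] := Q_bounded a z1.
have : m.-integrable setT ((EFin \o k) \* (EFin \o Q a z))%E.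
  apply: integrableMl => //; first exact: measurable_Q.
  exists B; split; first exact: num_real.
  by move=> x Bx y _ /=; rewrite gtr0_norm ?Q_gt0 // (le_trans (QB y)) // ltW.
by apply: eq_integrable => // xi _ /=; rewrite mulrC EFinM.
Qed.

Lemma integrable_Q a z : cabs z < 1 -> m.-integrable setT (EFin \o (Q a z : C -> R)).
Proof. by move=> z1; apply: continuous_circle_integrable; exact: continuous_Q. Qed.

(** Both sides depend only on [r] and on the distance [|xi - r xi'| = |xi' - r xi|]. *)
Lemma lnP_sym r xi xi' :
  lnP (r%:C * set_val xi') xi = lnP (r%:C * set_val xi) xi' :> R.
Proof.
rewrite /lnP /poisson !cabs_sub_circle !cabsM !cabs_circle.
rewrite !(ReM, ImM) /= !mul0r !subr0 !addr0 /cre /cim.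
by congr (ln (_ / (_ - 2 * _))); ring.
Qed.

Lemma cabs_radius r xi : 0 <= r -> cabs (r%:C * set_val xi : R[i]^o) = r.
Proof. by move=> r0; rewrite cabsM cabs_circle mulr1 cabs_real. Qed.

Lemma Q_sym a r xi xi' : 0 <= r ->
  Q a (r%:C * set_val xi') xi = Q a (r%:C * set_val xi) xi' :> R.
Proof. by move=> r0; rewrite /Q lnP_sym !cabs_radius. Qed.

(** As [|xi - z| ^ 2 = (1 - |z| ^ 2) / P], taking the second moment of [Q] about [z] lowers the
    exponent by one. *)
Lemma poisson_weight a z xi : cabs z < 1 ->
  Q a z xi * cabs (set_val xi - z) ^+ 2 =
  (1 - cabs z ^+ 2) / J a (cabs z) * expR ((a - 1) * lnP z xi).
Proof.
move=> z1; have p0 := poisson_gt0 xi z1.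
have d0 := cabs_sub_gt0 xi z1.
have z2 : 0 < 1 - cabs z ^+ 2 by have := cabs_ge0 z; nra.
have J0 : J a (cabs z) != 0 by rewrite gt_eqF // J_gt0 // cabs_01.
have -> : expR ((a - 1) * lnP z xi) = expR (a * lnP z xi) / poisson z xi.
  by rewrite mulrBl mul1r expRD expRN expR_lnP.
rewrite /Q /poisson; field.
by rewrite J0 !gt_eqF.
Qed.

Lemma one_sub_sqr_le r : 0 <= r < 1 -> 1 - r ^+ 2 <= 4 * expR (- hrad r).
Proof.
move=> r01; have /andP[r0 r1] := r01; rewrite expR_Nhrad //.
rewrite mulrA ler_pdivlMr; last lra.
have : 0 <= 1 - r by lra.
have : (1 + r) ^+ 2 <= 4 by nra.
have -> : (1 - r ^+ 2) * (1 + r) = (1 - r) * (1 + r) ^+ 2 by ring.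
nra.
Qed.

(** By [poisson_weight] the integral is [(1 - r ^ 2) J (a - 1) / J a], and
    [1 - r ^ 2 <= 4 exp (- L)] leads to [J_concentration]. *)
Lemma Q_concentration a (eta : R) : 2^-1 <= a -> 0 < eta ->
  \forall r \near (1 : R)^'-, forall z, cabs z = r ->
    \int[m]_xi (Q a z xi * cabs (set_val xi - z) ^+ 2) <= eta.
Proof.
move=> a2 eta0; near=> r.
have r01 : 0 <= r < 1 by near: r; exact: near1_01.
move=> z zr; have z1 : cabs z < 1 by rewrite zr; case/andP: r01.
have J0 := J_gt0 a r01.
under eq_Rintegral do rewrite poisson_weight //.
rewrite RintegralZl //; last first.
  apply: (@integrable_comp_lnP R (fun u => expR ((a - 1) * u))) => //.
  exact: continuous_expRl.
rewrite (integral_lnP_radial z1 (@continuous_expRl R (a - 1))) zr.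
rewrite -[\int[m]_xi _]/(J (a - 1) r) mulrAC ler_pdivrMr //.
have h : expR (- hrad r) * J (a - 1) r <= eta / 4 * J a r.
  by near: r; apply: J_concentration => //; exact: divr_gt0.
have := one_sub_sqr_le r01.
have := J_gt0 (a - 1) r01 => J1 h2.
have : (1 - r ^+ 2) * J (a - 1) r <= 4 * expR (- hrad r) * J (a - 1) r.
  by rewrite ler_pM2r.
lra.
Unshelve. all: by end_near. Qed.

(** At distance at least [dlt] from [z], [P] is at most [4 exp (- L) / dlt ^ 2], so [P ^ a] is at
    most a constant times [exp (- a L)], and [J_lower] makes [J a] larger by a factor of order
    [L]. *)
Lemma Q_offdiag a (dlt eta : R) : 2^-1 <= a -> 0 < dlt -> 0 < eta ->
  \forall r \near (1 : R)^'-, forall z, cabs z = r ->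
    forall xi, dlt <= cabs (set_val xi - z) -> Q a z xi <= eta.
Proof.
move=> a2 dlt0 eta0; have [c c0 cJ] := J_lower a2.
pose l := ln (4 / dlt ^+ 2).
near=> r.
have r01 : 0 <= r < 1 by near: r; exact: near1_01.
have Jl : c * hrad r * expR (- (a * hrad r)) <= J a r by near: r.
have L1 : expR (a * l) / (c * eta) <= hrad r by near: r; exact: near1_hrad.
move=> z zr xi xid; have z1 : cabs z < 1 by rewrite zr; case/andP: r01.
have J0 := J_gt0 a r01.
rewrite /Q zr ler_pdivrMr //.
have ul : lnP z xi <= l - hrad r.
  rewrite -ler_expR expR_lnP // expRD lnK ?posrE ?divr_gt0 ?exprn_gt0 //.
  rewrite /poisson ler_pdivrMr ?exprn_gt0 ?cabs_sub_gt0 // zr.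
  apply: le_trans (one_sub_sqr_le r01) _.
  have -> : 4 / dlt ^+ 2 * expR (- hrad r) * cabs (set_val xi - z) ^+ 2 =
    4 * expR (- hrad r) * (cabs (set_val xi - z) ^+ 2 / dlt ^+ 2) by ring.
  rewrite ler_peMr ?mulr_ge0 ?expR_ge0 // ler_pdivlMr ?exprn_gt0 // mul1r.
  by rewrite ler_sqr ?nnegrE ?cabs_ge0 // ltW.
have a0 : 0 < a by lra.
apply: (@le_trans _ _ (expR (a * l) * expR (- (a * hrad r)))).
  by rewrite -expRD ler_expR -mulrBr ler_pM2l.
rewrite ler_pdivrMr ?mulr_gt0 // in L1.
apply: le_trans (ler_wpM2l (ltW eta0) Jl).
rewrite [leRHS]mulrA ler_pM2r ?expR_gt0 //; lra.
Unshelve. all: by end_near. Qed.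

Lemma continuous_cfun_lnP F z : cabs z < 1 -> cfun F ->
  continuous (fun xi : C => complex.Re (F (lnP z xi))) /\
  continuous (fun xi : C => complex.Im (F (lnP z xi))).
Proof.
move=> z1 [cR cI]; split.
- exact: (continuous_comp_lnP z1 cR).
- exact: (continuous_comp_lnP z1 cI).
Qed.

(** [|P_n| <= B |u| ^ N P ^ a <= B L ^ N P ^ a], and the lower bound of the mean has the same factor
    [L ^ N], so the logarithms cancel in the quotient. *)
Lemma kernel_estimate n (lam : R[i]^o) :
  ~ (complex.Im lam = 0 /\ complex.Re lam < - 4^-1) ->
  exists (F : R -> R[i]) (a K : R), [/\ cfun F, 2^-1 <= a, 0 < K,
    forall z xi, Pn n lam z xi = F (lnP z xi) &
    \forall r \near (1 : R)^'-, forall z, cabs z = r ->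
      [/\ Phi n lam z != 0, Phi n lam z = Phi n lam r%:C &
          forall xi, cabs (Pn n lam z xi / Phi n lam z) <= K * Q a z xi]].
Proof.
move=> /(Pn_structure n)[F [N [a [B [c [cF PF [a2 [B0 c0]] FB low]]]]]].
exists F, a, (B / c); split => //; first exact: divr_gt0.
near=> r.
have r01 : 0 <= r < 1 by near: r; exact: near1_01.
have L1 : 1 <= hrad r by near: r; exact: near1_hrad.
have lowr : c * hrad r ^+ N * J a r <= cabs (cmean r F) by near: r.
have J0 := J_gt0 a r01.
have LN0 : 0 < hrad r ^+ N by rewrite exprn_gt0 //; lra.
move=> z zr; have z1 : cabs z < 1 by rewrite zr; case/andP: r01.
have PhiE w : cabs w = r -> Phi n lam w = cmean r F.
  move=> wr; have w1 : cabs w < 1 by rewrite wr; case/andP: r01.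
  rewrite -wr -cintegral_lnP // /Phi; congr cintegral; apply/funext => xi.
  exact: PF.
have mean0 : 0 < cabs (cmean r F) by apply: lt_le_trans lowr; rewrite !mulr_gt0.
rewrite PhiE // PhiE; last by rewrite cabs_real //; case/andP: r01.
split => //; first by rewrite -cabs_gt0.
move=> xi; rewrite cabsM cabsV PF ler_pdivrMr //.
apply: le_trans (FB _) _.
have uL : `|lnP z xi| <= hrad r by rewrite ler_norml lnP_le.
have uN : `|lnP z xi| ^+ N <= hrad r ^+ N.
  by rewrite lerXn2r ?nnegrE //; apply: le_trans uL.
apply: (@le_trans _ _ (B * (hrad r ^+ N * expR (a * lnP z xi)))).
  by rewrite ler_pM2l // ler_pM2r ?expR_gt0.
rewrite /Q zr.
have Q0 : 0 <= B / c * (expR (a * lnP z xi) / J a r).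
  by apply: mulr_ge0; apply: divr_ge0; rewrite ?expR_ge0 ?ltW.
apply: le_trans (ler_wpM2l Q0 lowr).
rewrite le_eqVlt; apply/orP; left; apply/eqP; field.
by rewrite !gt_eqF.
Unshelve. all: by end_near. Qed.

End poisson_power_kernel.

(** * Measurability of complex functions *)

Section complex_measurability.
Context {d : measure_display} {T : measurableType d} {R : realType}.
Implicit Types (h : T -> R[i]^o).

(** The substance is in the converse: an open set is the union of the countably many rational boxes
    that it contains. *)
Lemma measurable_cfunP h :
  measurable_fun setT (h : T -> g_sigma_algebraType (@open R[i]^o)) <-> cmeasurable h.
Proof.
split.
- move=> mh.
  have mo (phi : R[i]^o -> R) : continuous phi -> measurable_fun setT (phi \o h).
    move=> cphi; apply: (measurability _ (RGenOpens.measurableE R)).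
    move=> _ [_ [a [b ->]] <-]; rewrite setTI comp_preimage -[X in measurable X]setTI.
    apply: mh => //; apply: sub_sigma_algebra.
    by move/continuousP : cphi; apply; exact: interval_open.
  split; [exact: (mo _ (@continuous_Re R))|exact: (mo _ (@continuous_Im R))].
- move=> [mR mI]; apply: (@measurability _ _ T (g_sigma_algebraType (@open R[i]^o)) setT h (@open R[i]^o)) => //.
  move=> _ [U oU <-].
  rewrite setTI.
  pose box (p : rat * rat * rat) : set (R[i]^o) :=
    [set w | `|complex.Re w - ratr p.1.1| < ratr p.2 /\ `|complex.Im w - ratr p.1.2| < ratr p.2].
  pose V (n : nat) : set T := if unpickle n is Some p then
    (if `[< box p `<=` U >] then h @^-1` box p else set0) else set0.
  have -> : h @^-1` U = \bigcup_n V n.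
    apply/seteqP; split => x /=.
    + move=> Uhx; have /nbhs_cabs[e e0 eU] : nbhs (h x) U by exact: open_nbhs_nbhs.
      (* The centre is within [e / 8] of [h x] in each coordinate and the half side lies between
         [e / 8] and [e / 4], so the box contains [h x] and stays in the ball of radius [e]. *)
      have e4 : 0 < e / 8 by rewrite divr_gt0.
      have rl (y k : R) : 0 < k -> y - k < y + k by move=> ?; lra.
      have [q1] := rat_in_itvoo (rl (complex.Re (h x)) _ e4).
      have [q2] := rat_in_itvoo (rl (complex.Im (h x)) _ e4).
      have /rat_in_itvoo[q3] : e / 8 < e / 4 by lra.
      rewrite !in_itv /= => /andP[q31 q32] /andP[q21 q22] /andP[q11 q12].
      exists (pickle (q1, q2, q3)); [exact: I|rewrite /V pickleK].
      have bU : box (q1, q2, q3) `<=` U.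
        move=> w [/=]; rewrite !ltr_norml => /andP[w1 w2] /andP[w3 w4].
        apply: eU; apply: le_lt_trans (cabs_le_ReIm _) _.
        have : `|complex.Re (w - h x)| < e / 8 + e / 4.
          by rewrite ltr_norml ReD ReN; apply/andP; split; lra.
        have : `|complex.Im (w - h x)| < e / 8 + e / 4.
          by rewrite ltr_norml ImD ImN; apply/andP; split; lra.
        lra.
      rewrite (asboolT bU); split => /=; rewrite ltr_norml; apply/andP; split; lra.
    + move=> [n _]; rewrite /V; case: unpickle => // p.
      by case: asboolP => // bU; exact: bU.
  apply: bigcupT_measurable => n; rewrite /V; case: unpickle => [p|] //.
  case: asboolP => // _.
  have mb (phi : T -> R) (q e : R) : measurable_fun setT phi ->
      measurable [set x | `|phi x - q| < e].
    move=> mphi.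
    have -> : [set x | `|phi x - q| < e] = setT `&` phi @^-1` `]q - e, q + e[%classic.
      rewrite setTI; apply/seteqP; split => x /=; rewrite in_itv /= ltr_norml;
        move=> /andP[? ?]; apply/andP; split; lra.
    exact: mphi.
  rewrite (_ : h @^-1` box p =
    [set x | `|complex.Re (h x) - ratr p.1.1| < ratr p.2] `&`
    [set x | `|complex.Im (h x) - ratr p.1.2| < ratr p.2]) //.
  by apply: measurableI; exact: mb.
Qed.

End complex_measurability.

(** * Functions on the circle and the basic estimate of the quotient *)

Section circle_functions.
Variable R : realType.
Notation C := (circle R).
Notation m := (mT R).
Implicit Types (r a : R) (xi : C) (z w : R[i]^o) (g : C -> R[i]^o).

Lemma circle_nbhs_cabs xi (A : set C) : nbhs xi A ->
  exists2 e : R, 0 < e & forall xi', cabs (set_val xi' - set_val xi) < e -> A xi'.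
Proof.
rewrite nbhsE => -[B [[U oU UB] Bxi] BA].
have Uxi : U (set_val xi : R[i]^o) by move: Bxi; rewrite -UB.
have [e e0 eU] := nbhs_cabs (open_nbhs_nbhs (conj oU Uxi)).
by exists e => // xi' /eU Uxi'; apply: BA; rewrite -UB.
Qed.

Lemma circle_near_cabs xi (e : R) : 0 < e ->
  \forall xi' \near xi, cabs (set_val xi' - set_val xi) < e.
Proof.
move=> e0; apply: (@continuous_set_val R xi [set w | cabs (w - set_val xi) < e]).
exact: near_cabs.
Qed.

Lemma continuous_cfun_circle g : continuous g ->
  continuous (fun xi => complex.Re (g xi)) /\ continuous (fun xi => complex.Im (g xi)).
Proof. by move=> cg; split; [exact: continuous_Re_comp|exact: continuous_Im_comp]. Qed.

Lemma continuous_cabs_bounded g : continuous g ->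
  exists2 B : R, 0 < B & forall xi, cabs (g xi) <= B.
Proof.
move=> /continuous_cfun_circle[/continuous_circle_bounded[B1 B10 h1]
  /continuous_circle_bounded[B2 B20 h2]].
exists (B1 + B2) => [|xi]; first exact: addr_gt0.
by apply: le_trans (cabs_le_ReIm _) _; exact: lerD.
Qed.

Lemma continuous_circle_cmeasurable g : continuous g -> cmeasurable g.
Proof.
by move=> /continuous_cfun_circle[? ?]; split; exact: continuous_circle_measurable.
Qed.

(** Heine's theorem, from the near-covering form of compactness. *)
Lemma continuous_circle_uniform g (eta : R) : continuous g -> 0 < eta ->
  exists2 dlt : R, 0 < dlt &
    forall xi xi', cabs (set_val xi' - set_val xi) < dlt -> cabs (g xi' - g xi) < eta.
Proof.
move=> cg eta0.
pose P (dlt : R) (xi : C) := forall xi', cabs (set_val xi' - set_val xi) < dlt ->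
  cabs (g xi' - g xi) < eta.
have cov := (compact_near_coveringP _).1 (@compact_circle R).
have : \forall dlt \near (0 : R)^'+, [set: C] `<=` P dlt.
  apply: cov => xi _.
  have eta2 : 0 < eta / 2 by exact: divr_gt0.
  have : \forall xi' \near xi, cabs (g xi' - g xi) < eta / 2.
    by apply: (cg xi [set w | cabs (w - g xi) < eta / 2]); exact: near_cabs.
  move=> /circle_nbhs_cabs[e e0 ge].
  have e2 : 0 < e / 2 by exact: divr_gt0.
  exists ([set xi' | cabs (set_val xi' - set_val xi) < e / 2], [set dlt : R | dlt < e / 2]).
    split => /=; first exact: circle_near_cabs.
    exact: nbhs_right_lt.
  move=> [xi1 dlt] /= [h1 h2] xi2 h3.
  have h4 : cabs (set_val xi2 - set_val xi) < e.
    have := cabsD (set_val xi2 - set_val xi1) (set_val xi1 - set_val xi).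
    rewrite addrA subrK; lra.
  have g1 := ge xi1 _; have g2 := ge xi2 h4.
  have := cabsD (g xi2 - g xi) (g xi - g xi1); rewrite addrA subrK [cabs (g xi - _)]cabsB.
  have : cabs (g xi1 - g xi) < eta / 2 by apply: g1; lra.
  lra.
move=> h; have h' : \forall dlt \near (0 : R)^'+, 0 < dlt by exact: nbhs_right_gt.
have [dlt [d1 d2]] := @filter_ex _ _ (at_right_proper_filter (0 : R)) _ (filterI h h').
by exists dlt => // xi xi' /(d1 xi I).
Qed.

(** The modulus of continuity is given a quadratic shape because the concentration of [Q] is known
    through its second moment; beyond the distance [dlt] the quadratic term exceeds the oscillation
    [2 M]. *)
Lemma continuous_quadratic_modulus g (eta : R) : continuous g -> 0 < eta ->
  exists2 B : R, 0 < B & forall xi xi',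
    cabs (g xi' - g xi) <= eta + B * cabs (set_val xi' - set_val xi) ^+ 2.
Proof.
move=> cg eta0; have [M M0 gM] := continuous_cabs_bounded cg.
have [dlt d0 gd] := continuous_circle_uniform cg eta0.
have d2 : 0 < dlt ^+ 2 by rewrite exprn_gt0.
exists (2 * M / dlt ^+ 2); first by rewrite divr_gt0 ?mulr_gt0.
move=> xi xi'; have [lt|ge] := ltP (cabs (set_val xi' - set_val xi)) dlt.
  rewrite (le_trans (ltW (gd _ _ lt))) // lerDl mulr_ge0 ?sqr_ge0 //.
  by rewrite divr_ge0 ?mulr_ge0 // ltW.
have := cabsD (g xi') (- g xi); rewrite cabsN.
have := gM xi; have := gM xi' => g1 g2 g3.
have : 2 * M <= 2 * M / dlt ^+ 2 * cabs (set_val xi' - set_val xi) ^+ 2.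
  rewrite mulrAC ler_pdivlMr // ler_pM2l ?mulr_gt0 //.
  by rewrite ler_sqr ?nnegrE ?cabs_ge0 // ltW.
lra.
Qed.

Lemma near1_ex (P : R -> Prop) : (\forall r \near (1 : R)^'-, P r) ->
  exists2 rho : R, rho < 1 & forall r, rho < r < 1 -> P r.
Proof.
move=> [e /= e0 eP]; exists (1 - e); first by rewrite ltrBlDr ltrDl.
move=> r /andP[r1 r2]; apply: eP => //=.
by rewrite gtr0_norm ?subr_gt0 //; lra.
Qed.

Section quotient_estimate.
Variables (n : nat) (lam : R[i]^o) (F : R -> R[i]) (a K : R).
Hypothesis cF : cfun F.
Hypothesis PF : forall z xi, Pn n lam z xi = F (lnP z xi).

Lemma continuous_Pn z : cabs z < 1 ->
  continuous (fun xi : C => complex.Re (Pn n lam z xi)) /\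
  continuous (fun xi : C => complex.Im (Pn n lam z xi)).
Proof.
move=> z1; have [c1 c2] := continuous_cfun_lnP z1 cF.
by split; under eq_fun do rewrite PF.
Qed.

Lemma cmeasurable_Pn z : cabs z < 1 -> cmeasurable (Pn n lam z : C -> R[i]^o).
Proof.
by move=> /continuous_Pn[? ?]; split; exact: continuous_circle_measurable.
Qed.

Lemma Pn_bounded z : cabs z < 1 ->
  exists2 B : R, 0 < B & forall xi, cabs (Pn n lam z xi) <= B.
Proof.
move=> /continuous_Pn[/continuous_circle_bounded[B1 B10 h1]
  /continuous_circle_bounded[B2 B20 h2]].
exists (B1 + B2) => [|xi]; first exact: addr_gt0.
by apply: le_trans (cabs_le_ReIm _) _; exact: lerD.
Qed.

Lemma integrable_cabs g : cintegrable m g -> m.-integrable setT (fun xi => (cabs (g xi))%:E).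
Proof.
move=> ig; have mg := cintegrable_measurable ig; move: ig => [iR iI].
apply: (le_integrable measurableT _ _ (integrableD measurableT
  (integrable_norm iR) (integrable_norm iI))) => //.
  by apply/measurable_EFinP; exact: cmeasurable_cabs.
move=> xi _ /=; rewrite lee_fin ger0_norm ?cabs_ge0 // ger0_norm ?addr_ge0 //.
exact: cabs_le_ReIm.
Qed.

Lemma cintegrable_bounded (mu : {finite_measure set C -> \bar R}) g (B : R) :
  cmeasurable g -> (forall xi, cabs (g xi) <= B) -> cintegrable mu g.
Proof.
move=> mg gB; apply: (cintegrable_le (k := cst B) mg) => //.
by apply: continuous_circle_integrable; exact: cst_continuous.
Qed.

Lemma cintegrable_Pn z : cabs z < 1 -> cintegrable m (Pn n lam z).
Proof.
move=> z1; have [B B0 PB] := Pn_bounded z1.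
exact: cintegrable_bounded (cmeasurable_Pn z1) PB.
Qed.

Lemma cintegrableB_cst g w : cintegrable m g -> cintegrable m (fun xi => g xi - w).
Proof.
move=> ig; apply: cintegrableD => //.
by apply: (@cintegrable_bounded _ _ (cabs (- w))); first exact: cmeasurable_cst.
Qed.

(** [Phi] is the integral of [Pn], so [f / Phi - w] is the integral of [Pn / Phi * (g - w)]. *)
Lemma Pi_quotient_le z g w : cabs z < 1 ->
  Phi n lam z != 0 ->
  (forall xi, cabs (Pn n lam z xi / Phi n lam z) <= K * Q a z xi) ->
  cintegrable m g ->
  cabs (Pi_fun n lam g z / Phi n lam z - w) <=
  2 * K * \int[m]_xi (Q a z xi * cabs (g xi - w)).
Proof.
move=> z1 Phi0 PQ ig.
have igw := cintegrableB_cst w ig.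
have icgw := integrable_cabs igw.
have mgw := cintegrable_measurable igw.
pose h xi := Pn n lam z xi / Phi n lam z * (g xi - w).
have mh : cmeasurable h.
  apply: cmeasurableM => //; apply: cmeasurableM; first exact: cmeasurable_Pn.
  exact: cmeasurable_cst.
pose k xi := K * (Q a z xi * cabs (g xi - w)).
have hk xi : cabs (h xi) <= k xi.
  by rewrite /h /k cabsM mulrA; apply: ler_wpM2r (PQ xi); exact: cabs_ge0.
have iQ := integrable_QM a z1 icgw.
have ik : m.-integrable setT (EFin \o k) := integrableZl measurableT K iQ.
have ih := cintegrable_le mh ik hk.
have iP := cintegrable_Pn z1.
have -> : Pi_fun n lam g z / Phi n lam z - w = cintegral m h.
  have E : Pi_fun n lam g z = Phi n lam z * cintegral m h + w * Phi n lam z.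
    rewrite /Pi_fun (_ : (fun xi => _) =
        fun xi => Phi n lam z * h xi + w * Pn n lam z xi).
      rewrite cintegralD; [|exact: cintegrableM|exact: cintegrableM].
      by rewrite !cintegralM.
    apply/funext => xi; rewrite /h mulrA [Phi n lam z * _]mulrC divfK //.
    ring.
  by rewrite E mulrDl mulrAC divff // mul1r mulfK // addrK.
apply: le_trans (cabs_cintegral_le mh ik hk) _.
by rewrite /k RintegralZl // mulrA.
Qed.

End quotient_estimate.

End circle_functions.

(** * Continuous boundary values *)

Section continuous_boundary_values.
Variable R : realType.
Notation C := (circle R).
Notation m := (mT R).
Implicit Types (r a : R) (xi : C) (z w : R[i]^o) (g : C -> R[i]^o).
Variables (n : nat) (lam : R[i]^o).
Hypothesis hlam : ~ (complex.Im lam = 0 /\ complex.Re lam < - 4^-1).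

Lemma integrable_sqr_dist z : m.-integrable setT
  (EFin \o (fun xi : C => cabs (set_val xi - z) ^+ 2)).
Proof.
apply: continuous_circle_integrable.
under eq_fun do rewrite cabs_sub_circle.
apply: continuous_funB; first exact: cst_continuous.
apply: continuous_funMl; apply: continuous_funD; apply: continuous_funMl.
- exact: continuous_cre.
- exact: continuous_cim.
Qed.

Lemma continuous_cintegrable g : continuous g -> cintegrable m g.
Proof.
move=> cg; have [B B0 gB] := continuous_cabs_bounded cg.
exact: (@cintegrable_bounded R m g B (continuous_circle_cmeasurable cg) gB).
Qed.

(** One estimate, uniform in the boundary point, serves both for the limit at a point and for
    uniform convergence. The quadratic modulus of [g] is integrated against [Q], using [|xi - xi0| ^
    2 <= 2 |xi - z| ^ 2 + 2 |z - xi0| ^ 2]. *)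
Lemma Pi_quotient_continuous g (eps : R) : continuous g -> 0 < eps ->
  exists rho dlt : R, [/\ rho < 1, 0 < dlt & forall z xi0, rho < cabs z < 1 ->
    cabs (z - set_val xi0) < dlt ->
    cabs (Pi_fun n lam g z / Phi n lam z - g xi0) < eps].
Proof.
move=> cg eps0.
have [F [a [K [cF a2 K0 PF ker]]]] := kernel_estimate n hlam.
(* The constants make the final bound [2 K (eta + 4 B e1) = 3 eps / 4]. *)
have eta0 : 0 < eps / (8 * K) by rewrite divr_gt0 ?mulr_gt0.
have [B B0 gB] := continuous_quadratic_modulus cg eta0.
set eta := eps / (8 * K) in eta0 gB.
pose e1 := eps / (16 * K * B).
have KB0 : 0 < 16 * K * B by rewrite !mulr_gt0.
have e10 : 0 < e1 by rewrite divr_gt0.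
have e1E : e1 * (16 * K * B) = eps by rewrite divfK // gt_eqF.
have etaE : eta * (8 * K) = eps by rewrite divfK // gt_eqF // mulr_gt0.
have [rho rho1 rhoP] := near1_ex (filterI (filterI ker (near1_01 R)) (Q_concentration a2 e10)).
exists rho, (Num.min 1 e1); split => //; first by rewrite lt_min ltr01.
move=> z xi0 zr; rewrite lt_min => /andP[zx1 zx2].
have [[/(_ z erefl)[Phi0 _ PQ] z01] conc] := rhoP _ zr.
have {}conc := conc z erefl.
have z1 : cabs z < 1 by case/andP: zr.
have ig := continuous_cintegrable cg.
have qle := Pi_quotient_le cF PF (g xi0) z1 Phi0 PQ ig.
apply: (le_lt_trans qle).
have zx : cabs (z - set_val xi0) ^+ 2 <= e1.
  by have := cabs_ge0 (z - set_val xi0); nra.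
have icg := integrable_cabs (cintegrableB_cst (g xi0) ig).
have iQg := integrable_QM a z1 icg.
have iQ := integrable_Q a z1.
have iQd := integrable_QM a z1 (integrable_sqr_dist z).
have i1 := integrableZl measurableT (eta + 2 * B * e1) iQ.
have i2 := integrableZl measurableT (2 * B) iQd.
have le : \int[m]_xi (Q a z xi * cabs (g xi - g xi0)) <=
    (eta + 2 * B * e1) + 2 * B * e1.
  apply: (@le_trans _ _ (\int[m]_xi ((eta + 2 * B * e1) * Q a z xi +
      2 * B * (Q a z xi * cabs (set_val xi - z) ^+ 2)))).
    apply: (le_Rintegral measurableT iQg (integrableD measurableT i1 i2)).
    move=> xi _ /=; have Q0 := Q_gt0 a xi z1.
    have -> : (eta + 2 * B * e1) * Q a z xi + 2 * B * (Q a z xi * cabs (set_val xi - z) ^+ 2)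
      = Q a z xi * (eta + B * (2 * e1 + 2 * cabs (set_val xi - z) ^+ 2)) by ring.
    rewrite ler_pM2l //; apply: le_trans (gB _ _) _; rewrite lerD2l ler_pM2l //.
    have := cabsD (set_val xi - z) (z - set_val xi0); rewrite addrA subrK.
    have := cabs_ge0 (set_val xi - set_val xi0).
    have := cabs_ge0 (set_val xi - z); have := cabs_ge0 (z - set_val xi0).
    set p := cabs (z - _) in zx *; set q := cabs (set_val xi - z).
    set s := cabs (set_val xi - set_val xi0) => p0 q0 s0 spq.
    clearbody p q s.
    have : s ^+ 2 <= (q + p) ^+ 2 by rewrite ler_sqr ?nnegrE ?addr_ge0.
    have := sqr_ge0 (q - p); lra.
  rewrite (RintegralD measurableT i1 i2) (RintegralZl _ measurableT iQ).
  rewrite (RintegralZl _ measurableT iQd) integral_Q // mulr1.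
  by rewrite lerD2l ler_pM2l // mulr_gt0.
have : 2 * K * \int[m]_xi (Q a z xi * cabs (g xi - g xi0)) <=
    2 * K * ((eta + 2 * B * e1) + 2 * B * e1) by rewrite ler_pM2l // mulr_gt0.
lra.
Qed.

Lemma Pi_quotient_cvg g xi : continuous g ->
  Pi_fun n lam g z / Phi n lam z
    @[z --> within (@disk R) (nbhs (set_val xi : R[i]^o))] --> g xi.
Proof.
move=> cg; apply/cvgcP => eps eps0.
have [rho [dlt [rho1 dlt0 h]]] := Pi_quotient_continuous cg eps0.
(* [|z - xi| < 1 - rho] forces [|z| > rho]. *)
have d0 : 0 < Num.min dlt (1 - rho) by rewrite lt_min dlt0 subr_gt0.
apply: filterS (near_cabs (set_val xi) d0) => z; rewrite lt_min => /andP[z1 z2] zdisk.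
apply: h => //; rewrite /disk /= in zdisk; rewrite zdisk andbT.
have := cabsD (set_val xi - z) z; rewrite subrK cabs_circle cabsB; lra.
Qed.

Lemma cabs_radial_sub r xi : 0 <= r -> cabs (r%:C * set_val xi - set_val xi : R[i]^o) = `|1 - r|.
Proof.
move=> r0; rewrite -[X in _ - X]mul1r -mulrBl cabsM cabs_circle mulr1.
by rewrite -[1 : R[i]]/((1 : R)%:C) -rmorphB cabsR distrC.
Qed.

Lemma radial_quotient r g xi :
  0 <= r -> Phi n lam (r%:C * set_val xi) = Phi n lam r%:C ->
  radial n lam (Pi_fun n lam g) r xi =
  Pi_fun n lam g (r%:C * set_val xi) / Phi n lam (r%:C * set_val xi).
Proof. by move=> r0 h; rewrite /radial h. Qed.

Lemma radial_quotient_le : exists a c : R, [/\ 2^-1 <= a, 0 < c &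
  \forall r \near (1 : R)^'-, 0 <= r < 1 /\ forall g xi w, cintegrable m g ->
    cabs (radial n lam (Pi_fun n lam g) r xi - w) <=
    c * \int[m]_xi' (Q a (r%:C * set_val xi) xi' * cabs (g xi' - w))].
Proof.
have [F [a [K [cF a2 K0 PF ker]]]] := kernel_estimate n hlam.
exists a, (2 * K); split => //; first by rewrite mulr_gt0.
apply: filterS2 ker (near1_01 R) => r kr r01; split => // g xi w ig.
have /andP[r0 r1] := r01; have zr := cabs_radius xi r0.
have [Phi0 PhiE PQ] := kr _ zr; rewrite (radial_quotient g r0 PhiE).
by apply: (Pi_quotient_le cF PF w _ Phi0 PQ ig); rewrite zr.
Qed.

Lemma radial_uniform g (eps : R) : continuous g -> 0 < eps ->
  \forall r \near (1 : R)^'-, forall xi,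
    cabs (radial n lam (Pi_fun n lam g) r xi - g xi) < eps.
Proof.
move=> cg eps0.
have [F [a [K [cF a2 K0 PF ker]]]] := kernel_estimate n hlam.
have [rho [dlt [rho1 dlt0 h]]] := Pi_quotient_continuous cg eps0.
have m1 : Num.max rho (1 - dlt) < 1 by rewrite gt_max rho1 ltrBlDr ltrDl.
apply: filterS3 ker (near1_01 R) (nbhs_left_gt m1) => r kr /andP[r0 r1] + xi.
have xr := cabs_radius xi r0; have [_ PhiE _] := kr _ xr.
rewrite gt_max => /andP[r2 r3].
rewrite (radial_quotient g r0 PhiE); apply: h; first by rewrite xr r2.
rewrite (cabs_radial_sub xi r0) gtr0_norm ?subr_gt0; lra.
Qed.

Lemma radial_cvg_uniform g : continuous g ->
  {uniform, radial n lam (Pi_fun n lam g) @ (1 : R)^'- --> g}.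
Proof.
move=> cg P /uniform_nbhs[E [entE EP]].
move: entE; rewrite -entourage_from_ballE => -[e /= e0 eE].
move: e0; rewrite ltcE /= => /andP[/eqP ie re].
apply: filterS (radial_uniform cg re) => r h; apply: EP => xi _ /=.
apply: eE => /=; rewrite -ball_normE /ball_ /= normc_cabs ltcE /= ie eqxx /=.
by rewrite -cabsB; exact: h.
Qed.

End continuous_boundary_values.

(** * Layer cake formula and radially decreasing weights *)

Section layer_cake.
Variable R : realType.
Notation mu := (@lebesgue_measure R).

(** Tonelli for [H t] times the indicator of [0 <= c < q t]. Measurability in [c] is included
    because [radial_domination] compares two such integrals level by level. *)
Lemma layer_cake (B : set R) (H q : R -> R) : measurable B ->
  measurable_fun setT H -> measurable_fun setT q ->
  (forall t, 0 <= H t) -> (forall t, 0 <= q t) ->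
  (\int[mu]_(t in B) (H t * q t)%:E =
   \int[mu]_c \int[mu]_(t in B `&` [set t | (0 <= c < q t)%R]) (H t)%:E)%E /\
  measurable_fun setT
    (fun c : R => \int[mu]_(t in B `&` [set t | (0 <= c < q t)%R]) (H t)%:E)%E.
Proof.
move=> mB mH mq H0 q0.
pose f (x : R * R) : \bar R :=
  (H x.1 * (\1_B x.1 * \1_[set x : R * R | 0 <= x.2 < q x.1] x))%:E.
have mset : measurable [set x : R * R | 0 <= x.2 < q x.1].
  have m1 : measurable_fun setT (fun x : R * R => 0 <= x.2).
    by apply: measurable_fun_ler; [exact: measurable_cst|exact: measurable_snd].
  have m2 : measurable_fun setT (fun x : R * R => x.2 < q x.1).
    apply: measurable_fun_ltr; first exact: measurable_snd.
    by apply: measurableT_comp => //; exact: measurable_fst.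
  have := measurable_and m1 m2; move=> /(_ measurableT [set true] _).
  by rewrite setTI; apply.
have mf : measurable_fun setT f.
  apply/measurable_EFinP; apply: measurable_funM.
    by apply: measurableT_comp => //; exact: measurable_fst.
  apply: measurable_funM.
    have mi : measurable_fun setT (\1_B : R -> R) by exact: measurable_indic.
    by apply: (measurableT_comp mi); exact: measurable_fst.
  exact: measurable_indic.
have f0 x : (0 <= f x)%E by rewrite lee_fin !mulr_ge0.
have F1 t : (\int[mu]_c f (t, c) = (H t * q t * \1_B t)%:E)%E.
  rewrite (_ : (fun c => f (t, c)) = (fun c => (H t * \1_B t)%:E * (\1_`[0%R, q t[ c)%:E)%E).
    rewrite ge0_integralZl //; last 2 first.
    - by apply/measurable_EFinP; exact: measurable_indic.
    - by rewrite lee_fin mulr_ge0.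
    have lq : mu `[0%R, q t[%classic = (q t)%:E.
      rewrite lebesgue_measure_itv /= lte_fin.
      case: ifPn => [_|]; first by rewrite sube0.
      by rewrite -leNgt => qt; congr EFin; apply/eqP; rewrite eq_le qt q0.
    by rewrite integral_indic // setIT [X in (_ * X)%E]lq -EFinM mulrAC.
  apply/funext => c; rewrite /f -EFinM /= mulrA.
  have -> : \1_[set x : R * R | 0 <= x.2 < q x.1] (t, c) = \1_`[0, q t[%classic c :> R.
    rewrite !indicE; have -> : ((t, c) \in [set x : R * R | 0 <= x.2 < q x.1]) =
      (c \in `[0, q t[%classic) by apply/idP/idP; rewrite !inE /= ?in_itv.
    by [].
  by [].
have F2 c : (\int[mu]_t f (t, c) =
    \int[mu]_(t in B `&` [set t | (0 <= c < q t)%R]) (H t)%:E)%E.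
  rewrite [RHS]integral_mkcond; apply: eq_integral => t _; rewrite /f patchE /= !indicE in_setI.
  have -> : ((t, c) \in [set x : R * R | 0 <= x.2 < q x.1]) = (t \in [set t | 0 <= c < q t]).
    by apply/idP/idP; rewrite !inE.
  by case: (t \in B); case: (t \in _); rewrite /= ?mulr1 ?mulr0 ?mul0r ?mulr0.
have -> : (\int[mu]_(t in B) (H t * q t)%:E = \int[mu]_t \int[mu]_c f (t, c))%E.
  rewrite integral_mkcond; apply: eq_integral => t _; rewrite F1 patchE indicE.
  by case: ifPn => _; rewrite ?mulr1 ?mulr0.
split.
  transitivity (\int[mu]_c \int[mu]_t f (t, c))%E; first exact: fubini_tonelli.
  by apply: eq_integral => c _; rewrite F2.
rewrite (_ : (fun c => _) = fun c => \int[mu]_t f (t, c))%E.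
  exact: (@measurable_fun_fubini_tonelli_G _ _ _ _ _ mu f mf f0).
by apply/funext => c; rewrite F2.
Qed.

(** By the monotonicity of [q] each of its level sets in the interval is, up to end points, an
    interval centred at [t0], where the mean of [H] is at most [eta]; the layer cake formula sums
    over the levels. *)
Lemma radial_domination (t0 dlt eta : R) (H q : R -> R) :
  measurable_fun setT H -> measurable_fun setT q ->
  (forall t, 0 <= H t) -> (forall t, 0 <= q t) -> 0 <= eta ->
  (forall s t, `|s - t0| <= `|t - t0| -> `|t - t0| < dlt -> q t <= q s) ->
  (forall rho : R, rho <= dlt ->
     (\int[mu]_(t in `](t0 - rho)%R, (t0 + rho)%R[) (H t)%:E <=
      eta%:E * mu `](t0 - rho)%R, (t0 + rho)%R[%classic)%E) ->
  (\int[mu]_(t in `](t0 - dlt)%R, (t0 + dlt)%R[) (H t * q t)%:E <=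
   eta%:E * \int[mu]_(t in `](t0 - dlt)%R, (t0 + dlt)%R[) (q t)%:E)%E.
Proof.
move=> mH mq H0 q0 eta0 qdec HB.
set B := `]t0 - dlt, t0 + dlt[%classic.
have mB : measurable B by exact: measurable_itv.
have [-> mL] := layer_cake mB mH mq H0 q0.
have [E1 mL1] := layer_cake mB (measurable_cst (1 : R)) mq (fun=> ler01) q0.
have -> : (\int[mu]_(t in B) (q t)%:E = \int[mu]_(t in B) (1 * q t)%:E)%E.
  by apply: eq_integral => t _; rewrite mul1r.
rewrite E1 -ge0_integralZl //; last first.
  by move=> c _; apply: integral_ge0 => t _; rewrite lee_fin.
apply: ge0_le_integral => //.
- by move=> c _; apply: integral_ge0 => t _; rewrite lee_fin.
- exact: measurable_funeM.
move=> c _; set S := B `&` _.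
have mS : measurable S.
  apply: measurableI => //.
  have -> : [set t | 0 <= c < q t] = if 0 <= c then q @^-1` `]c, +oo[%classic else set0.
    apply/seteqP; split => t /=; case: ifP => c0 //=; rewrite ?in_itv /= ?andbT //.
  case: ifP => _; last exact: measurable0.
  by rewrite -[X in measurable X]setTI; exact: mq.
rewrite [X in (_ <= _ * X)%E](_ : _ = mu S); last first.
  by transitivity (\int[mu]_(t in S) cst 1%E t)%E; [|rewrite integral_cst // mul1e].
have [[t1 St1]|S0] := pselect (S !=set0); last first.
  rewrite (_ : S = set0) ?integral_set0 ?measure0 ?mule0 //.
  by apply/seteqP; split => // t St; case: S0; exists t.
have SB t : S t -> `|t - t0| < dlt.
  move=> [+ _]; rewrite /B /= in_itv /= => /andP[? ?].
  by rewrite ltr_norml; apply/andP; split; lra.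
pose D := [set `|t - t0| | t in S].
have Dsup : has_sup D.
  split; first by exists `|t1 - t0|, t1.
  by exists dlt => _ [t St <-]; exact: ltW (SB t St).
(* The radius of the level set: [S] lies between the open and the closed interval of this radius
   about [t0]. *)
pose rho := sup D.
have rhod : rho <= dlt by apply: ge_sup => [|_ [t St <-]]; [exact: Dsup.1|exact: ltW (SB t St)].
have ballS : `]t0 - rho, t0 + rho[%classic `<=` S.
  move=> t /=; rewrite in_itv /= => /andP[ta tb].
  have tr : `|t - t0| < rho by rewrite ltr_norml; apply/andP; split; lra.
  have [_ [s Ss <-] ts] := sup_gt Dsup.1 tr.
  split; first by rewrite /B /= in_itv /=; apply/andP; split; lra.
  have [_ /= /andP[c0 cs]] := Ss; rewrite c0 /=; apply: lt_le_trans cs _.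
  by apply: qdec; [exact: ltW|exact: SB].
have Scball : S `<=` `[t0 - rho, t0 + rho]%classic.
  move=> t St; have : `|t - t0| <= rho by apply: ub_le_sup; [exact: Dsup.2|exists t].
  by rewrite /= in_itv /= ler_norml => /andP[? ?]; apply/andP; split; lra.
apply: (@le_trans _ _ (\int[mu]_(t in `[(t0 - rho)%R, (t0 + rho)%R]) (H t)%:E)%E).
  apply: ge0_subset_integral => //; first exact/measurable_EFinP/measurable_funTS.
  by move=> t _; rewrite lee_fin.
rewrite (integral_itv_bndoo true false); last exact/measurable_EFinP/measurable_funTS.
apply: le_trans (HB _ rhod) _; apply: lee_wpmul2l; first by rewrite lee_fin.
by apply: le_measure => //; rewrite inE.
Qed.

End layer_cake.

(** * Lebesgue points on the circle and pointwise convergence *)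

Section lebesgue_points.
Variable R : realType.
Notation C := (circle R).
Notation m := (mT R).
Notation mu := (@lebesgue_measure R).
Implicit Types (r a t : R) (xi : C) (k : C -> R) (z : R[i]^o) (g : C -> R[i]^o).

Lemma measurable_comp_expi k : measurable_fun setT k ->
  measurable_fun setT (fun t : R => k (expi t)).
Proof. by move=> mk; apply: (measurableT_comp mk); exact: measurable_expi. Qed.

Lemma integrable_comp_expi k : m.-integrable setT (EFin \o k) ->
  mu.-integrable `[0, 2 * pi]%classic (EFin \o (fun t : R => k (expi t))).
Proof.
move=> /integrableP[/measurable_EFinP mk fin]; apply/integrableP; split.
  by apply/measurable_funTS/measurable_EFinP; exact: measurable_comp_expi.
move: fin; rewrite ge0_integral_mT //; last first.
  by apply: measurableT_comp => //; exact/measurable_EFinP.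
move=> h; rewrite -(@lte_pmul2l _ ((2 * pi)^-1)%:E) //; last first.
  by rewrite lte_fin invr_gt0 twopi_gt0.
by rewrite [ltRHS]gt0_muley // lte_fin invr_gt0 twopi_gt0.
Qed.

Lemma lebesgue_ptE (f : R -> R) (t0 eta : R) : lebesgue_pt f t0 -> 0 < eta ->
  exists2 dlt : R, 0 < dlt & forall rho : R, rho < dlt ->
    (\int[mu]_(t in `](t0 - rho)%R, (t0 + rho)%R[) (`|f t - f t0|)%:E <=
     eta%:E * mu `](t0 - rho)%R, (t0 + rho)%R[%classic)%E.
Proof.
move=> lf eta0.
have : \forall rho \near (0 : R)^'+, (davg f t0 rho < eta%:E)%E.
  apply: (lf [set y | (y < eta%:E)%E]); apply: open_nbhs_nbhs; split.
    exact: open_ereal_lt_ereal.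
  by rewrite /= lte_fin.
move=> [e /= e0 eP]; exists e => // rho re.
have [rho0|rho0] := leP rho 0.
  rewrite set_itv_ge ?integral_set0 ?measure0 ?mule0 // bnd_simp -leNgt; lra.
have := eP rho; rewrite /= sub0r normrN gtr0_norm // => /(_ re rho0).
rewrite /davg /iavg ball_itv.
have mE : mu `](t0 - rho)%R, (t0 + rho)%R[%classic = (rho *+ 2)%:E.
  by rewrite -ball_itv lebesgue_measure_ball // ltW.
rewrite mE inver gt_eqF ?pmulrn_lgt0 // => h.
have r20 : 0 < rho *+ 2 by rewrite pmulrn_lgt0.
apply: ltW; rewrite muleC -lte_pdivrMl //.
Qed.

Lemma cos_le_of_far (d x : R) : 0 < d <= pi -> d <= x <= 2 * pi - d -> cos x <= cos d.
Proof.
move=> /andP[d0 dpi] /andP[dx xd].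
have [xpi|xpi] := leP x pi.
  by rewrite leNgt; apply/negP; rewrite ltr_cos ?in_itv /=; [lra| |]; lra.
have -> : cos x = cos (2 * pi - x).
  by rewrite -[in RHS]cosN opprB mulr_natl -[in LHS](subrK (pi *+ 2) x) cosD2pi.
by rewrite leNgt; apply/negP; rewrite ltr_cos ?in_itv /=; [lra| |]; lra.
Qed.

Lemma Q_le a z xi xi' : 0 <= a -> cabs z < 1 ->
  cabs (set_val xi' - z) ^+ 2 <= cabs (set_val xi - z) ^+ 2 -> Q a z xi <= Q a z xi'.
Proof.
move=> a0 z1 d; rewrite /Q ler_pM2r; last first.
  by rewrite invr_gt0 J_gt0 // cabs_ge0.
rewrite ler_expR ler_wpM2l // -ler_expR !expR_lnP // /poisson.
have z2 : 0 < 1 - cabs z ^+ 2 by have := cabs_ge0 z; nra.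
by rewrite ler_pM2l // lef_pV2 ?posrE ?exprn_gt0 ?cabs_sub_gt0.
Qed.

Lemma sqr_dist_expi r t0 t : 0 <= r ->
  cabs (set_val (expi t) - r%:C * set_val (expi t0) : R[i]^o) ^+ 2 =
  1 + r ^+ 2 - 2 * r * cos (t - t0).
Proof.
move=> r0; rewrite cabs_sub_circle cabs_radius // cosB /cre /cim /=.
by rewrite !mul0r subr0 addr0; ring.
Qed.

Lemma cos_far (d t0 t : R) : d <= pi -> 0 < d -> d <= t0 -> d <= 2 * pi - t0 ->
  t \in `[0, 2 * pi] -> t \notin `](t0 - d), (t0 + d)[ -> cos (t - t0) <= cos d.
Proof.
move=> dpi d0 h1 h2; rewrite !in_itv /= => /andP[t1 t2] tB.
have [tt|tt] := leP 0 (t - t0).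
- apply: cos_le_of_far; first by rewrite d0 dpi.
  have [?|?] := ltP (t - t0) d; last by apply/andP; split; lra.
  by exfalso; move/negP: tB; apply; apply/andP; split; lra.
- rewrite -cosN; apply: cos_le_of_far; first by rewrite d0 dpi.
  have [?|?] := ltP (- (t - t0)) d; last by apply/andP; split; lra.
  by exfalso; move/negP: tB; apply; apply/andP; split; lra.
Qed.

(** Near [t0] the kernel decreases with the distance in the angle and [radial_domination] applies;
    away from [t0] it is uniformly small by [Q_offdiag]. *)
Lemma lebesgue_pt_kernel a k t0 (eta : R) : 2^-1 <= a ->
  m.-integrable setT (EFin \o k) -> 0 < t0 < 2 * pi ->
  lebesgue_pt ((fun t : R => k (expi t)) \_ `[0, 2 * pi]%classic) t0 -> 0 < eta ->
  \forall r \near (1 : R)^'-,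
    \int[m]_xi (Q a (r%:C * set_val (expi t0)) xi * `|k xi - k (expi t0)|) <= eta.
Proof.
move=> a2 ik /andP[t00 t02] lk eta0.
have a0 : 0 <= a by lra.
have p0 := twopi_gt0 R.
pose kt t : R := k (expi t).
pose H t : R := `|kt t - kt t0|.
have mk : measurable_fun setT k by apply/measurable_EFinP; exact: measurable_int ik.
have mkt : measurable_fun setT kt by exact: measurable_comp_expi.
have mH : measurable_fun setT H.
  by apply: measurableT_comp => //; apply: measurable_funB.
have H0 t : 0 <= H t by exact: normr_ge0.
have eta2 : 0 < eta / 2 by exact: divr_gt0.
have [d1 d10 lpt] := lebesgue_ptE lk eta2.
(* [d] stays below the Lebesgue threshold [d1] and keeps the interval around [t0] inside
   [[0, 2 pi]], so that it does not wrap around. *)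
have [d [d0 dd1 dt0 dt1]] : exists d, [/\ 0 < d, d < d1, d <= t0 & d <= 2 * pi - t0].
  exists (Num.min (d1 / 2) (Num.min t0 (2 * pi - t0))).
  rewrite !lt_min divr_gt0 // t00 subr_gt0 t02 /= gt_min !ge_min !lexx ?orbT /=.
  split => //; apply/orP; left; lra.
have dpi : d <= pi by lra.
have cosd : cos d < 1.
  by rewrite -cos0 ltr_cos ?in_itv /= ?lexx ?pi_ge0 // ltW.
have sd0 : 0 < Num.sqrt (1 - cos d) by rewrite sqrtr_gt0 subr_gt0.
pose N0 := \int[m]_xi `|k xi - k (expi t0)|.
have ikk : m.-integrable setT (EFin \o (fun xi => k xi - k (expi t0))).
  have ic : m.-integrable setT (EFin \o cst (k (expi t0))).
    by apply: continuous_circle_integrable; exact: cst_continuous.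
  exact: (integrableB measurableT ik ic).
have iN : m.-integrable setT (EFin \o (fun xi => `|k xi - k (expi t0)|)) := integrable_norm ikk.
have N00 : 0 <= N0 by apply: Rintegral_ge0.
(* [tau] makes the contribution [tau * N0] of the complement at most [eta / 2]. *)
have tau0 : 0 < eta / (2 * (N0 + 1)) by rewrite divr_gt0 ?mulr_gt0 // ltr_wpDl.
set tau := eta / (2 * (N0 + 1)) in tau0.
have tauE : tau * (2 * (N0 + 1)) = eta by rewrite divfK // gt_eqF // mulr_gt0 // ltr_wpDl.
near=> r.
have r01 : 0 <= r < 1 by near: r; exact: near1_01.
have /andP[r0 r1] := r01.
have r2 : 2^-1 < r by near: r; apply: nbhs_left_gt; rewrite invf_lt1 // ltr1n.
set z := (r%:C * set_val (expi t0) : R[i]^o).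
have zr : cabs z = r by exact: cabs_radius.
have z1 : cabs z < 1 by rewrite zr.
(* Outside the interval, [|expi t - z| ^ 2 = (1 - r) ^ 2 + 2 r (1 - cos (t - t0)) >= 1 - cos d]
   because [r > 1/2]; this is the distance used here. *)
have off : forall z, cabs z = r -> forall xi, Num.sqrt (1 - cos d) <= cabs (set_val xi - z) -> Q a z xi <= tau.
  by near: r; exact: Q_offdiag.
pose q t : R := Q a z (expi t).
have mq : measurable_fun setT q by apply: measurable_comp_expi; exact: measurable_Q.
have q0 t : 0 <= q t by apply: ltW; exact: Q_gt0.
have qdec s t : `|s - t0| <= `|t - t0| -> `|t - t0| < d -> q t <= q s.
  move=> st td; apply: Q_le => //; rewrite !sqr_dist_expi // lerD2l lerN2.
  rewrite ler_wpM2l ?mulr_ge0 //.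
  have cosn x : cos x = cos `|x| :> R.
    by have [_|_] := ger0P x; rewrite ?cosN.
  rewrite cosn [leRHS]cosn leNgt ltr_cos ?in_itv /= ?normr_ge0 //=; first by rewrite -leNgt.
  - by move: td dpi; clear; lra.
  - by move: st td dpi; clear; lra.
pose B := `](t0 - d)%R, (t0 + d)%R[%classic : set R.
pose D := `[0%R, (2 * pi)%R]%classic : set R.
have BD : B `<=` D.
  apply: subset_itv; rewrite bnd_simp; first by rewrite subr_ge0.
  by move: dt1; clear; lra.
have mB : measurable B by exact: measurable_itv.
have mD : measurable D by exact: measurable_itv.
have HB : (forall rho : R, rho <= d ->
     (\int[mu]_(t in `](t0 - rho)%R, (t0 + rho)%R[) (H t)%:E <=
      (eta / 2)%:E * mu `](t0 - rho)%R, (t0 + rho)%R[%classic)%E).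
  move=> rho rhod; apply: le_trans (lpt rho _); last exact: le_lt_trans dd1.
  rewrite le_eqVlt; apply/orP; left; apply/eqP; apply: eq_integral => t.
  rewrite inE /= in_itv /= => /andP[ta tb].
  have tD : t \in D.
    rewrite inE /D /= in_itv /=; move: ta tb rhod dt0 dt1; clear => *.
    by apply/andP; split; lra.
  have t0D : t0 \in D by rewrite inE /D /= in_itv /= !ltW.
  by rewrite /H !patchE tD t0D.
have dom := radial_domination mH mq H0 q0 (ltW eta2) qdec HB.
have mqH : measurable_fun setT (fun t => (H t * q t)%:E).
  by apply/measurable_EFinP; exact: measurable_funM.
have intB : (\int[mu]_(t in B) (q t)%:E <= \int[mu]_(t in D) (q t)%:E)%E.
  apply: ge0_subset_integral => //; first exact/measurable_EFinP/measurable_funTS.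
  by move=> t _; rewrite lee_fin.
have intD : (((2 * pi)^-1)%:E * \int[mu]_(t in D) (q t)%:E = 1)%E.
  rewrite -(@ge0_integral_mT R (fun xi => (Q a z xi)%:E)).
  - rewrite -(@fineK _ (\int[m]_xi _)%E); first by rewrite -/(Rintegral _ _ _) integral_Q.
    by apply: integrable_fin_num => //; exact: integrable_Q.
  - by apply/measurable_EFinP; exact: measurable_Q.
  - by move=> xi; rewrite lee_fin ltW // Q_gt0.
have intH : (((2 * pi)^-1)%:E * \int[mu]_(t in D) (H t)%:E = N0%:E)%E.
  rewrite -(@ge0_integral_mT R (fun xi => (`|k xi - k (expi t0)|)%:E)).
  - by rewrite /N0 /Rintegral fineK //; apply: integrable_fin_num.
  - by apply: measurable_int iN.
  - by move=> xi; rewrite lee_fin.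
have offD : (\int[mu]_(t in D `\` B) (H t * q t)%:E <= tau%:E * \int[mu]_(t in D) (H t)%:E)%E.
  have mDB : measurable (D `\` B) by exact: measurableD.
  apply: (@le_trans _ _ (\int[mu]_(t in D `\` B) (tau%:E * (H t)%:E))%E).
    apply: ge0_le_integral => //.
    - by move=> t _; rewrite lee_fin mulr_ge0.
    - exact: measurable_funTS.
    - apply: measurable_funeM; exact/measurable_EFinP/measurable_funTS.
    - move=> t [Dt Bt]; rewrite -EFinM lee_fin mulrC ler_wpM2r //.
      apply: off => //; rewrite -ler_sqr ?nnegrE ?cabs_ge0 ?sqrtr_ge0 //.
      rewrite sqr_sqrtr ?subr_ge0 ?cos_le1 // sqr_dist_expi //.
      have ct : cos (t - t0) <= cos d.
        by apply: (cos_far dpi d0 dt0 dt1 Dt); apply/negP.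
      have := sqr_ge0 (1 - r); move: r0 r2 ct cosd; clear; nra.
  rewrite ge0_integralZl //; last 3 first.
  - exact/measurable_EFinP/measurable_funTS.
  - by move=> t _; rewrite lee_fin.
  - by rewrite lee_fin ltW.
  apply: lee_wpmul2l; first by rewrite lee_fin ltW.
  apply: ge0_subset_integral => //; first exact/measurable_EFinP/measurable_funTS.
  by move=> t _; rewrite lee_fin.
have iQk := integrable_QM a z1 iN.
rewrite -lee_fin /Rintegral fineK; last by apply: integrable_fin_num.
rewrite ge0_integral_mT; last 2 first.
- exact: measurable_int iQk.
- by move=> xi; rewrite lee_fin mulr_ge0 // ltW // Q_gt0.
rewrite -/D (_ : (\int[mu]_(t in D) _ = \int[mu]_(t in D) (H t * q t)%:E)%E); last first.
  by apply: eq_integral => t _; rewrite mulrC.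
have -> : (\int[mu]_(t in D) (H t * q t)%:E =
    \int[mu]_(t in B) (H t * q t)%:E + \int[mu]_(t in D `\` B) (H t * q t)%:E)%E.
  rewrite -{1}(setDUK BD) ge0_integral_setU //.
  - exact: measurableD.
  - exact: measurable_funTS.
  - by move=> t _; rewrite lee_fin mulr_ge0.
  - by rewrite disj_set2E setDIK.
have pV0 : (0 <= ((2 * pi)^-1 : R)%:E)%E by rewrite lee_fin invr_ge0 ltW.
apply: (@le_trans _ _ (((2 * pi)^-1)%:E * ((eta / 2)%:E * \int[mu]_(t in D) (q t)%:E
    + tau%:E * \int[mu]_(t in D) (H t)%:E))%E).
  apply: lee_wpmul2l => //; apply: leeD => //.
  apply: le_trans dom _; apply: lee_wpmul2l => //.
  by rewrite lee_fin ltW.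
rewrite ge0_muleDr; last 2 first.
- by apply: mule_ge0; [rewrite lee_fin ltW|apply: integral_ge0 => t _; rewrite lee_fin].
- by apply: mule_ge0; [rewrite lee_fin ltW|apply: integral_ge0 => t _; rewrite lee_fin].
rewrite muleCA intD mule1 muleCA intH -EFinM -EFinD lee_fin.
by move: (tauE) (tau0); clear; lra.
Unshelve. all: by end_near. Qed.

(** [acos] is continuous on the open interval; extending it by zero makes it measurable on the whole
    line. *)
Let acos0 : R -> R := (@acos R) \_ (`](-1 : R), 1[%classic).

Let measurable_acos0 : measurable_fun setT acos0.
Proof.
apply/(measurable_restrictT (@acos R) _) => //.
apply: open_continuous_measurable_fun; first exact: interval_open.
by move=> x; rewrite inE /= in_itv /=; exact: continuous_acos.
Qed.

(** A measurable inverse of [expi] away from the points [1] and [-1], by which null sets of angles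
    are carried over to the circle. *)
Definition angle_of xi : R :=
  if 0 <= cim xi then acos0 (cre xi) else 2 * pi - acos0 (cre xi).

Lemma measurable_angle_of : measurable_fun setT angle_of.
Proof.
have mre : measurable_fun setT (@cre R).
  by apply: continuous_circle_measurable; exact: continuous_cre.
have mim : measurable_fun setT (@cim R).
  by apply: continuous_circle_measurable; exact: continuous_cim.
have ma : measurable_fun setT (fun xi => acos0 (cre xi)) by exact: measurableT_comp.
apply: measurable_fun_ifT => //.
- by apply: (measurable_fun_ler (f := cst 0)).
- by apply: measurable_funB.
Qed.

Lemma angle_ofP xi : -1 < cre xi < 1 -> 0 < angle_of xi < 2 * pi /\ expi (angle_of xi) = xi.
Proof.
move=> uP; have /andP[u1 u2] := uP; have a0 : acos0 (cre xi) = acos (cre xi).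
  by rewrite /acos0 patchE mem_set //= in_itv.
have g0 : 0 < acos (cre xi) by apply: acos_gt0; rewrite u2 ltW.
have gpi : acos (cre xi) < pi by apply: acos_ltpi; rewrite u1 ltW.
have u12 : -1 <= cre xi <= 1 by rewrite !ltW.
have ck : cos (acos (cre xi)) = cre xi by apply: acosK; rewrite in_itv.
have sk : sin (acos (cre xi)) = `|cim xi|.
  by rewrite sin_acos // -sqrtr_sqr -(circle_sqr xi) addrAC subrr add0r.
rewrite /angle_of a0; case: ifPn => [v0|v0].
  split; first by apply/andP; split; lra.
  by apply: expi_eq; rewrite ?ck // sk ger0_norm.
split; first by apply/andP; split; lra.
have -> : 2 * pi - acos (cre xi) = - acos (cre xi) + pi *+ 2 by rewrite mulr_natl addrC.
by apply: expi_eq; rewrite ?cosD2pi ?sinD2pi ?cosN ?sinN ?ck // sk ltr0_norm ?ltNge // opprK.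
Qed.

Let cos_oo t : 0 < t < pi -> -1 < cos t < 1.
Proof.
move=> /andP[t0 tp]; rewrite -cospi -cos0.
by rewrite !ltr_cos ?in_itv /= ?lexx ?pi_ge0 ?tp ?t0 //; rewrite !ltW.
Qed.

Let acos0K t : 0 < t < pi -> acos0 (cos t) = t.
Proof.
move=> t0p; have /andP[t0 tp] := t0p; rewrite /acos0 patchE mem_set.
  by rewrite cosK // in_itv /= !ltW.
by rewrite /= in_itv /=; exact: cos_oo.
Qed.

Let cos_reflect t : cos t = cos (2 * pi - t).
Proof. by rewrite -[in RHS]cosN opprB mulr_natl -[in LHS](subrK (pi *+ 2) t) cosD2pi. Qed.

Lemma angle_of_expi t : 0 <= t <= 2 * pi -> t \notin [:: 0; pi; 2 * pi] ->
  -1 < cos t < 1 /\ angle_of (expi t) = t.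
Proof.
move=> /andP[t0 t2]; rewrite !inE !negb_or => /and3P[/eqP n1 /eqP n2 /eqP n3].
have p0 := pi_gt0 R.
have t00 : 0 < t by rewrite lt_neqAle t0 andbT eq_sym; exact/eqP.
have t22 : t < 2 * pi by rewrite lt_neqAle t2 andbT; exact/eqP.
rewrite /angle_of -[cre _]/(cos t) -[cim _]/(sin t).
have [tp|tp|//] := ltgtP t pi.
  split; first by apply: cos_oo; rewrite t00.
  by rewrite ltW ?acos0K ?t00 //; apply: sin_gt0_pi; rewrite t00.
split; first by rewrite cos_reflect; apply: cos_oo; apply/andP; split; lra.
have sneg : sin t < 0.
  rewrite -(subrK pi t) sinDpi oppr_lt0; apply: sin_gt0_pi; apply/andP.
  by rewrite subr_gt0; split=> //; lra.
rewrite leNgt sneg /=.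
rewrite cos_reflect acos0K; [|apply/andP; split]; lra.
Qed.

(** Instead of the image of [N] under [expi], whose measurability is not immediate, the exceptional
    set is the preimage of [N] under [angle_of] together with the points [1] and [-1]. Its preimage
    in [[0, 2 pi]] lies in [N] and the three points 0, [pi], [2 pi]. *)
Lemma ae_expi (P : R -> Prop) : {ae mu, forall t, P t} ->
  {ae m, forall xi, exists2 t, 0 < t < 2 * pi & expi t = xi /\ P t}.
Proof.
move=> [N [mN N0 PN]].
have p0 := twopi_gt0 R.
have mre : measurable_fun setT (@cre R).
  by apply: continuous_circle_measurable; exact: continuous_cre.
pose E : set C := (angle_of @^-1` N) `|` (@cre R @^-1` (~` `](-1 : R), 1[%classic)).
have mE : measurable E.
  apply: measurableU; rewrite -[_ @^-1` _]setTI.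
    by apply: measurable_angle_of.
  by apply: mre => //; apply: measurableC.
exists E; split => //.
  rewrite -[E]setIT -integral_indic // ge0_integral_mT; last 2 first.
  - by apply/measurable_EFinP; exact: measurable_indic.
  - by move=> xi; rewrite lee_fin.
  rewrite (_ : (\int[mu]_(t in _) _ = 0)%E) ?mule0 //.
  have mE' : measurable (@expi R @^-1` E).
    by rewrite -[_ @^-1` _]setTI; exact: measurable_expi.
  transitivity (\int[mu]_(t in `[0%R, (2 * pi)%R]%classic) (\1_(@expi R @^-1` E) t)%:E)%E => //.
  rewrite integral_indic //.
  have mN' : measurable (N `|` [set 0; pi; 2 * pi]).
    by do! apply: measurableU => //.
  apply: (subset_measure0 (B := N `|` [set 0; pi; 2 * pi])) => //.
  - exact: measurableI.
  - move=> t [Et]; rewrite /= in_itv /= => tD.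
    have [|tn] := boolP (t \in [:: 0; pi; 2 * pi]).
      by rewrite !inE => /or3P[] /eqP ->; right => /=; tauto.
    have [tc tE] := angle_of_expi tD tn.
    case: Et => [|]; rewrite /preimage /=; first by rewrite tE; left.
    by rewrite in_itv /= -[cre _]/(cos t) tc.
  apply: null_set_setU => //.
  - by do! apply: measurableU => //.
  - by apply: countable_lebesgue_measure0; apply: finite_set_countable; exact: finite_set3.
move=> xi /= nP; apply: contrapT => nE; apply: nP.
have [uP|uP] := boolP (-1 < cre xi < 1); last first.
  by exfalso; apply: nE; right => /=; rewrite in_itv /=; exact/negP.
have [h1 h2] := angle_ofP uP.
exists (angle_of xi) => //; split => //.
by apply: contrapT => /PN h; apply: nE; left.
Qed.

Lemma ae_lebesgue_pt_expi k : m.-integrable setT (EFin \o k) ->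
  {ae mu, forall t, lebesgue_pt ((fun t => k (expi t)) \_ `[0, 2 * pi]%classic) t}.
Proof.
move=> ik; apply: lebesgue_differentiation; apply: integrable_locally => //.
by apply: integrable_comp_expi.
Qed.

Lemma ae_kernel_average a k : 2^-1 <= a -> m.-integrable setT (EFin \o k) ->
  {ae m, forall xi, forall eta : R, 0 < eta -> \forall r \near (1 : R)^'-,
    \int[m]_xi' (Q a (r%:C * set_val xi) xi' * `|k xi' - k xi|) <= eta}.
Proof.
move=> a2 ik; have := ae_expi (ae_lebesgue_pt_expi ik).
apply: filterS => xi [t t02 [<- lt]] eta eta0.
exact: lebesgue_pt_kernel.
Qed.

Lemma Q_average_le a z g (w : R[i]^o) : cabs z < 1 -> cintegrable m g ->
  \int[m]_xi (Q a z xi * cabs (g xi - w)) <=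
  \int[m]_xi (Q a z xi * `|complex.Re (g xi) - complex.Re w|) +
  \int[m]_xi (Q a z xi * `|complex.Im (g xi) - complex.Im w|).
Proof.
move=> z1 ig; have igw := cintegrableB_cst w ig; have [iRw iIw] := igw.
have iA : m.-integrable setT
    (EFin \o (fun xi => Q a z xi * `|complex.Re (g xi) - complex.Re w|)).
  have := integrable_QM a z1 (integrable_norm iRw).
  by apply: eq_integrable => // xi _ /=; rewrite ReD ReN.
have iB : m.-integrable setT
    (EFin \o (fun xi => Q a z xi * `|complex.Im (g xi) - complex.Im w|)).
  have := integrable_QM a z1 (integrable_norm iIw).
  by apply: eq_integrable => // xi _ /=; rewrite ImD ImN.
have iC := integrable_QM a z1 (integrable_cabs igw).
rewrite -(RintegralD measurableT iA iB).
apply: (le_Rintegral measurableT iC (integrableD measurableT iA iB)) => xi _.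
rewrite /= -mulrDr; apply: ler_wpM2l; first by rewrite ltW // Q_gt0.
by apply: le_trans (cabs_le_ReIm _) _; rewrite ReD ImD ReN ImN.
Qed.

(** The averages of the real and imaginary parts are controlled separately, each at almost every
    point, and [Q_average_le] recombines them. *)
Lemma radial_ae n (lam : R[i]^o) g :
  ~ (complex.Im lam = 0 /\ complex.Re lam < - 4^-1) -> cintegrable m g ->
  {ae m, forall xi, radial n lam (Pi_fun n lam g) r xi @[r --> 1^'-] --> g xi}.
Proof.
move=> hlam ig; have [a [c [a2 c0 h]]] := radial_quotient_le n hlam.
have [iR iI] := ig.
have := ae_kernel_average a2 iR; have := ae_kernel_average a2 iI.
apply: filterS2 => xi hI hR; apply/cvgcP => eps eps0.
have c4 : 0 < 4 * c by rewrite mulr_gt0.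
have eta0 : 0 < eps / (4 * c) by rewrite divr_gt0.
have etaE : eps / (4 * c) * (4 * c) = eps by rewrite divfK // lt0r_neq0.
apply: filterS3 h (hR _ eta0) (hI _ eta0) => r [/andP[r0 r1] hr] bR bI.
have z1 : cabs (r%:C * set_val xi : R[i]^o) < 1 by rewrite cabs_radius.
apply: le_lt_trans (hr g xi (g xi) ig) _.
have := le_trans (Q_average_le a (g xi) z1 ig) (lerD bR bI); rewrite -(ler_pM2l c0).
move: (\int[m]_xi' _) => X; move: etaE eps0; move: (eps / _) => eta; clear; lra.
Qed.

End lebesgue_points.

(** * Measurability and Fubini for integrals with a parameter *)

Section parametric_integral.
Context {d1 d2 : measure_display} {T1 : measurableType d1} {T2 : measurableType d2}.
Context {R : realType}.

(** Tonelli's measurability statement, applied to the positive and to the negative part. *)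
Lemma measurable_parametric_integral (m2 : {sigma_finite_measure set T2 -> \bar R})
    (f : T1 * T2 -> \bar R) :
  measurable_fun setT f -> measurable_fun setT (fun x => \int[m2]_y f (x, y))%E.
Proof.
move=> mf; under eq_fun do rewrite integralE.
apply: emeasurable_funB.
- have h := measurable_fun_fubini_tonelli_F (m2 := m2) _ (measurable_funepos mf)
    (fun p => funepos_ge0 f p).
  move: h; apply: eq_measurable_fun => x _; apply: eq_integral => y _.
  by rewrite !funeposE.
- have h := measurable_fun_fubini_tonelli_F (m2 := m2) _ (measurable_funeneg mf)
    (fun p => funeneg_ge0 f p).
  move: h; apply: eq_measurable_fun => x _; apply: eq_integral => y _.
  by rewrite !funenegE.
Qed.

Lemma cmeasurable_parametric_integral (m2 : {sigma_finite_measure set T2 -> \bar R})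
    (K : T1 * T2 -> R[i]^o) :
  cmeasurable K -> cmeasurable (fun x => cintegral m2 (fun y => K (x, y))).
Proof.
move=> [mR mI]; split; apply: (measurableT_comp (fine_measurable measurableT)).
- by apply: (@measurable_parametric_integral m2 (EFin \o (fun p => complex.Re (K p))));
    exact/measurable_EFinP.
- by apply: (@measurable_parametric_integral m2 (EFin \o (fun p => complex.Im (K p))));
    exact/measurable_EFinP.
Qed.

Variables (m1 : {finite_measure set T1 -> \bar R}) (m2 : {finite_measure set T2 -> \bar R}).

Lemma integrable_bounded d (T : measurableType d) (mu : {finite_measure set T -> \bar R})
    (f : T -> R) (B : R) :
  measurable_fun setT f -> (forall x, `|f x| <= B) -> mu.-integrable setT (EFin \o f).
Proof.
move=> mf fB; apply: (@le_integrable _ _ _ mu _ measurableT _ (EFin \o cst B)).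
- exact/measurable_EFinP.
- move=> x _; rewrite /= lee_fin; exact: le_trans (fB x) (ler_norm _).
- exact: finite_measure_integrable_cst.
Qed.

Lemma Rintegral_fubini (f : T1 * T2 -> R) (B : R) :
  measurable_fun setT f -> (forall p, `|f p| <= B) ->
  \int[m1]_x \int[m2]_y f (x, y) = \int[m2]_y \int[m1]_x f (x, y).
Proof.
move=> mf fB.
have i2 x : m2.-integrable setT (EFin \o (fun y => f (x, y))).
  by apply: (@integrable_bounded _ _ _ _ B) => //; apply: measurableT_comp.
have i1 y : m1.-integrable setT (EFin \o (fun x => f (x, y))).
  by apply: (@integrable_bounded _ _ _ _ B) => //; apply: measurableT_comp.
have i12 : (m1 \x m2)%E.-integrable setT (EFin \o f).
  apply/integrable12ltyP; first exact/measurable_EFinP.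
  apply: (@le_lt_trans _ _ (\int[m1]_x \int[m2]_y (cst `|B|%:E (x, y)))%E).
    apply: ge0_le_integral => //.
    - by move=> x _; apply: integral_ge0.
    - apply: (@measurable_parametric_integral m2 (fun p => `|(f p)%:E|%E)).
      by apply: measurableT_comp => //; exact/measurable_EFinP.
    - exact: (@measurable_parametric_integral m2 (cst `|B|%:E)).
    - move=> x _; apply: ge0_le_integral => //.
      + by apply: measurableT_comp => //; apply/measurable_EFinP; apply: measurableT_comp.
      + by move=> y _; rewrite lee_fin; exact: le_trans (fB _) (ler_norm _).
  under eq_integral do rewrite integral_cst //.
  rewrite integral_cst // -muleA lte_mul_pinfty //.
  by rewrite lte_mul_pinfty // ?fin_num_measure // ltey_eq fin_num_measure.
congr fine.
transitivity (\int[m1]_x \int[m2]_y (EFin \o f) (x, y))%E.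
  by apply: eq_integral => x _; rewrite fineK //; exact: (integrable_fin_num measurableT (i2 x)).
rewrite Fubini //.
by apply: eq_integral => y _; rewrite /= fineK //; exact: (integrable_fin_num measurableT (i1 y)).
Qed.

Lemma cintegral_fubini (K : T1 * T2 -> R[i]^o) (B : R) :
  cmeasurable K -> (forall p, cabs (K p) <= B) ->
  cintegral m1 (fun x => cintegral m2 (fun y => K (x, y))) =
  cintegral m2 (fun y => cintegral m1 (fun x => K (x, y))).
Proof.
move=> [mR mI] KB; congr (_ +i* _).
- apply: (@Rintegral_fubini (fun p => complex.Re (K p)) B) => // p.
  exact: le_trans (cabs_Re _) (KB p).
- apply: (@Rintegral_fubini (fun p => complex.Im (K p)) B) => // p.
  exact: le_trans (cabs_Im _) (KB p).
Qed.

End parametric_integral.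

(** * Joint measurability of the kernels *)

Section kernel_measurability.
Variable R : realType.
Notation C := (circle R).

(** Measurability for the product sigma-algebra is read off from the formula for [|xi' - r xi| ^ 2]
    in the coordinates of the two points. *)
Lemma measurable_lnP_prod (r : R) : 0 <= r < 1 ->
  measurable_fun setT (fun p : C * C => lnP (r%:C * set_val p.1) p.2).
Proof.
move=> /andP[r0 r1].
have mre : measurable_fun setT (@cre R).
  by apply: continuous_circle_measurable; exact: continuous_cre.
have mim : measurable_fun setT (@cim R).
  by apply: continuous_circle_measurable; exact: continuous_cim.
have z1 (xi : C) : cabs (r%:C * set_val xi : R[i]^o) < 1 by rewrite cabs_radius.
have r2 : 0 < 1 - r ^+ 2 by nra.
have -> : (fun p : C * C => lnP (r%:C * set_val p.1) p.2) = (fun p =>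
    ln (1 - r ^+ 2) - ln (1 + r ^+ 2 -
      (2 * r) * (cre p.1 * cre p.2 + cim p.1 * cim p.2))).
  apply/funext => -[xi xi'] /=; rewrite /lnP /poisson lnM ?lnV ?posrE ?invr_gt0 //.
  - by rewrite cabs_radius // cabs_sub_circle cabs_radius // !(ReM, ImM) /=;
      congr (_ - ln (_ - _)); rewrite /cre /cim; ring.
  - by rewrite exprn_gt0 // cabs_sub_gt0.
  - by rewrite cabs_radius.
  - by rewrite exprn_gt0 // cabs_sub_gt0.
apply: measurable_funB => //; apply: measurableT_comp; first exact: measurable_ln.
apply: measurable_funB => //; apply: measurable_funM => //.
by apply: measurable_funD; apply: measurable_funM; apply: measurableT_comp.
Qed.

Lemma cmeasurable_cfun_lnP (F : R -> R[i]) (r : R) : cfun F -> 0 <= r < 1 ->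
  cmeasurable (fun p : C * C => F (lnP (r%:C * set_val p.1) p.2)).
Proof.
move=> [cR cI] r01; have ml := measurable_lnP_prod r01; split.
- apply: (measurableT_comp (f := fun u => complex.Re (F u))) => //.
  exact: continuous_measurable_fun.
- apply: (measurableT_comp (f := fun u => complex.Im (F u))) => //.
  exact: continuous_measurable_fun.
Qed.

Lemma measurable_Q_prod (a r : R) : 0 <= r < 1 ->
  measurable_fun setT (fun p : C * C => Q a (r%:C * set_val p.1) p.2).
Proof.
move=> r01; have ml := measurable_lnP_prod r01.
have -> : (fun p : C * C => Q a (r%:C * set_val p.1) p.2) =
    (fun p => expR (a * lnP (r%:C * set_val p.1) p.2) / J a r).
  by apply/funext => p; rewrite /Q cabs_radius //; case/andP: r01.
apply: measurable_funM => //; apply: measurableT_comp => //.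
exact: measurable_funM.
Qed.

End kernel_measurability.

(** * Inequalities for powers *)

Section power_inequalities.
Context {R : realType}.
Implicit Types (p x y : R).

(** Young's inequality against the constant 1; equivalently, the graph of [x ^ p] lies above its
    tangent at 1. *)
Lemma bernoulli_powR p x : 1 <= p -> 0 <= x -> p * x <= x `^ p + (p - 1).
Proof.
rewrite le_eqVlt => /predU1P[<- x0|p1 x0].
  by rewrite mul1r powRr1 // subrr addr0.
have p0 : 0 < p by lra.
have q0 : 0 < p / (p - 1) by rewrite divr_gt0 // subr_gt0.
have pq : p^-1 + (p / (p - 1))^-1 = 1.
  by rewrite invf_div -{1}(div1r p) -mulrDl addrC subrK divff // gt_eqF.
have := conjugate_powR x0 ler01 p0 q0 pq; rewrite powR1 mulr1 mul1r invf_div.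
rewrite -mulrDl ler_pdivlMr //; lra.
Qed.

Lemma le1D_powR p x : 1 <= p -> 0 <= x -> x <= 1 + x `^ p.
Proof.
move=> p1 x0; have := bernoulli_powR p1 x0; have := powR_ge0 x p; nra.
Qed.

(** From [x + y <= 2 max (x, y)]; this constant is enough for domination. *)
Lemma powRD_le p x y : 1 <= p -> 0 <= x -> 0 <= y ->
  (x + y) `^ p <= 2 `^ p * (x `^ p + y `^ p).
Proof.
move=> p1; have p0 : 0 <= p by lra.
wlog xy : x y / x <= y => [hw x0 y0|x0 y0].
  have [xy|/ltW xy] := leP x y; first exact: hw.
  by rewrite addrC [X in _ * X]addrC; exact: hw.
apply: (@le_trans _ _ ((2 * y) `^ p)).
  by apply: ge0_ler_powR; rewrite ?nnegrE //; lra.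
by rewrite powRM // ler_wpM2l ?powR_ge0 // lerDr powR_ge0.
Qed.

(** Once [u k < 1], [u k ^ p <= u k]. *)
Lemma powR_cvg0 (u : R ^nat) p : 1 <= p -> (forall k, 0 <= u k) ->
  u k @[k --> \oo] --> (0 : R) -> u k `^ p @[k --> \oo] --> (0 : R).
Proof.
move=> p1 u0 cu; have p0 : 0 < p by exact: lt_le_trans p1.
apply: (squeeze_cvgr _ (cvg_cst (0 : R)) cu).
have : \forall k \near \oo, u k < 1 by apply: (cvgr_lt 0 cu).
apply: filterS => k uk; rewrite powR_ge0 /=.
rewrite -[leRHS]mulr1 -(mulr_powRB1 (u0 k) p0) ler_wpM2l //.
apply: (@le_trans _ _ (1 `^ (p - 1))); last by rewrite powR1.
by apply: ge0_ler_powR; rewrite ?nnegrE ?subr_ge0 // ltW.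
Qed.

Lemma cabsB_powR_le (w w' : R[i]^o) p : 1 <= p ->
  cabs (w - w') `^ p <= 2 `^ p * (cabs w `^ p + cabs w' `^ p).
Proof.
move=> p1; have p0 : 0 <= p by lra.
have D : cabs (w - w') <= cabs w + cabs w' by rewrite (le_trans (cabsD _ _)) // cabsN.
apply: le_trans (ge0_ler_powR p0 _ _ D) _.
- by rewrite nnegrE cabs_ge0.
- by rewrite nnegrE addr_ge0 // cabs_ge0.
- exact: powRD_le (cabs_ge0 _) (cabs_ge0 _).
Qed.

End power_inequalities.

(** * Jensen's inequality and dominated convergence *)

Section Rintegral_inequalities.
Context {d : measure_display} {T : measurableType d} {R : realType}.
Variables (mu : {measure set T -> \bar R}).
Implicit Types (w k : T -> R).

(** The tangent inequality [bernoulli_powR] at [k / X], multiplied by [w * X ^ p] and integrated,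
    where [w] has integral one; the degenerate mean [X = 0] is separate. *)
Lemma jensen_powR (p : R) w k : 1 <= p ->
  (forall x, 0 <= w x) -> (forall x, 0 <= k x) ->
  mu.-integrable setT (EFin \o w) -> \int[mu]_x w x = 1 ->
  mu.-integrable setT (EFin \o (fun x => w x * k x)) ->
  mu.-integrable setT (EFin \o (fun x => w x * k x `^ p)) ->
  (\int[mu]_x (w x * k x)) `^ p <= \int[mu]_x (w x * k x `^ p).
Proof.
move=> p1 w0 k0 iw w1 iwk iwkp; set X := \int[mu]_x (w x * k x).
have X0 : 0 <= X by apply: Rintegral_ge0 => x _; exact: mulr_ge0.
have [->|Xn0] := eqVneq X 0.
  rewrite powR0; last by lra.
  by apply: Rintegral_ge0 => x _; rewrite mulr_ge0 ?powR_ge0.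
have Xgt0 : 0 < X by rewrite lt_def Xn0.
have Xp0 : 0 < X `^ p by rewrite powR_gt0.
pose c := X `^ p / X.
have h x : p * c * (w x * k x) <= w x * k x `^ p + (p - 1) * X `^ p * w x.
  have := bernoulli_powR p1 (divr_ge0 (k0 x) X0).
  have -> : (k x / X) `^ p = k x `^ p / X `^ p.
    by rewrite powRM ?invr_ge0 // -(powR_inv1 X0) -powRrM mulN1r powRN.
  have wX : 0 <= w x * X `^ p by rewrite mulr_ge0 // ltW.
  move=> /(ler_wpM2l wX).
  have -> : w x * X `^ p * (k x `^ p / X `^ p + (p - 1)) =
            w x * k x `^ p + (p - 1) * X `^ p * w x.
    by rewrite mulrDr; congr (_ + _); [field; rewrite gt_eqF|ring].
  by apply: le_trans; rewrite /c le_eqVlt; apply/orP; left; apply/eqP; ring.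
have i1 : mu.-integrable setT (EFin \o (fun x => p * c * (w x * k x))).
  exact: (integrableZl measurableT (p * c) iwk).
have i2 : mu.-integrable setT (EFin \o (fun x => (p - 1) * X `^ p * w x)).
  exact: (integrableZl measurableT ((p - 1) * X `^ p) iw).
have := le_Rintegral measurableT i1 (integrableD measurableT iwkp i2) (fun x _ => h x).
rewrite (RintegralZl _ measurableT iwk) -/X (RintegralD measurableT iwkp i2).
rewrite (RintegralZl _ measurableT iw) w1 mulr1.
have -> : p * c * X = p * X `^ p by rewrite /c mulrA -mulrA mulVf // mulr1.
lra.
Qed.

Lemma Rintegral_dominated_cvg (f : nat -> T -> R) (g h : T -> R) :
  (forall n, measurable_fun setT (f n)) -> measurable_fun setT g ->
  {ae mu, forall x, f n x @[n --> \oo] --> g x} ->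
  mu.-integrable setT (EFin \o h) ->
  {ae mu, forall x, forall n, `|f n x| <= h x} ->
  \int[mu]_x f n x @[n --> \oo] --> \int[mu]_x g x.
Proof.
move=> mf mg fg ih fh.
have ae1 : {ae mu, forall x, setT x -> (EFin \o f n) x @[n --> \oo] --> (EFin \o g) x}.
  by apply: filterS fg => x fx _; apply: cvg_EFin => //; apply: nearW.
have ae2 : {ae mu, forall x, forall n, setT x -> (`|(EFin \o f n) x| <= (EFin \o h) x)%E}.
  by apply: filterS fh => x hx n _; rewrite lee_fin.
have [ig _ cf] := dominated_convergence measurableT
  (fun n => proj2 (measurable_EFinP _ _) (mf n)) (proj2 (measurable_EFinP _ _) mg) ae1 ih ae2.
apply: fine_cvg; rewrite fineK //; exact: integrable_fin_num.
Qed.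

(** The majorants vary but keep their integral. The fixed majorant [2 G] is recovered from
    [f n <= phi n + (G_ n - G)], where the bracket has integral zero. *)
Lemma dominated_cvg0_varying (f G_ : nat -> T -> R) (G : T -> R) :
  (forall n, measurable_fun setT (f n)) ->
  (forall n, mu.-integrable setT (EFin \o G_ n)) -> mu.-integrable setT (EFin \o G) ->
  (forall n x, 0 <= f n x <= G_ n x) -> (forall x, 0 <= G x) ->
  (forall n, \int[mu]_x G_ n x = \int[mu]_x G x) ->
  {ae mu, forall x, f n x @[n --> \oo] --> (0 : R)} ->
  {ae mu, forall x, G_ n x @[n --> \oo] --> G x} ->
  \int[mu]_x f n x @[n --> \oo] --> (0 : R).
Proof.
move=> mf iG_ iG fG G0 IG f0 GG.
have mG_ n : measurable_fun setT (G_ n) by apply/measurable_EFinP; exact: measurable_int (iG_ n).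
have mG : measurable_fun setT G by apply/measurable_EFinP; exact: measurable_int iG.
(* [f n] is cut at [G], and the positive part of [G - G_ n] makes up for the points where the
   varying majorant is below [G]; the sum is at most [2 G] and still tends to zero. *)
pose phi n x := Num.min (f n x) (G x) + Num.max (G x - G_ n x) 0.
have phi0 n x : 0 <= phi n x.
  by rewrite addr_ge0 // ?le_min ?G0 ?le_max ?lexx ?orbT //; case/andP: (fG n x) => ->.
have phiG n x : phi n x <= 2 * G x.
  have /andP[f1 f2] := fG n x; have g0 := G0 x.
  have : Num.min (f n x) (G x) <= G x by rewrite ge_min lexx orbT.
  have : Num.max (G x - G_ n x) 0 <= G x by rewrite ge_max g0 andbT; lra.
  rewrite /phi; lra.
have mphi n : measurable_fun setT (phi n).
  apply: measurable_funD; first exact: measurable_minr.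
  by apply: measurable_maxr => //; exact: measurable_funB.
have i2G : mu.-integrable setT (EFin \o (fun x => 2 * G x)) := integrableZl measurableT 2 iG.
have iphi n : mu.-integrable setT (EFin \o phi n).
  apply: (@le_integrable _ _ _ mu _ measurableT _ (EFin \o (fun x => 2 * G x))) => //.
    exact/measurable_EFinP.
  by move=> x _; rewrite /= lee_fin ger0_norm // (le_trans (phiG n x)) // ler_norm.
have fphi n x : f n x <= phi n x + (G_ n x - G x).
  have /andP[f1 f2] := fG n x; rewrite /phi.
  by case: (leP (f n x) (G x)) => ?; case: (leP (G x - G_ n x) 0) => ?; lra.
have intphi : \int[mu]_x phi n x @[n --> \oo] --> (0 : R).
  have -> : (0 : R) = \int[mu]_x 0 by rewrite Rintegral_cst // mul0r.
  apply: (Rintegral_dominated_cvg mphi _ _ i2G) => //.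
    apply: filterS2 f0 GG => x fx Gx.
    have bnd : f n x + `|G x - G_ n x| @[n --> \oo] --> (0 : R).
      have cG : `|G x - G_ n x| @[n --> \oo] --> (0 : R).
        by have := cvg_norm (cvgB (cvg_cst (G x)) Gx); rewrite subrr normr0; exact.
      by have := cvgD fx cG; rewrite addr0; exact.
    apply: (squeeze_cvgr _ (cvg_cst (0 : R)) bnd); apply: nearW => n.
    rewrite phi0 /= /phi lerD ?ge_min ?lexx // ge_max ler_norm normr_ge0 //.
  by apply: nearW => x n; rewrite ger0_norm.
apply: (squeeze_cvgr _ (cvg_cst (0 : R)) intphi); apply: nearW => n.
apply/andP; split; first by apply: Rintegral_ge0 => x _; case/andP: (fG n x).
have if_ : mu.-integrable setT (EFin \o f n).
  apply: (@le_integrable _ _ _ mu _ measurableT _ (EFin \o G_ n)) => //.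
    exact/measurable_EFinP.
  move=> x _; have /andP[f1 f2] := fG n x.
  by rewrite /= lee_fin ger0_norm // (le_trans f2) // ler_norm.
have iB := integrableB measurableT (iG_ n) iG.
apply: le_trans (le_Rintegral measurableT if_ (integrableD measurableT (iphi n) iB) (fun x _ => fphi n x)) _.
rewrite (RintegralD measurableT (iphi n) iB) (RintegralB measurableT (iG_ n) iG).
by rewrite IG subrr addr0.
Qed.

End Rintegral_inequalities.

(** * Left limits through sequences, and complex dominated convergence *)

Section left_limits.
Context {d : measure_display} {T : measurableType d} {R : realType}.
Variable mu : {measure set T -> \bar R}.

(** Dominated convergence speaks of sequences. A sequence tending to 1 from below is shifted so that
    [P], which holds only near 1, holds for all its terms. *)
Lemma cvg_left_seq (P : R -> Prop) (N : R -> R) (l : R) :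
  (\forall r \near (1 : R)^'-, P r) ->
  (forall u : R ^nat, (forall j, P (u j)) -> u j @[j --> \oo] --> (1 : R)^'- ->
    N (u j) @[j --> \oo] --> l) ->
  N r @[r --> (1 : R)^'-] --> l.
Proof.
move=> nP h; apply/cvg_at_leftP => u [u1 cu].
have [rho rho1 hrho] := near1_ex nP.
have [N0 _ hN] : \forall j \near \oo, rho < u j by exact: (cvgr_gt 1 cu).
rewrite -(cvg_shiftn N0); apply: (h (fun j => u (j + N0)%N)) => [j|].
  by apply: hrho; rewrite hN ?u1 //= leq_addl.
have cs : u (j + N0)%N @[j --> \oo] --> (1 : R) by rewrite (cvg_shiftn N0 u).
move=> A hA.
have h2 : \forall j \near \oo, u (j + N0)%N < 1 -> A (u (j + N0)%N) := cs _ hA.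
suff : \forall j \near \oo, A (u (j + N0)%N) by [].
by apply: filterS h2 => j; apply; exact: u1.
Qed.

Lemma Rintegral_dominated_cvg_left (f : R -> T -> R) (g k : T -> R) :
  (\forall r \near (1 : R)^'-, measurable_fun setT (f r) /\ forall x, `|f r x| <= k x) ->
  measurable_fun setT g -> mu.-integrable setT (EFin \o k) ->
  {ae mu, forall x, f r x @[r --> (1 : R)^'-] --> g x} ->
  \int[mu]_x f r x @[r --> (1 : R)^'-] --> \int[mu]_x g x.
Proof.
move=> nf mg ik fg; apply: (cvg_left_seq nf) => u hu u1.
apply: (Rintegral_dominated_cvg (f := fun j x => f (u j) x) (h := k)) => //.
- by move=> j; exact: (hu j).1.
- by apply: filterS fg => x cx; exact: (cvg_comp _ _ u1 cx).
- by apply: nearW => x j; exact: (hu j).2.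
Qed.

Lemma cvgc_ReIm (I : Type) (F : set_system I) (f : I -> R[i]^o) (l : R[i]^o) : Filter F ->
  complex.Re (f x) @[x --> F] --> complex.Re l ->
  complex.Im (f x) @[x --> F] --> complex.Im l -> f @ F --> l.
Proof.
move=> FF cR cI; apply/cvgcP => eps eps0.
have e2 : 0 < eps / 2 by rewrite divr_gt0.
have /cvgrPdist_lt/(_ _ e2) hR := cR.
have /cvgrPdist_lt/(_ _ e2) hI := cI.
apply: filterS2 hR hI => x xR xI; apply: le_lt_trans (cabs_le_ReIm _) _.
rewrite ReD ReN ImD ImN distrC [X in _ + X]distrC [ltRHS]splitr.
exact: ltrD.
Qed.

Lemma cvgc_Re (I : Type) (F : set_system I) (f : I -> R[i]^o) (l : R[i]^o) : Filter F ->
  f @ F --> l -> complex.Re (f x) @[x --> F] --> complex.Re l.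
Proof.
move=> FF cf; apply: (cvg_comp _ _ cf); exact: continuous_Re.
Qed.

Lemma cvgc_Im (I : Type) (F : set_system I) (f : I -> R[i]^o) (l : R[i]^o) : Filter F ->
  f @ F --> l -> complex.Im (f x) @[x --> F] --> complex.Im l.
Proof.
move=> FF cf; apply: (cvg_comp _ _ cf); exact: continuous_Im.
Qed.

Lemma cvgcMl (I : Type) (F : set_system I) (f : I -> R[i]^o) (w l : R[i]^o) : Filter F ->
  f @ F --> l -> w * f x @[x --> F] --> w * l.
Proof.
move=> FF /cvgcP cf; apply/cvgcP => eps eps0.
have w0 : 0 < cabs w + 1 by rewrite ltr_wpDl // cabs_ge0.
apply: filterS (cf (eps / (cabs w + 1)) (divr_gt0 eps0 w0)) => x xl.
rewrite -mulrBr cabsM.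
apply: (@le_lt_trans _ _ ((cabs w + 1) * cabs (f x - l))).
  by rewrite ler_wpM2r ?cabs_ge0 // lerDl.
by rewrite mulrC -ltr_pdivlMr.
Qed.

Lemma cintegral_dominated_cvg_left (f : R -> T -> R[i]^o) (g : T -> R[i]^o) (k : T -> R) :
  (\forall r \near (1 : R)^'-, cmeasurable (f r) /\ forall x, cabs (f r x) <= k x) ->
  cmeasurable g -> mu.-integrable setT (EFin \o k) ->
  {ae mu, forall x, f r x @[r --> (1 : R)^'-] --> g x} ->
  cintegral mu (f r) @[r --> (1 : R)^'-] --> (cintegral mu g : R[i]^o).
Proof.
move=> nf [mR mI] ik fg; apply: cvgc_ReIm.
- apply: (Rintegral_dominated_cvg_left (f := fun r x => complex.Re (f r x)) _ mR ik).
    apply: filterS nf => r [[m1 m2] b]; split=> // x.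
    exact: le_trans (cabs_Re _) (b x).
  by apply: filterS fg => x; exact: cvgc_Re.
- apply: (Rintegral_dominated_cvg_left (f := fun r x => complex.Im (f r x)) _ mI ik).
    apply: filterS nf => r [[m1 m2] b]; split=> // x.
    exact: le_trans (cabs_Im _) (b x).
  by apply: filterS fg => x; exact: cvgc_Im.
Qed.

End left_limits.

(** * Integration against densities *)

Section density.
Context {d : measure_display} {T : measurableType d} {R : realType}.
Implicit Types (k f : T -> R) (h F : T -> R[i]^o).

Lemma integrable_bounded_mul (mu : {measure set T -> \bar R}) k f (B : R) :
  measurable_fun setT k -> (forall x, `|k x| <= B) -> mu.-integrable setT (EFin \o f) ->
  mu.-integrable setT (EFin \o (fun x => k x * f x)).
Proof.
move=> mk kB intf; have mf : measurable_fun setT f.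
  by apply/measurable_EFinP; exact: measurable_int intf.
apply: (le_integrable measurableT _ _ (integrableZl measurableT B (integrable_norm intf))).
  by apply/measurable_EFinP; exact: measurable_funM.
move=> x _; rewrite /= lee_fin !normrM normr_id ler_wpM2r //.
exact: le_trans (kB x) (ler_norm _).
Qed.

Section finite_measure.
Variable mu : {finite_measure set T -> \bar R}.

Let RN (nu : {finite_measure set T -> \bar R}) x :=
  fine (Radon_Nikodym (charge_of_finite_measure nu) mu x).

Let RNE (nu : {finite_measure set T -> \bar R}) : nu `<< mu ->
  (fun x => (RN nu x)%:E) = Radon_Nikodym (charge_of_finite_measure nu) mu.
Proof.
move=> numu; apply/funext => x.
by rewrite /RN fineK //; exact: Radon_Nikodym_fin_num.
Qed.

Let integrable_RN (nu : {finite_measure set T -> \bar R}) : nu `<< mu ->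
  mu.-integrable setT (EFin \o RN nu).
Proof. by move=> numu; have := @Radon_Nikodym_integrable _ _ _ (charge_of_finite_measure nu) mu numu; rewrite -(RNE numu). Qed.

Let Rintegral_RN (nu : {finite_measure set T -> \bar R}) k (B : R) : nu `<< mu ->
  measurable_fun setT k -> (forall x, `|k x| <= B) ->
  \int[nu]_x k x = \int[mu]_x (k x * RN nu x).
Proof.
move=> numu mk kB; have ik := @integrable_bounded R d T nu k B mk kB.
rewrite /Rintegral -(Radon_Nikodym_change_of_variables numu measurableT ik).
by congr fine; apply: eq_integral => x _; rewrite -(RNE numu) EFinM.
Qed.

(** Both Jordan parts are absolutely continuous with respect to [mu], and the difference of their
    Radon-Nikodym densities is [f] almost everywhere, since the two have the same integral over
    every measurable set. *)
Lemma Rintegral_jordan f k (B : R) (intf : mu.-integrable setT (fun x => (f x)%:E)) :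
  measurable_fun setT k -> (forall x, `|k x| <= B) ->
  \int[jordan_pos (hahn_posneg (induced_charge intf))]_x k x -
  \int[jordan_neg (hahn_posneg (induced_charge intf))]_x k x =
  \int[mu]_x (k x * f x).
Proof.
move=> mk kB; set nu := induced_charge intf; set nuPN := hahn_posneg nu.
have numu : nu `<< mu.
  apply/null_content_dominatesP => A mA muA; apply: null_set_integral => //.
  by apply: measurable_funTS; exact: measurable_int intf.
have pmu := jordan_pos_dominates nuPN numu.
have nmu := jordan_neg_dominates nuPN numu.
have ip := integrable_RN pmu; have inn := integrable_RN nmu.
have ikp := integrable_bounded_mul mk kB ip; have ikn := integrable_bounded_mul mk kB inn.
rewrite (Rintegral_RN pmu mk kB) (Rintegral_RN nmu mk kB).
rewrite -(RintegralB measurableT ikp ikn).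
have ae : ae_eq mu setT (fun x => (RN (jordan_pos nuPN) x - RN (jordan_neg nuPN) x)%:E)
    (fun x => (f x)%:E).
  apply: integral_ae_eq => //.
  - exact: (integrableB measurableT ip inn).
  - exact: measurable_int intf.
  - move=> E _ mE.
    have subE g : mu.-integrable setT (EFin \o g) -> mu.-integrable E (EFin \o g).
      exact: integrableS.
    rewrite (integralB_EFin mE (subE _ ip) (subE _ inn)).
    have IE (la : {finite_measure set T -> \bar R}) : la `<< mu ->
        (\int[mu]_(x in E) (RN la x)%:E)%E = la E.
      move=> lamu; rewrite (RNE lamu); apply/esym.
      exact: (@Radon_Nikodym_integral _ _ _ (charge_of_finite_measure la) mu E lamu mE).
    rewrite (IE _ pmu) (IE _ nmu).
    by have := jordan_decomp nuPN mE; rewrite /cadd /= cscaleN1.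
rewrite /Rintegral; congr fine; apply: ae_eq_integral => //.
- by apply: measurable_int (integrableB measurableT ikp ikn).
- by apply: measurable_int (integrable_bounded_mul mk kB intf).
- by apply: filterS ae => x /(_ I)[h] _; rewrite -mulrBr h.
Qed.

End finite_measure.
End density.

(** * Integration against complex measures *)

Section complex_measures.
Context {d : measure_display} {T : measurableType d} {R : realType}.
Implicit Types (k h F : T -> R[i]^o) (nu : cmeasure T R).

Definition cbounded h := cmeasurable h /\ exists B : R, forall x, cabs (h x) <= B.

Lemma cbounded_cintegrable (mu : {finite_measure set T -> \bar R}) h :
  cbounded h -> cintegrable mu h.
Proof.
move=> [[mR mI] [B hB]]; split.
- apply: (@integrable_bounded R d T mu _ B) => // x; exact: le_trans (cabs_Re _) (hB x).
- apply: (@integrable_bounded R d T mu _ B) => // x; exact: le_trans (cabs_Im _) (hB x).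
Qed.

Lemma cboundedD h k : cbounded h -> cbounded k -> cbounded (fun x => h x + k x).
Proof.
move=> [mh [B hB]] [mk [B' kB]]; split; first exact: cmeasurableD.
by exists (B + B') => x; apply: le_trans (cabsD _ _) _; exact: lerD.
Qed.

Lemma cboundedN h : cbounded h -> cbounded (fun x => - h x).
Proof.
move=> [mh [B hB]]; split; first exact: cmeasurableN.
by exists B => x; rewrite cabsN.
Qed.

Lemma cbounded_cst (w : R[i]^o) : cbounded (fun=> w).
Proof. by split; [exact: cmeasurable_cst|exists (cabs w)]. Qed.

Lemma cboundedM h k : cbounded h -> cbounded k -> cbounded (fun x => h x * k x).
Proof.
move=> [mh [B hB]] [mk [B' kB]]; split; first exact: cmeasurableM.
by exists (B * B') => x; rewrite cabsM; apply: ler_pM => //; exact: cabs_ge0.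
Qed.

Lemma cintegral_finite_le (mu : {finite_measure set T -> \bar R}) h (B : R) :
  cmeasurable h -> (forall x, cabs (h x) <= B) ->
  cabs (cintegral mu h) <= 2 * (B * fine (mu setT)).
Proof.
move=> mh hB.
have iB : mu.-integrable setT (EFin \o cst B) by exact: finite_measure_integrable_cst.
by have := cabs_cintegral_le mh iB hB; rewrite Rintegral_cst.
Qed.

Lemma cintegralB (mu : {measure set T -> \bar R}) h k : cintegrable mu h -> cintegrable mu k ->
  cintegrable mu (fun x => h x - k x) /\
  cintegral mu (fun x => h x - k x) = cintegral mu h - cintegral mu k.
Proof.
move=> ih ik; have iN := cintegrableM (-1) ik.
have -> : (fun x => h x - k x) = (fun x => h x + (-1) * k x).
  by apply/funext => x; rewrite mulN1r.
split; first exact: cintegrableD.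
by rewrite cintegralD // cintegralM // mulN1r.
Qed.

Definition jpos (nu : {charge set T -> \bar R}) : {finite_measure set T -> \bar R} :=
  jordan_pos (hahn_posneg nu).
Definition jneg (nu : {charge set T -> \bar R}) : {finite_measure set T -> \bar R} :=
  jordan_neg (hahn_posneg nu).

Lemma cm_integralE nu h : cm_integral nu h =
  (cintegral (jpos (cmeasure_re nu)) h - cintegral (jneg (cmeasure_re nu)) h) +
  (0 +i* 1) * (cintegral (jpos (cmeasure_im nu)) h - cintegral (jneg (cmeasure_im nu)) h).
Proof. by []. Qed.

Lemma cm_integralM nu (w : R[i]^o) h : cbounded h ->
  cm_integral nu (fun x => w * h x) = w * cm_integral nu h.
Proof.
move=> bh; rewrite !cm_integralE.
have ih mu := @cbounded_cintegrable mu h bh.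
rewrite !cintegralM //; ring.
Qed.

Lemma cm_integralB nu h k : cbounded h -> cbounded k ->
  cm_integral nu h - cm_integral nu k = cm_integral nu (fun x => h x - k x).
Proof.
move=> bh bk; rewrite !cm_integralE.
have BE (mu : {finite_measure set T -> \bar R}) :=
  (cintegralB (cbounded_cintegrable mu bh) (cbounded_cintegrable mu bk)).2.
rewrite !BE; ring.
Qed.

(** The constant is twice the total mass of the four Jordan parts; it lets uniform convergence of
    test functions pass to the integrals. *)
Lemma cm_integral_le nu : exists2 c : R, 0 <= c & forall h (B : R), cmeasurable h ->
  (forall x, cabs (h x) <= B) -> cabs (cm_integral nu h) <= c * B.
Proof.
pose s mu := fine ((mu : {finite_measure set T -> \bar R}) setT).
have s0 mu : 0 <= s mu by exact: fine_ge0.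
exists (2 * (s (jpos (cmeasure_re nu)) + s (jneg (cmeasure_re nu)) +
  (s (jpos (cmeasure_im nu)) + s (jneg (cmeasure_im nu))))).
  by rewrite mulr_ge0 // !addr_ge0.
move=> h B mh hB; rewrite cm_integralE.
have L mu := @cintegral_finite_le mu h B mh hB.
have D (x y : R[i]^o) (a b : R) : cabs x <= a -> cabs y <= b -> cabs (x - y) <= a + b.
  by move=> xa yb; apply: le_trans (cabsD _ _) _; rewrite cabsN lerD.
apply: le_trans (cabsD _ _) _; rewrite cabsM.
have -> : cabs (0 +i* 1 : R[i]^o) = 1 by rewrite /= expr0n expr1n add0r sqrtr1.
rewrite mul1r; apply: le_trans (lerD (D _ _ _ _ (L _) (L _)) (D _ _ _ _ (L _) (L _))) _.
rewrite -/(s _) -/(s _) -/(s _) -/(s _) le_eqVlt; apply/orP; left; apply/eqP; ring.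
Qed.

(** Integrability of [F] selects the branch of [cdensity] that is a true density; the four real
    integrals then come from [Rintegral_jordan]. *)
Lemma cm_integral_cdensity (mu : {finite_measure set T -> \bar R}) F h :
  cintegrable mu F -> cbounded h ->
  cm_integral (cdensity mu F) h = cintegral mu (fun x => h x * F x).
Proof.
move=> [iR iI] [[mR mI] [B hB]]; rewrite /cdensity.
case: pselect => [iR'|//]; case: pselect => [iI'|//].
have hR x : `|complex.Re (h x)| <= B by exact: le_trans (cabs_Re _) (hB x).
have hI x : `|complex.Im (h x)| <= B by exact: le_trans (cabs_Im _) (hB x).
rewrite /cm_integral /charge_integral /cintegral /=.
have JRR := Rintegral_jordan iR' mR hR; have JRI := Rintegral_jordan iR' mI hI.
have JIR := Rintegral_jordan iI' mR hR; have JII := Rintegral_jordan iI' mI hI.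
have iRR := integrable_bounded_mul mR hR iR; have iIR := integrable_bounded_mul mI hI iR.
have iRI := integrable_bounded_mul mR hR iI; have iII := integrable_bounded_mul mI hI iI.
under [X in _ = X +i* _]eq_Rintegral do rewrite ReM.
under [X in _ = _ +i* X]eq_Rintegral do rewrite ImM.
rewrite (RintegralB measurableT iRR iII) (RintegralD measurableT iRI iIR).
rewrite -JRR -JRI -JIR -JII.
have E (p1 p2 p3 p4 q1 q2 q3 q4 : R) :
    (p1 +i* p2) - (p3 +i* p4) + (0 +i* 1) * ((q1 +i* q2) - (q3 +i* q4)) =
    (p1 - p3 - (q2 - q4)) +i* (q1 - q3 + (p2 - p4)).
  by apply/eqP; rewrite eq_complex /=; apply/andP; split; apply/eqP; ring.
exact: E.
Qed.

End complex_measures.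

(** * Fubini for a finite measure and a complex measure *)

Section complex_measure_fubini.
Context {d1 d2 : measure_display} {T1 : measurableType d1} {T2 : measurableType d2}.
Context {R : realType}.
Variables (mu : {finite_measure set T1 -> \bar R}) (nu : cmeasure T2 R).
Variables (K : T1 * T2 -> R[i]^o) (B : R).
Hypotheses (mK : cmeasurable K) (KB : forall p, cabs (K p) <= B).

Lemma cbounded_section x : cbounded (fun y => K (x, y)).
Proof.
case: mK => mR mI; split; last by exists B.
by split; [exact: (measurableT_comp mR (pair1_measurable x))|
  exact: (measurableT_comp mI (pair1_measurable x))].
Qed.

Let bint (la : {finite_measure set T2 -> \bar R}) :
  cbounded (fun x => cintegral la (fun y => K (x, y))).
Proof.
split; first exact: cmeasurable_parametric_integral.
exists (2 * (B * fine (la setT))) => x; have [m1 _] := cbounded_section x.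
exact: cintegral_finite_le.
Qed.

Lemma cbounded_cm_integral : cbounded (fun x => cm_integral nu (fun y => K (x, y))).
Proof.
have bB la la' := cboundedD (@bint la) (cboundedN (@bint la')).
exact: (cboundedD (bB _ _) (cboundedM (cbounded_cst _) (bB _ _))).
Qed.

Lemma cm_integral_fubini :
  cintegral mu (fun x => cm_integral nu (fun y => K (x, y))) =
  cm_integral nu (fun y => cintegral mu (fun x => K (x, y))).
Proof.
have fub la := @cintegral_fubini _ _ T1 T2 R mu la K B mK KB.
have ib la := cbounded_cintegrable mu (@bint la).
have BE la la' := cintegralB (ib la) (ib la').
rewrite cm_integralE.
under eq_fun do rewrite cm_integralE.
have [i1 e1] := BE (jpos (cmeasure_re nu)) (jneg (cmeasure_re nu)).
have [i2 e2] := BE (jpos (cmeasure_im nu)) (jneg (cmeasure_im nu)).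
rewrite cintegralD //; last exact: cintegrableM.
by rewrite cintegralM // e1 e2 !fub.
Qed.

End complex_measure_fubini.

(** * [Lp] membership and averages against [Q] *)

Section Lp_and_kernel_averages.
Variable R : realType.
Notation C := (circle R).
Notation m := (mT R).
Implicit Types (g : C -> R[i]^o) (p : R) (k : C -> R).

Lemma measurable_cabs_powR g p : cmeasurable g ->
  measurable_fun setT (fun xi => cabs (g xi) `^ p).
Proof.
move=> mg; apply: (measurableT_comp (f := (@powR R)^~ p)) => //.
exact: cmeasurable_cabs.
Qed.

(** Trades the norm for integrability of [|g| ^ p], the form in which domination arguments apply. *)
Lemma LpP g p : 0 < p -> Lp p%:E g <-> cmeasurable g /\
  m.-integrable setT (EFin \o (fun xi => cabs (g xi) `^ p)).
Proof.
move=> p0; have absE xi : (`|(cabs (g xi))%:E| `^ p)%E = (cabs (g xi) `^ p)%:E.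
  by rewrite abse_EFin ger0_norm ?cabs_ge0 // poweR_EFin.
have NE : (Lnorm m p%:E (fun xi => (cabs (g xi))%:E) `^ p)%E =
    (\int[m]_xi (cabs (g xi) `^ p)%:E)%E.
  rewrite poweR_Lnorm; last by rewrite gt_eqF.
  by apply: eq_integral => xi _; rewrite absE.
split=> [[/measurable_cfunP mg fin]|[mg ig]].
- split=> //; apply/integrableP; split.
    by apply/measurable_EFinP; exact: measurable_cabs_powR.
  under eq_integral do rewrite /= ger0_norm ?powR_ge0 //.
  by rewrite -NE; apply: poweR_lty.
- split; first exact/measurable_cfunP.
  rewrite unlock; apply: poweR_lty; under eq_integral do rewrite absE.
  by apply: integrable_lty.
Qed.

(** [t <= 1 + t ^ p], and the circle has finite measure. *)
Lemma Lp_cintegrable g p : 1 <= p -> Lp p%:E g -> cintegrable m g.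
Proof.
move=> p1; have p0 : 0 < p by exact: lt_le_trans p1.
move=> /(LpP _ p0)[mg ig].
have i1 : m.-integrable setT (EFin \o (cst 1 : C -> R)) by exact: finite_measure_integrable_cst.
apply: (cintegrable_le mg (integrableD measurableT i1 ig)) => xi.
by apply: le1D_powR => //; exact: cabs_ge0.
Qed.

Definition Qmean (a r : R) k (xi : C) : R :=
  \int[m]_xi' (Q a (r%:C * set_val xi) xi' * k xi').

Lemma measurable_QM_prod a r k : 0 <= r < 1 -> measurable_fun setT k ->
  measurable_fun setT (fun q : C * C => Q a (r%:C * set_val q.1) q.2 * k q.2).
Proof.
move=> r01 mk; apply: measurable_funM; first exact: measurable_Q_prod.
exact: measurableT_comp.
Qed.

Lemma Qmean_ge0 a r k xi : 0 <= r < 1 -> (forall xi, 0 <= k xi) -> 0 <= Qmean a r k xi.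
Proof.
move=> /andP[r0 r1] k0; apply: Rintegral_ge0 => xi' _.
by rewrite mulr_ge0 // ltW // Q_gt0 // cabs_radius.
Qed.

(* Q (r xi) xi' is symmetric in xi and xi', so averaging preserves the integral. *)
Lemma integral_Qmean a r k : 0 <= r < 1 -> (forall xi, 0 <= k xi) ->
  m.-integrable setT (EFin \o k) ->
  m.-integrable setT (EFin \o Qmean a r k) /\ \int[m]_xi Qmean a r k xi = \int[m]_xi k xi.
Proof.
move=> r01 k0 ik; have /andP[r0 r1] := r01.
have mk : measurable_fun setT k by apply/measurable_EFinP; exact: measurable_int ik.
have mQk := measurable_QM_prod a r01 mk.
have z1 (xi : C) : cabs (r%:C * set_val xi : R[i]^o) < 1 by rewrite cabs_radius.
have iQk xi := integrable_QM a (z1 xi) ik.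
have QE xi : (Qmean a r k xi)%:E =
    (\int[m]_xi' (Q a (r%:C * set_val xi) xi' * k xi')%:E)%E.
  by rewrite /Qmean /Rintegral fineK //; exact: (integrable_fin_num measurableT (iQk xi)).
have mA : measurable_fun setT (fun xi => (Qmean a r k xi)%:E).
  have := @measurable_parametric_integral _ _ C C R m _ (proj2 (measurable_EFinP _ _) mQk).
  by apply: eq_measurable_fun => xi _; rewrite QE.
have E : (\int[m]_xi (Qmean a r k xi)%:E = \int[m]_xi (k xi)%:E)%E.
  under eq_integral do rewrite QE.
  have := @fubini_tonelli _ _ C C R m m
    (fun q => (Q a (r%:C * set_val q.1) q.2 * k q.2)%:E) _ _.
  move=> /= ->; last 2 first.
  - exact/measurable_EFinP.
  - by move=> [xi xi'] /=; rewrite lee_fin mulr_ge0 // ltW // Q_gt0.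
  apply: eq_integral => xi' _.
  under eq_integral => xi _ do rewrite (Q_sym a _ _ r0) mulrC EFinM.
  rewrite ge0_integralZl //; last 3 first.
  - by apply/measurable_EFinP; exact: measurable_Q.
  - by move=> xi _; rewrite lee_fin ltW // Q_gt0.
  - by rewrite lee_fin.
  rewrite -[X in (_ * X)%E]fineK; last exact: (integrable_fin_num measurableT (integrable_Q a (z1 xi'))).
  by rewrite -/(Rintegral _ _ _) integral_Q // mule1.
split; last by rewrite /Rintegral E.
apply/integrableP; split=> //.
under eq_integral do rewrite /= ger0_norm ?Qmean_ge0 //.
by rewrite E; apply: integrable_lty.
Qed.

(** As [Q] has total mass one, [Qmean a r k xi - k xi] is the average of [k - k xi], which
    [ae_kernel_average] controls. *)
Lemma ae_Qmean_cvg a k : 2^-1 <= a -> m.-integrable setT (EFin \o k) ->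
  {ae m, forall xi, Qmean a r k xi @[r --> (1 : R)^'-] --> k xi}.
Proof.
move=> a2 ik; apply: filterS (ae_kernel_average a2 ik) => xi h.
apply/cvgrPdist_le => eps eps0; near=> r.
have /andP[r0 r1] : 0 <= r < 1 by near: r; exact: near1_01.
have z1 : cabs (r%:C * set_val xi : R[i]^o) < 1 by rewrite cabs_radius.
have b : \int[m]_xi' (Q a (r%:C * set_val xi) xi' * `|k xi' - k xi|) <= eps.
  by near: r; exact: h.
apply: le_trans b; rewrite distrC.
have ic : m.-integrable setT (EFin \o cst (- k xi)) by exact: finite_measure_integrable_cst.
have i1 := integrable_QM a z1 ik; have i2 := integrable_QM a z1 ic.
have ikc : m.-integrable setT (EFin \o (fun xi' => k xi' - k xi)) := integrableD measurableT ik ic.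
have -> : Qmean a r k xi - k xi = \int[m]_xi' (Q a (r%:C * set_val xi) xi' * (k xi' - k xi)).
  under [RHS]eq_Rintegral do rewrite mulrDr.
  by rewrite (RintegralD measurableT i1 i2) RintegralZr ?integral_Q ?mul1r //; exact: integrable_Q.
have i3 := integrable_QM a z1 ikc.
apply: le_trans (le_normr_Rintegral measurableT i3) _.
rewrite le_eqVlt; apply/orP; left; apply/eqP; apply: eq_Rintegral => xi' _.
by rewrite normrM ger0_norm // ltW // Q_gt0.
Unshelve. all: by end_near. Qed.

End Lp_and_kernel_averages.

(** * Radial limits in mean, in the weak* sense, and for measures *)

Section radial_limits.
Variables (R : realType) (n : nat) (lam : R[i]^o).
Hypothesis hlam : ~ (complex.Im lam = 0 /\ complex.Re lam < - 4^-1).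
Notation C := (circle R).
Notation m := (mT R).
Implicit Types (g h : C -> R[i]^o) (p r : R) (nu : cmeasure C R).

Lemma cmeasurable_radial g r : 0 <= r < 1 -> cmeasurable g ->
  cmeasurable (radial n lam (Pi_fun n lam g) r).
Proof.
move=> r01 mg; have [F [a [K [cF a2 K0 PF ker]]]] := kernel_estimate n hlam.
have := cmeasurable_cfun_lnP cF r01 => mF.
have mg2 : cmeasurable (fun q : C * C => g q.2).
  by case: mg => mR mI; split; [exact: (measurableT_comp mR measurable_snd)|exact: (measurableT_comp mI measurable_snd)].
have := cmeasurable_parametric_integral m (cmeasurableM mF mg2) => mP.
have := cmeasurableM mP (cmeasurable_cst (Phi n lam r%:C)^-1).
by rewrite /radial /Pi_fun; under [in X in _ -> X]eq_fun do under eq_fun do rewrite PF.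
Qed.

Lemma radial_le g : cintegrable m g ->
  exists (a c : R), [/\ 2^-1 <= a, 0 < c & \forall r \near (1 : R)^'-, 0 <= r < 1 /\
    forall xi, cabs (radial n lam (Pi_fun n lam g) r xi) <=
      c * Qmean a r (fun xi' => cabs (g xi')) xi].
Proof.
move=> ig; have [a [c [a2 c0 h]]] := radial_quotient_le n hlam.
exists a, c; split => //; apply: filterS h => r [r01 hr]; split=> // xi.
have := hr g xi 0 ig; rewrite subr0.
by under eq_Rintegral do rewrite subr0.
Qed.

Lemma radial_powR_le g p : 1 <= p -> Lp p%:E g ->
  exists (a c : R), [/\ 2^-1 <= a, 0 <= c & \forall r \near (1 : R)^'-, 0 <= r < 1 /\
    forall xi, cabs (radial n lam (Pi_fun n lam g) r xi) `^ p <=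
      c * Qmean a r (fun xi' => cabs (g xi') `^ p) xi].
Proof.
move=> p1 Lg; have p0 : 0 < p by exact: lt_le_trans p1.
have ig := Lp_cintegrable p1 Lg; have [mg igp] := (LpP g p0).1 Lg.
have [a [c [a2 c0 h]]] := radial_le ig.
exists a, (c `^ p); split => //; first exact: powR_ge0.
apply: filterS h => r [r01 h]; split=> // xi; have /andP[r0 r1] := r01.
have z1 : cabs (r%:C * set_val xi : R[i]^o) < 1 by rewrite cabs_radius.
have q0 : 0 <= Qmean a r (fun xi' => cabs (g xi')) xi.
  by apply: Qmean_ge0 => // xi'; exact: cabs_ge0.
apply: (@le_trans _ _ ((c * Qmean a r (fun xi' => cabs (g xi')) xi) `^ p)).
  apply: ge0_ler_powR (h xi); rewrite ?nnegrE ?cabs_ge0 //; first exact: ltW.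
  by rewrite mulr_ge0 // ltW.
rewrite powRM //; last exact: ltW.
rewrite ler_wpM2l ?powR_ge0 //.
apply: jensen_powR => //.
- by move=> xi'; rewrite ltW // Q_gt0.
- by move=> xi'; exact: cabs_ge0.
- exact: integrable_Q.
- exact: integral_Q.
- exact: (integrable_QM a z1 (integrable_cabs ig)).
- exact: (integrable_QM a z1 igp).
Qed.

Lemma radial_Lp g p : 1 <= p -> Lp p%:E g ->
  \forall r \near (1 : R)^'-, Lp p%:E (radial n lam (Pi_fun n lam g) r).
Proof.
move=> p1 Lg; have p0 : 0 < p by exact: lt_le_trans p1.
have [mg igp] := (LpP g p0).1 Lg.
have [a [c [a2 c0 h]]] := radial_powR_le p1 Lg.
apply: filterS h => r [r01 h]; apply/(LpP _ p0).
have mr := cmeasurable_radial r01 mg; split=> //.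
have [iQ _] := integral_Qmean a r01 (fun xi => powR_ge0 (cabs (g xi)) p) igp.
apply: (le_integrable measurableT _ _ (integrableZl measurableT c iQ)) => //.
  by apply/measurable_EFinP; exact: measurable_cabs_powR.
move=> xi _; rewrite /= lee_fin ger0_norm ?powR_ge0 //.
exact: le_trans (h xi) (ler_norm _).
Qed.

Lemma radial_cvg_powR g p : 1 <= p -> Lp p%:E g ->
  \int[m]_xi (cabs (radial n lam (Pi_fun n lam g) r xi - g xi) `^ p)
    @[r --> (1 : R)^'-] --> (0 : R).
Proof.
move=> p1 Lg; have p0 : 0 < p by exact: lt_le_trans p1.
have p0' := ltW p0.
have ig := Lp_cintegrable p1 Lg; have [mg igp] := (LpP g p0).1 Lg.
have [a [c [a2 c0 h]]] := radial_powR_le p1 Lg.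
set k := fun xi => cabs (g xi) `^ p in igp.
have k0 xi : 0 <= k xi by exact: powR_ge0.
apply: (cvg_left_seq h) => u uN' uN1.
pose b := 2 `^ p.
(* The majorants come from [|x - y| ^ p <= 2 ^ p (|x| ^ p + |y| ^ p)]. Their integral does not
   depend on [j] by [integral_Qmean], and they tend to [G] almost everywhere by [ae_Qmean_cvg]. *)
pose G_ j xi := b * (c * Qmean a (u j) k xi + k xi).
pose G xi := b * (c * k xi + k xi).
have iQ j := integral_Qmean a (uN' j).1 k0 igp.
have i1 j := integrableZl measurableT c (iQ j).1.
have i2 := integrableZl measurableT c igp.
have iG_ j : m.-integrable setT (EFin \o G_ j).
  exact: (integrableZl measurableT b (integrableD measurableT (i1 j) igp)).
have iG : m.-integrable setT (EFin \o G).
  exact: (integrableZl measurableT b (integrableD measurableT i2 igp)).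
apply: (dominated_cvg0_varying (f := fun j xi =>
  cabs (radial n lam (Pi_fun n lam g) (u j) xi - g xi) `^ p) _ iG_ iG) => //.
- move=> j; apply: measurable_cabs_powR; apply: cmeasurableD.
    exact: (cmeasurable_radial (uN' j).1 mg).
  exact: cmeasurableN.
- move=> j xi; rewrite powR_ge0 /=.
  apply: le_trans (cabsB_powR_le _ _ p1) _; rewrite ler_wpM2l ?powR_ge0 //.
  by rewrite lerD2r; exact: (uN' j).2.
- by move=> xi; rewrite /G mulr_ge0 ?powR_ge0 ?addr_ge0 ?mulr_ge0.
- move=> j; rewrite /G_ /G.
  rewrite (RintegralZl _ measurableT (integrableD measurableT (i1 j) igp)).
  rewrite (RintegralZl _ measurableT (integrableD measurableT i2 igp)).
  rewrite (RintegralD measurableT (i1 j) igp) (RintegralD measurableT i2 igp).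
  rewrite (RintegralZl _ measurableT (iQ j).1) (RintegralZl _ measurableT igp).
  by rewrite (iQ j).2.
- apply: filterS (radial_ae n hlam ig) => xi cxi; apply: powR_cvg0 => //.
    by move=> j; exact: cabs_ge0.
  apply/cvgrPdist_lt => eps eps0.
  have /cvgcP/(_ _ eps0) := cvg_comp _ _ uN1 cxi.
  by apply: filterS => j; rewrite sub0r normrN ger0_norm // cabs_ge0.
- apply: filterS (ae_Qmean_cvg a2 igp) => xi cxi.
  apply: cvgM; first exact: cvg_cst.
  apply: cvgD; last exact: cvg_cst.
  apply: cvgM; first exact: cvg_cst.
  exact: (cvg_comp _ _ uN1 cxi).
Qed.

Lemma radial_Lp_cvg g p : 1 <= p -> Lp p%:E g -> Lp_cvg p%:E (radial n lam (Pi_fun n lam g)) g.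
Proof.
move=> p1 Lg; have p0 : 0 < p by exact: lt_le_trans p1.
split; first exact: radial_Lp.
have cN := radial_cvg_powR p1 Lg.
pose N r := \int[m]_xi (cabs (radial n lam (Pi_fun n lam g) r xi - g xi) `^ p).
have N0 r : 0 <= N r by apply: Rintegral_ge0 => xi _; exact: powR_ge0.
have NE r : Lp p%:E (radial n lam (Pi_fun n lam g) r) ->
    (N r `^ p^-1)%:E =
    Lnorm m p%:E (fun xi => (cabs (radial n lam (Pi_fun n lam g) r xi - g xi))%:E).
  move=> /(LpP _ p0)[mr ir]; have [mg ig] := (LpP g p0).1 Lg.
  have md : cmeasurable (fun xi => radial n lam (Pi_fun n lam g) r xi - g xi).
    by apply: cmeasurableD => //; exact: cmeasurableN.
  have iD : m.-integrable setT
      (EFin \o (fun xi => cabs (radial n lam (Pi_fun n lam g) r xi - g xi) `^ p)).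
    apply: (le_integrable measurableT _ _
      (integrableZl measurableT (2 `^ p) (integrableD measurableT ir ig))).
      by apply/measurable_EFinP; exact: measurable_cabs_powR.
    move=> xi _; rewrite /= lee_fin ger0_norm ?powR_ge0 //.
    by apply: le_trans (cabsB_powR_le _ _ p1) (ler_norm _).
  rewrite unlock -poweR_EFin; congr (_ `^ _)%E.
  rewrite /N /Rintegral fineK; last exact: (integrable_fin_num measurableT iD).
  apply: eq_integral => xi _.
  by rewrite abse_EFin ger0_norm ?cabs_ge0 // poweR_EFin.
have cP : N r `^ p^-1 @[r --> (1 : R)^'-] --> (0 : R).
  apply/cvgrPdist_le => eps eps0.
  have ep0 : 0 < eps `^ p by rewrite powR_gt0.
  have /cvgrPdist_lt/(_ _ ep0) := cN; apply: filterS => r.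
  rewrite -/(N r) !sub0r !normrN !ger0_norm ?powR_ge0 // => Nr.
  apply: (@le_trans _ _ ((eps `^ p) `^ p^-1)).
    by apply: ge0_ler_powR; rewrite ?nnegrE ?invr_ge0 ?powR_ge0 // ltW.
  by rewrite -powRrM divff ?gt_eqF // powRr1 // ltW.
have cE : (N r `^ p^-1)%:E @[r --> (1 : R)^'-] --> 0%E.
  by apply: cvg_EFin => //; apply: nearW.
apply: cvg_trans cE; apply: near_eq_cvg.
by apply: filterS (radial_Lp p1 Lg) => r /NE.
Qed.

Lemma LinftyP g : Lp +oo%E g <->
  cmeasurable g /\ exists B : R, {ae m, forall xi, cabs (g xi) <= B}.
Proof.
have m0 : (0 < m setT)%E by rewrite probability_setT.
have absE xi : (abse \o (fun xi => (cabs (g xi))%:E)) xi = (cabs (g xi))%:E.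
  by rewrite /= ger0_norm // cabs_ge0.
split=> [[/measurable_cfunP mg]|[mg [B gB]]].
- rewrite unlock m0 => fin; split=> //.
  have [M MP] : exists M, {ae m, forall xi, `|cabs (g xi)| <= M}.
    exact: (@ess_sup_inf.ess_supr_bounded _ _ _ m (fun xi => `|cabs (g xi)|) fin).
  by exists M; apply: filterS MP => xi; rewrite ger0_norm // cabs_ge0.
- split; first exact/measurable_cfunP.
  rewrite unlock m0; apply: (@le_lt_trans _ _ B%:E); last exact: ltry.
  by apply/ess_sup_inf.ess_supP; apply: filterS gB => xi gxi; rewrite absE lee_fin.
Qed.

Lemma Linfty_cintegrable g : Lp +oo%E g -> cintegrable m g.
Proof.
move=> /LinftyP[mg [B gB]].
have L1 : Lp 1%:E g.
  apply/LpP => //; split => //; apply/integrableP; split.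
    by apply/measurable_EFinP; exact: measurable_cabs_powR.
  under eq_integral do rewrite /= ger0_norm ?powR_ge0 // powRr1 ?cabs_ge0 //.
  apply: (@le_lt_trans _ _ (\int[m]_xi (cst `|B|%:E xi))%E); last first.
    by rewrite integral_cst // lte_mul_pinfty // ltey_eq fin_num_measure.
  apply: ae_ge0_le_integral => //.
  - by move=> xi _; rewrite lee_fin cabs_ge0.
  - by apply/measurable_EFinP; exact: cmeasurable_cabs.
  - by move=> xi _; rewrite lee_fin.
  - by apply: filterS gB => xi gxi _; rewrite lee_fin (le_trans gxi) // ler_norm.
exact: (Lp_cintegrable (lexx 1) L1).
Qed.

(** The bound holds at every [xi], although [k] is bounded only almost everywhere, because averaging
    ignores null sets. *)
Lemma Qmean_le_ae a r (k : C -> R) (B : R) xi : 0 <= r < 1 -> 0 <= B ->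
  (forall xi, 0 <= k xi) -> m.-integrable setT (EFin \o k) ->
  {ae m, forall xi, k xi <= B} -> Qmean a r k xi <= B.
Proof.
move=> /andP[r0 r1] B0 k0 ik kB.
have z1 : cabs (r%:C * set_val xi : R[i]^o) < 1 by rewrite cabs_radius.
have i1 := integrable_QM a z1 ik.
have iB : m.-integrable setT (EFin \o cst `|B|) by exact: finite_measure_integrable_cst.
have i2 := integrable_QM a z1 iB.


have <- : \int[m]_xi' (Q a (r%:C * set_val xi) xi' * cst `|B| xi') = B.
  by rewrite RintegralZr ?integral_Q ?mul1r ?ger0_norm //; exact: integrable_Q.
rewrite /Qmean /Rintegral fine_le //; [exact: (integrable_fin_num measurableT i1)|exact: (integrable_fin_num measurableT i2)|].
apply: ae_ge0_le_integral => //.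
- by move=> xi' _; rewrite lee_fin mulr_ge0 // ltW // Q_gt0.
- exact: measurable_int i1.
- by move=> xi' _; rewrite lee_fin mulr_ge0 // ltW // Q_gt0.
- exact: measurable_int i2.
- apply: filterS kB => xi' kxi _; rewrite lee_fin ler_wpM2l ?(ltW (Q_gt0 _ _ _)) //.
  exact: le_trans kxi (ler_norm _).
Qed.

Lemma radial_Linfty g : Lp +oo%E g -> exists B : R,
  \forall r \near (1 : R)^'-, 0 <= r < 1 /\
    forall xi, cabs (radial n lam (Pi_fun n lam g) r xi) <= B.
Proof.
move=> Lg; have ig := Linfty_cintegrable Lg.
have [mg [B gB]] := (LinftyP g).1 Lg.
have [a [c [a2 c0 h]]] := radial_le ig.
exists (c * `|B|); apply: filterS h => r [r01 h]; split=> // xi.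
apply: le_trans (h xi) _; rewrite ler_wpM2l ?(ltW c0) //.
apply: Qmean_le_ae => //.
- by move=> xi'; exact: cabs_ge0.
- exact: integrable_cabs.
- by apply: filterS gB => xi' gxi; exact: le_trans gxi (ler_norm _).
Qed.

(** Near radius 1 the quotients are bounded by one constant [B], so [B |h|] dominates the products
    with [h] and almost everywhere convergence suffices. *)
Lemma radial_weakstar g : Lp +oo%E g ->
  Linfty_weakstar_cvg (radial n lam (Pi_fun n lam g)) g.
Proof.
move=> Lg; have ig := Linfty_cintegrable Lg.
have [mg _] := (LinftyP g).1 Lg; have [B FB] := radial_Linfty Lg.
split.
  apply: filterS FB => r [r01 b]; apply/LinftyP; split.
    exact: cmeasurable_radial.
  by exists B; exact: nearW.
move=> h Lh; have [mh _] := (LpP h ltr01).1 Lh.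
have ih := Lp_cintegrable (lexx 1) Lh.
apply: (cintegral_dominated_cvg_left (k := fun xi => B * cabs (h xi))).
- apply: filterS FB => r [r01 b]; split.
    by apply: cmeasurableM => //; exact: cmeasurable_radial.
  by move=> xi; rewrite cabsM mulrC ler_wpM2r ?cabs_ge0.
- exact: cmeasurableM.
- exact: (integrableZl measurableT B (integrable_cabs ih)).
- by apply: filterS (radial_ae n hlam ig) => xi; exact: cvgcMl.
Qed.

(** A function of both boundary points, so that it can be integrated in either of them. *)
Definition radial_kernel (r : R) (q : C * C) : R[i]^o :=
  Pn n lam (r%:C * set_val q.1) q.2 / Phi n lam r%:C.

Lemma radial_kernel_bounded : \forall r \near (1 : R)^'-,
  [/\ 0 <= r < 1, cmeasurable (radial_kernel r) &
      exists B : R, forall q, cabs (radial_kernel r q) <= B].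
Proof.
have [F [a [K [cF a2 K0 PF ker]]]] := kernel_estimate n hlam.
apply: filterS2 ker (near1_01 R) => r kr r01; have /andP[r0 r1] := r01.
split; first exact: r01.
  have -> : radial_kernel r =
      (fun q => F (lnP (r%:C * set_val q.1) q.2) * (Phi n lam r%:C)^-1).
    by apply/funext => q; rewrite /radial_kernel PF.
  by apply: cmeasurableM; [exact: cmeasurable_cfun_lnP|exact: cmeasurable_cst].
exists (K * (expR (a * hrad r) / J a r)) => -[xi xi'].
have zr : cabs (r%:C * set_val xi : R[i]^o) = r by exact: cabs_radius.
have [_ PhiE PQ] := kr _ zr.
rewrite /radial_kernel /= -PhiE; apply: le_trans (PQ xi') _.
apply: ler_wpM2l; first exact: ltW.
rewrite /Q zr; apply: ler_wpM2r; first by rewrite invr_ge0; apply: ltW; exact: J_gt0.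
rewrite ler_expR; apply: ler_wpM2l; first exact: le_trans a2.
by have /andP[] := lnP_le r01 xi' zr.
Qed.

Lemma radial_Pi_measE nu (r : R) : cmeasurable (radial_kernel r) ->
  (exists B : R, forall q, cabs (radial_kernel r q) <= B) -> Phi n lam r%:C != 0 ->
  radial n lam (Pi_meas n lam nu) r =
  (fun xi => cm_integral nu (fun xi' => radial_kernel r (xi, xi'))).
Proof.
move=> mK [B KB] Phi0; apply/funext => xi; rewrite /radial /Pi_meas.
have bK := cbounded_section mK KB xi.
have -> : Pn n lam (r%:C * set_val xi) =
    (fun xi' => Phi n lam r%:C * radial_kernel r (xi, xi')).
  by apply/funext => xi'; rewrite /radial_kernel /= [RHS]mulrC divfK.
by rewrite cm_integralM // mulrAC divff // mul1r.
Qed.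

Lemma radial_kernel_sym (r : R) xi xi' : radial_kernel r (xi, xi') = radial_kernel r (xi', xi).
Proof.
have [F [a [K [_ _ _ PF _]]]] := kernel_estimate n hlam.
by rewrite /radial_kernel /= !PF lnP_sym.
Qed.

Lemma near1_Phi : \forall r \near (1 : R)^'-, Phi n lam r%:C != 0.
Proof.
have [F [a [K [_ _ _ _ ker]]]] := kernel_estimate n hlam.
apply: filterS2 ker (near1_01 R) => r kr /andP[r0 _].
by case: (kr r%:C (cabs_real r0)).
Qed.

Lemma cbounded_radial_meas nu : \forall r \near (1 : R)^'-,
  cbounded (radial n lam (Pi_meas n lam nu) r).
Proof.
apply: filterS2 radial_kernel_bounded near1_Phi => r [r01 mK KB] Phi0.
rewrite radial_Pi_measE //; case: KB => B KB.
exact: (cbounded_cm_integral nu mK KB).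
Qed.

Lemma radial_meas_Lp1 nu : \forall r \near (1 : R)^'-,
  Lp 1%E (radial n lam (Pi_meas n lam nu) r).
Proof.
apply: filterS (cbounded_radial_meas nu) => r bF; have [mF _] := bF.
apply/(LpP _ ltr01); split=> //.
have := integrable_cabs (cbounded_cintegrable m bF).
by apply: eq_integrable => // xi _; rewrite /= powRr1 // cabs_ge0.
Qed.

(** Duality: after Fubini, the symmetry of the kernel turns the transform of [nu] tested against [h]
    into the transform of [h] integrated against [nu]. *)
Lemma cm_integral_radial_meas nu h : continuous h -> \forall r \near (1 : R)^'-,
  cm_integral (cdensity m (radial n lam (Pi_meas n lam nu) r)) h =
  cm_integral nu (radial n lam (Pi_fun n lam h) r).
Proof.
move=> ch; have bh : cbounded h.
  have [B _ hB] := continuous_cabs_bounded ch.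
  by split; [exact: continuous_circle_cmeasurable|exists B].
have [mh [Bh hB]] := bh.
apply: filterS (filterI (filterI radial_kernel_bounded near1_Phi) (cbounded_radial_meas nu)).
move=> r [[[r01 mK [B KB]] Phi0] bF].
rewrite (cm_integral_cdensity (cbounded_cintegrable m bF) bh).
rewrite radial_Pi_measE //; last by exists B.
pose K q := h q.1 * radial_kernel r q.
have mh1 : cmeasurable (fun q : C * C => h q.1).
  by case: mh => mR mI; split; [exact: (measurableT_comp mR measurable_fst)|
    exact: (measurableT_comp mI measurable_fst)].
have mK' : cmeasurable K by exact: cmeasurableM.
have KB' q : cabs (K q) <= Bh * B by rewrite cabsM; apply: ler_pM => //; exact: cabs_ge0.
transitivity (cintegral m (fun xi => cm_integral nu (fun xi' => K (xi, xi')))).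
  congr cintegral; apply/funext => xi; rewrite /K /= cm_integralM //.
  exact: cbounded_section.
rewrite (cm_integral_fubini m nu mK' KB').
congr cm_integral; apply/funext => xi'; rewrite /radial /Pi_fun /K /=.
transitivity (cintegral m (fun xi => (Phi n lam r%:C)^-1 * (Pn n lam (r%:C * set_val xi') xi * h xi))).
  congr cintegral; apply/funext => xi; rewrite radial_kernel_sym /radial_kernel /=.
  by rewrite mulrC mulrAC [LHS]mulrC.
have [F [a [KK [cF _ _ PF _]]]] := kernel_estimate n hlam.
have /andP[r0 r1] := r01.
have z1 : cabs (r%:C * set_val xi' : R[i]^o) < 1 by rewrite cabs_radius.
have [BP BP0 PB] := Pn_bounded cF PF z1.
have bP : cbounded (Pn n lam (r%:C * set_val xi')).
  by split; [exact: (cmeasurable_Pn cF PF z1)|exists BP].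
by rewrite cintegralM; [rewrite mulrC|exact: cbounded_cintegrable (cboundedM bP bh)].
Qed.

(** By duality the difference is the [nu]-integral of [radial h - h], which is uniformly small by
    the case of continuous functions. *)
Lemma radial_meas_cvg nu :
  measure_weakstar_cvg (fun r => cdensity m (radial n lam (Pi_meas n lam nu) r)) nu.
Proof.
move=> h ch; have bh : cbounded h.
  have [B _ hB] := continuous_cabs_bounded ch.
  by split; [exact: continuous_circle_cmeasurable|exists B].
have [mh [Bh hB]] := bh.
apply/cvgcP => eps eps0.
have [c c0 hc] := cm_integral_le nu.
(* With [c + 1] in place of [c] the quotient makes sense for [c = 0] and the final bound is
   strict. *)
have e0 : 0 < eps / (c + 1) by rewrite divr_gt0 // ltr_wpDl.
near=> r.
have r01 : 0 <= r < 1 by near: r; exact: near1_01.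
have ru : forall xi, cabs (radial n lam (Pi_fun n lam h) r xi - h xi) < eps / (c + 1).
  by near: r; exact: radial_uniform.
have -> : cm_integral (cdensity m (radial n lam (Pi_meas n lam nu) r)) h =
    cm_integral nu (radial n lam (Pi_fun n lam h) r).
  by near: r; exact: cm_integral_radial_meas.
have mr := cmeasurable_radial r01 mh.
have br : cbounded (radial n lam (Pi_fun n lam h) r).
  split=> //; exists (eps / (c + 1) + Bh) => xi.
  rewrite -[radial _ _ _ _ _](subrK (h xi)).
  by apply: le_trans (cabsD _ _) _; apply: lerD => //; exact: ltW.
rewrite (cm_integralB nu br bh).
apply: le_lt_trans (hc _ (eps / (c + 1)) _ _) _.
- by have [] := cboundedD br (cboundedN bh).
- by move=> xi; exact: ltW.
- by rewrite mulrCA gtr_pMr // ltr_pdivrMr ?ltr_wpDl // mul1r ltrDl.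
Unshelve. all: by end_near. Qed.

End radial_limits.

(** [hlam] says that [lam] is not on the ray [(-oo, -1/4)]. In (iv) membership in [L^1] is asserted
    as well, because [cdensity] is zero by convention for a function that is not integrable; near
    radius 1 the measures are thus true densities. *)
Theorem proposition4p6 (R : realType) (n : nat) (lam : R[i]^o)
    (hlam : ~ (complex.Im lam = 0 /\ complex.Re lam < - 4^-1)) :
  (* (i) *)
  (forall g : circle R -> R[i]^o, continuous g ->
     (forall xi : circle R,
        Pi_fun n lam g z / Phi n lam z
          @[z --> within (@disk R) (nbhs (set_val xi : R[i]^o))] --> g xi) /\
     {uniform, radial n lam (Pi_fun n lam g) @ 1^'- --> g}) /\
  (* (ii) *)
  (forall (p : R) (g : circle R -> R[i]^o), 1 <= p -> Lp p%:E g ->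
     {ae mT R, forall xi : circle R,
        radial n lam (Pi_fun n lam g) r xi @[r --> 1^'-] --> g xi} /\
     Lp_cvg p%:E (radial n lam (Pi_fun n lam g)) g) /\
  (* (iii) *)
  (forall g : circle R -> R[i]^o, Lp +oo%E g ->
     Linfty_weakstar_cvg (radial n lam (Pi_fun n lam g)) g) /\
  (* (iv) *)
  (forall nu : cmeasure (circle R) R,
     (\forall r \near 1^'-, Lp 1%E (radial n lam (Pi_meas n lam nu) r)) /\
     measure_weakstar_cvg
       (fun r => cdensity (mT R) (radial n lam (Pi_meas n lam nu) r)) nu).
Proof.
split.
  move=> g cg; split; last exact: radial_cvg_uniform.
  by move=> xi; exact: Pi_quotient_cvg.
split.
  move=> p g p1 Lg; split; last exact: radial_Lp_cvg.
  exact: (radial_ae n hlam (Lp_cintegrable p1 Lg)).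
split; first by move=> g; exact: radial_weakstar.
by move=> nu; split; [exact: radial_meas_Lp1|exact: radial_meas_cvg].
Qed.
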